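(* Let $d\ge1$ be an integer. The set $\{A\in\mathbf{K}([0,1]^d) : A \text{ is a Salem set}\}$ is $\boldsymbol\Pi^0_3$-complete.
   Context: $\mathbf{K}([0,1]^d)$ is the space of compact subsets of $[0,1]^d$ (including $\emptyset$) with the Vietoris topology, i.e. the topology generated by the sets $\{F : F\cap C=\emptyset\}$ ($C$ closed) and $\{F: F\cap U\neq\emptyset\}$ ($U$ open); it is Polish. For $A\subset\mathbb{R}^d$, the Hausdorff dimension is $\dim_{\mathcal H}(A)=\sup\{s\ge 0:\mathcal H^s(A)>0\}$, where $\mathcal H^s$ is $s$-dimensional Hausdorff measure. $\mathbb{P}(A)$ denotes the set of Borel probability measures on $\mathbb{R}^d$ with support included in $A$; $\widehat\mu(\xi)=\int_{\mathbb{R}^d} e^{-i\,\xi\cdot x}\,d\mu(x)$. The Fourier dimension (relative to the ambient space $\mathbb{R}^d$) is $\dim_{\mathrm F}(A)=\sup\{s\in[0,d] : (\exists\mu\in\mathbb{P}(A))(\exists c>0)(\forall x\in\mathbb{R}^d, x\ne 0)\ |\widehat\mu(x)|\le c|x|^{-s/2}\}$. Convention: $\sup\emptyset=0$ in both definitions. $A$ is a Salem set if $\dim_{\mathcal H}(A)=\dim_{\mathrm F}(A)$. Borel hierarchy: $\boldsymbol\Sigma^0_1$ are the open sets, $\boldsymbol\Pi^0_1$ the closed sets; $\boldsymbol\Sigma^0_\xi$ sets ($\xi>1$) are countable unions of sets each in some $\boldsymbol\Pi^0_{\eta}$ with $\eta<\xi$; $\boldsymbol\Pi^0_\xi$ sets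 are complements of $\boldsymbol\Sigma^0_\xi$ sets. For $A\subset X$, $B\subset Y$ write $A\le_W B$ if there is a continuous $f:X\to Y$ with $x\in A\iff f(x)\in B$. For $Y$ Polish, $B\subset Y$ is $\boldsymbol\Gamma$-hard if $A\le_W B$ for every $A\in\boldsymbol\Gamma(X)$ and every Polish $X$ having a basis of clopen sets; it is $\boldsymbol\Gamma$-complete if it is $\boldsymbol\Gamma$-hard and $B\in\boldsymbol\Gamma(Y)$. *)

(* Defs.v *)
From HB Require Import structures.
From mathcomp Require Import all_boot all_order all_algebra.
From mathcomp Require Import all_classical all_reals all_analysis.
From mathcomp Require Import complex.

Set Implicit Arguments.
Unset Strict Implicit.
Unset Printing Implicit Defensive.

Import Order.TTheory GRing.Theory Num.Theory.
Import numFieldNormedType.Exports.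

Local Open Scope classical_set_scope.
Local Open Scope ring_scope.

(** * The Borel hierarchy (finite levels) and Wadge reducibility *)

(* [Sigma0 n] is empty for [n = 0], so the pointclasses eta < n met in the
   second rule all have eta >= 1. *)
Inductive Sigma0 (T : topologicalType) : nat -> set T -> Prop :=
| Sigma0_open (A : set T) : open A -> Sigma0 1 A
| Sigma0_bigcup (n : nat) (eta : nat -> nat) (F : nat -> set T) :
    (1 < n)%N -> (forall i, (eta i < n)%N) ->
    (forall i, Sigma0 (eta i) (~` F i)) -> Sigma0 n (\bigcup_i F i).

Definition Pi0 (n : nat) (T : topologicalType) (A : set T) : Prop :=
  Sigma0 n (~` A).

Definition wadge_le (X Y : topologicalType) (A : set X) (B : set Y) : Prop :=
  exists2 f : X -> Y, continuous f & forall x, A x <-> B (f x).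

Definition homeomorphic (X Y : topologicalType) : Prop :=
  exists (f : X -> Y) (g : Y -> X),
    [/\ continuous f, continuous g, cancel f g & cancel g f].

Definition complete_space (M : uniformType) : Prop :=
  forall F : set_system M, ProperFilter F -> cauchy F ->
  exists l : M, F --> l.

Definition polish (R : realType) (X : topologicalType) : Prop :=
  (exists2 D : set X, countable D & dense D) /\
  (exists2 M : metricType R, complete_space M & homeomorphic X M).

(* Stronger than the library's [zero_dimensional], which only asks that
   distinct points be separated by a clopen set. *)
Definition has_clopen_basis (X : topologicalType) : Prop :=
  exists2 B : set (set X), basis B & B `<=` clopen.

Definition pointclass := forall X : topologicalType, set X -> Prop.

Definition hard (R : realType) (Gamma : pointclass)
    (Y : topologicalType) (B : set Y) : Prop :=
  forall X : topologicalType, polish R X -> has_clopen_basis X ->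
  forall A : set X, Gamma X A -> wadge_le A B.

Definition pointclass_complete (R : realType) (Gamma : pointclass)
    (Y : topologicalType) (B : set Y) : Prop :=
  hard R Gamma B /\ Gamma Y B.

(** * The hyperspace of compact sets with the Vietoris topology *)

Definition hyperspace (T : topologicalType) : Type := {A : set T | compact A}.

HB.instance Definition _ (T : topologicalType) := gen_eqMixin (hyperspace T).
HB.instance Definition _ (T : topologicalType) :=
  gen_choiceMixin (hyperspace T).

Definition vietoris_subbase (T : topologicalType) :
    set (set (hyperspace T)) :=
  [set V | (exists2 C : set T, closed C &
              V = [set F | sval F `&` C = set0]) \/
           (exists2 U : set T, open U &
              V = [set F | sval F `&` U !=set0])].

HB.instance Definition _ (T : topologicalType) :=
  @isSubBaseTopological.Build (hyperspace T) (set (hyperspace T))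
    (@vietoris_subbase T) id.

(** * Hausdorff and Fourier dimension in R^d *)

(* The topology on ['rV[R]_d] is the usual one, but the library norm on it is
   the sup norm, hence the explicit Euclidean norm. *)
Definition dotp (R : realType) (d : nat) (x y : 'rV[R]_d) : R :=
  \sum_(i < d) x ord0 i * y ord0 i.

Definition enorm (R : realType) (d : nat) (x : 'rV[R]_d) : R :=
  Num.sqrt (dotp x x).

Definition unit_cube (R : realType) (d : nat) : set 'rV[R]_d :=
  [set x | forall i, 0 <= x ord0 i <= 1].
Arguments unit_cube : clear implicits.

(* Equals [-oo] on the empty set. *)
Definition diam (R : realType) (d : nat) (U : set 'rV[R]_d) : \bar R :=
  ereal_sup [set (enorm (p.1 - p.2))%:E | p in U `*` U].

(* diam(U)^s with 0^0 = 1 for nonempty U, and the value 0 for U empty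
   (also when s = 0). *)
Definition diam_pow (R : realType) (d : nat) (s : R) (U : set 'rV[R]_d) :
    \bar R :=
  if U == set0 then 0%E else poweR (diam U) s.

Definition hausdorff_premeasure (R : realType) (d : nat) (s delta : R)
    (A : set 'rV[R]_d) : \bar R :=
  ereal_inf [set (\sum_(0 <= i <oo) diam_pow s (U i))%E |
    U in [set U : nat -> set 'rV[R]_d |
      A `<=` \bigcup_i U i /\ forall i, (diam (U i) <= delta%:E)%E]].

Definition hausdorff_measure (R : realType) (d : nat) (s : R)
    (A : set 'rV[R]_d) : \bar R :=
  ereal_sup [set hausdorff_premeasure s delta A |
    delta in [set delta : R | 0 < delta]].

(* The real [sup] is 0 on the empty set; it would also be 0 on an unbounded
   set, but here the set is bounded by [d]. *)
Definition hausdorff_dim (R : realType) (d : nat) (A : set 'rV[R]_d) : R :=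
  sup [set s : R | 0 <= s /\ (0 < hausdorff_measure s A)%E].

Definition borel_rV (R : realType) (d : nat) :=
  g_sigma_algebraType (@open 'rV[R]_d).

Definition msupport (R : realType) (d : nat)
    (mu : probability (borel_rV R d) R) : set 'rV[R]_d :=
  [set x | forall U : set 'rV[R]_d, open U -> U x -> (0 < mu U)%E].

Definition cexp_i (R : realType) (t : R) : R[i] := Complex (cos t) (sin t).

Definition cintegral (R : realType) (d : nat)
    (mu : probability (borel_rV R d) R) (f : 'rV[R]_d -> R[i]) : R[i] :=
  Complex (Rintegral mu setT (fun x : borel_rV R d => complex.Re (f x)))
          (Rintegral mu setT (fun x : borel_rV R d => complex.Im (f x))).

Definition fourier (R : realType) (d : nat)
    (mu : probability (borel_rV R d) R) (xi : 'rV[R]_d) : R[i] :=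
  cintegral mu (fun x => cexp_i (- dotp xi x)).

Definition fourier_dim (R : realType) (d : nat) (A : set 'rV[R]_d) : R :=
  sup [set s : R | 0 <= s <= d%:R /\
    exists mu : probability (borel_rV R d) R, msupport mu `<=` A /\
    exists c : R, 0 < c /\
    forall x : 'rV[R]_d, x != 0 ->
      ComplexField.Normc.normc (fourier mu x) <= c * enorm x `^ (- s / 2)].

Definition salem (R : realType) (d : nat) (A : set 'rV[R]_d) : Prop :=
  hausdorff_dim A = fourier_dim A.

(* An element of [hyperspace (set_type (unit_cube R d))] is a compact subset of the
   subspace [0,1]^d; it is viewed in R^d through the inclusion. *)
Definition salem_sets (R : realType) (d : nat) :
    set (hyperspace (set_type (unit_cube R d))) :=
  [set K | salem (set_val @` sval K)].
Arguments salem_sets : clear implicits.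

(* Main.v *)
From HB Require Import structures.
Require Import Defs.
From mathcomp Require Import all_boot all_order all_algebra.
From mathcomp Require Import all_classical all_reals all_analysis.
From mathcomp Require Import measurable_realfun borel_hierarchy complex ring lra zify.

Set Implicit Arguments.
Unset Strict Implicit.
Unset Printing Implicit Defensive.

Import Order.TTheory GRing.Theory Num.Theory.
Import numFieldNormedType.Exports.

Local Open Scope classical_set_scope.
Local Open Scope ring_scope.

(** The set of Salem sets is in [Pi^0_3] because both dimensions are lower
    semicontinuous up to countable unions: for [p >= 0] the sets [dim > p] are
    F-sigma in the hyperspace, and so are its open sets, so that the coincidence
    set of the two dimensions is [Pi^0_3] ([Pi0_eq]). For the Hausdorff dimension
    one uses covers by sets of arbitrary size: that all covers of [K] have
    [s]-dimensional weight at least [e] is a closed condition on the compact set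
    [K], since a cover violating it can be enlarged to an open cover
    ([closed_content]). For the Fourier dimension one uses weak compactness: that
    [K] carries a measure with [|mu^(xi)| <= c |xi|^(-s/2)] is a closed condition
    for fixed [c] and [s] ([weak_limit], [closed_carries]).

    For the hardness, a [Pi^0_3] set of a zero-dimensional Polish space is given by
    a matrix of bits depending continuously on the point, which belongs to the set
    when no row has infinitely many raised bits ([Pi0_3_bits]); one may assume that
    all the rows after an infinite one are infinite. The [m]-th row drives the
    construction of a compact set [piece m]; the set coded by the matrix is the
    union of these pieces, which shrink to the origin, and of a fixed compact set
    [gap_set]. It depends continuously on the bits, and it is a Salem set exactly
    when all the rows are finite.

    The fixed set consists of the points whose coordinates have a vanishing binary
    digit in the positions 1, 4, 9, ... counted from 0: its Hausdorff dimension is [d], because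
    the prescribed positions are sparse ([gap_set_content]), but it is null for
    every measure with a Fourier decay, because [sin] is nonnegative on it at a
    sparse sequence of frequencies ([gap_set_null]). So the coded sets always have
    Hausdorff dimension [d], and the fixed set does not contribute to the Fourier
    dimension.

    The pieces are limits of finite clouds of points ([tree_set]). Given a cloud
    and a displacement bound [rho], [extend_cloud] makes a new cloud near the
    former one whose exponential sums are those of the former cloud damped at
    frequencies beyond [1 / rho], up to an error that is tiny compared with the
    desired decay; the new points are samples of a convolution, and they are chosen
    deterministically by the method of exponential moments. As long as [rho] is of
    the size dictated by the resolution of the cloud, this produces in the limit a
    measure whose decay exponent is close to [d] ([tree_measure]). A raised bit
    makes [rho] smaller than any fixed power of the inverse of the number of points:
    if this happens infinitely often, the limit set has lower box dimension zero, and
    a Fejer kernel argument shows that it is null for every measure with a Fourier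
    decay ([fejer_null], [tree_null_often]). In any case the [m]-th piece has lower
    box dimension at most some [q_m < d], up to a countable set, so it is null for
    decays faster than [q_m] ([tree_null]).

    Hence if all rows are finite, the pieces have Fourier dimensions tending to [d]
    and the coded set is Salem. If the rows from [M] on are infinite, a measure with
    a decay faster than [q_M] charges neither the fixed set, nor the pieces before
    [M], nor those after: the Fourier dimension of the coded set is at most
    [q_M < d]. *)

(** * Bounded measurable functions and trigonometric integrals *)

Lemma small_inv (R : archiRealFieldType) (e : R) : 0 < e -> exists n, n.+1%:R^-1 < e.
Proof.
move=> e0; exists (Num.truncn e^-1); rewrite invf_plt ?posrE ?ltr0Sn //.
exact: truncnS_gt.
Qed.

Section BoundedMeasurable.
Context d (T : measurableType d) (R : realType).
Implicit Types (h : T -> R) (P : probability T R).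

Definition bounded_mfun h :=
  measurable_fun [set: T] h /\ exists M, forall x, `|h x| <= M.

Lemma bounded_mfun_integrable P (D : set T) h :
  measurable D -> bounded_mfun h -> P.-integrable D (EFin \o h).
Proof.
move=> mD [mh [M hM]]; apply: measurable_bounded_integrable => //.
- by apply: (le_lt_trans (probability_le1 _ mD)); rewrite ltry.
- exact: measurable_funTS.
- exists M; split; first exact: num_real.
  by move=> m Mm x _ /=; apply: (le_trans (hM x)); exact: ltW.
Qed.

Lemma bounded_mfun_cst (c : R) : bounded_mfun (fun=> c).
Proof. by split=> //; exists `|c|. Qed.

Lemma bounded_mfunD h1 h2 :
  bounded_mfun h1 -> bounded_mfun h2 -> bounded_mfun (fun x => h1 x + h2 x).
Proof.
move=> [m1 [M1 h1M]] [m2 [M2 h2M]]; split; first exact: measurable_funD.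
by exists (M1 + M2) => x; rewrite (le_trans (ler_normD _ _)) // lerD.
Qed.

Lemma bounded_mfunM h1 h2 :
  bounded_mfun h1 -> bounded_mfun h2 -> bounded_mfun (fun x => h1 x * h2 x).
Proof.
move=> [m1 [M1 h1M]] [m2 [M2 h2M]]; split; first exact: measurable_funM.
by exists (M1 * M2) => x; rewrite normrM ler_pM.
Qed.

Lemma bounded_mfunB h1 h2 :
  bounded_mfun h1 -> bounded_mfun h2 -> bounded_mfun (fun x => h1 x - h2 x).
Proof.
move=> [m1 [M1 h1M]] [m2 [M2 h2M]]; split; first exact: measurable_funB.
by exists (M1 + M2) => x; rewrite (le_trans (ler_normB _ _)) // lerD.
Qed.

Lemma bounded_mfun_sum (I : Type) (s : seq I) (f : I -> T -> R) :
  (forall i, bounded_mfun (f i)) -> bounded_mfun (fun x => \sum_(i <- s) f i x).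
Proof.
move=> bf; elim: s => [|i s IHs].
  by under eq_fun do rewrite big_nil; exact: bounded_mfun_cst.
by under eq_fun do rewrite big_cons; exact: bounded_mfunD.
Qed.

Lemma Rintegral_sum P (D : set T) (I : Type) (s : seq I) (f : I -> T -> R) :
  measurable D -> (forall i, bounded_mfun (f i)) ->
  \int[P]_(x in D) (\sum_(i <- s) f i x) = \sum_(i <- s) \int[P]_(x in D) f i x.
Proof.
move=> mD bf; elim: s => [|i s IHs].
  rewrite big_nil; under eq_Rintegral do rewrite big_nil.
  by rewrite Rintegral_cst // mul0r.
rewrite big_cons -IHs; under eq_Rintegral do rewrite big_cons.
by rewrite RintegralD //; apply: bounded_mfun_integrable => //; exact: bounded_mfun_sum.
Qed.

Lemma Rintegral_prob_cst P (c : R) : \int[P]_x c = c.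
Proof.
rewrite Rintegral_cst //; set p := fine _.
by have -> : p = 1 by [exact: (congr1 fine (probability_setT P))]; rewrite mulr1.
Qed.

Lemma le_Rintegral_prob P h1 h2 : bounded_mfun h1 -> bounded_mfun h2 ->
  (forall x, h1 x <= h2 x) -> \int[P]_x h1 x <= \int[P]_x h2 x.
Proof. by move=> b1 b2 h12; apply: le_Rintegral => //; exact: bounded_mfun_integrable. Qed.

Lemma bounded_mfun_norm h : bounded_mfun h -> bounded_mfun (fun x => `|h x|).
Proof.
move=> [mh [M hM]]; split; first exact: measurableT_comp.
by exists M => x; rewrite normr_id.
Qed.

Lemma bounded_mfun_indic (A : set T) : measurable A -> bounded_mfun (\1_A : T -> R).
Proof.
move=> mA; split; first exact: measurable_indic.
by exists 1 => x; rewrite indicE; case: (_ \in _); rewrite ?normr1 ?normr0.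
Qed.

Lemma Rintegral_indic P (A : set T) : measurable A ->
  \int[P]_x (\1_A x : R) = fine (P A).
Proof. by move=> mA; rewrite /Rintegral integral_indic // setIT. Qed.

Lemma Rintegral_norm_le P h (M : R) :
  measurable_fun setT h -> (forall x, `|h x| <= M) -> `|\int[P]_x h x| <= M.
Proof.
move=> mh hM; have bh : bounded_mfun h by split=> //; exists M.
apply: (le_trans (le_normr_Rintegral _ _)) => //; first exact: bounded_mfun_integrable.
rewrite -[leRHS](Rintegral_prob_cst P); apply: le_Rintegral_prob => //.
  exact: bounded_mfun_norm.
exact: bounded_mfun_cst.
Qed.

(** Only the values on a set of full measure matter for the bound; elsewhere the
    function is merely bounded. *)
Lemma Rintegral_norm_le_full P (A : set T) h (c : R) :
  measurable A -> P A = 1%E -> bounded_mfun h -> (forall x, A x -> `|h x| <= c) ->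
  `|\int[P]_x h x| <= c.
Proof.
move=> mA PA [mh [M hM]] hc; have bh : bounded_mfun h by split=> //; exists M.
have PAC : fine (P (~` A)) = 0 by rewrite probability_setC // PA subee.
apply: (le_trans (le_normr_Rintegral _ _)) => //; first exact: bounded_mfun_integrable.
have bI : bounded_mfun (fun x => M * \1_(~` A) x).
  by apply: bounded_mfunM; [exact: bounded_mfun_cst|apply: bounded_mfun_indic; exact: measurableC].
apply: (@le_trans _ _ (\int[P]_x (c + M * \1_(~` A) x))).
  apply: le_Rintegral_prob => [||x]; first exact: bounded_mfun_norm.
    by apply: bounded_mfunD => //; exact: bounded_mfun_cst.
  have M0 : 0 <= M by exact: le_trans (hM x).
  have [Ax|nAx] := pselect (A x); first by rewrite indicE memNset ?mulr0 ?addr0 ?hc.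
  rewrite indicE mem_set // mulr1.
  have [y Ay] : exists y, A y.
    apply/not_existsP => nA; have A0 : A = set0 by apply/seteqP; split=> // y /nA.
    by have := PA; rewrite A0 measure0 => /eqP; rewrite eqe eq_sym oner_eq0.
  by rewrite ler_wpDl // (le_trans _ (hc y Ay)).
rewrite RintegralD //; last 2 first.
- by apply: bounded_mfun_integrable => //; exact: bounded_mfun_cst.
- exact: bounded_mfun_integrable.
rewrite Rintegral_prob_cst RintegralZl //; last first.
  by apply: bounded_mfun_integrable => //; apply: bounded_mfun_indic; exact: measurableC.
by rewrite Rintegral_indic ?PAC ?mulr0 ?addr0 //; exact: measurableC.
Qed.

(** Functions constant on the parts of a finite measurable partition, the parts
    being labelled by [phi]: integrals over covers are estimated through them. *)
Section FiniteRange.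
Variables (phi : T -> nat) (N : nat) (H : nat -> R).
Hypothesis phiN : forall x, (phi x < N)%N.
Hypothesis mphi : forall j, measurable [set x | phi x = j].

Let finite_rangeE : (fun x => H (phi x)) =
  (fun x => \sum_(j < N) H j * \1_[set x | phi x = j] x).
Proof.
apply/funext => x.
rewrite (bigD1 (Ordinal (phiN x))) //= indicE mem_set // mulr1 big1 ?addr0 //.
move=> j jx; rewrite indicE memNset ?mulr0 //= => xj.
by case/negP: jx; apply/eqP/val_inj.
Qed.

Let bounded_term (j : 'I_N) : bounded_mfun (fun x => H j * \1_[set x | phi x = j] x).
Proof.
by apply: bounded_mfunM; [exact: bounded_mfun_cst|exact: bounded_mfun_indic].
Qed.

Lemma bounded_mfun_finite_range : bounded_mfun (fun x => H (phi x)).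
Proof. by rewrite finite_rangeE; exact: bounded_mfun_sum bounded_term. Qed.

Lemma Rintegral_finite_range P :
  \int[P]_x H (phi x) = \sum_(j < N) H j * fine (P [set x | phi x = j]).
Proof.
rewrite finite_rangeE Rintegral_sum //; apply: eq_bigr => j _.
rewrite RintegralZl //; first by rewrite Rintegral_indic.
by apply: bounded_mfun_integrable => //; exact: bounded_mfun_indic.
Qed.
End FiniteRange.

End BoundedMeasurable.

Section Borel.
Variables (R : realType) (d : nat).
Local Notation V := 'rV[R]_d.
Local Notation BV := (borel_rV R d).

Lemma open_borel (U : set V) : open U -> measurable (U : set BV).
Proof. by move=> oU; apply: sub_sigma_algebra. Qed.

Lemma closed_borel (C : set V) : closed C -> measurable (C : set BV).
Proof.
move=> cC; rewrite -[C]setCK; apply: measurableC.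
by apply: open_borel; apply: closed_openC.
Qed.

Lemma continuous_borel (h : V -> R) :
  continuous h -> measurable_fun [set: BV] (h : BV -> R).
Proof.
move=> ch; apply: (measurability _ (RGenOpens.measurableE R)).
move=> _ [_ [a [b ->]] <-]; rewrite setTI.
apply: open_borel; move/continuousP: ch; apply.
exact: interval_open.
Qed.

Lemma prob_fin_num (mu : probability BV R) (A : set BV) :
  measurable A -> mu A \is a fin_num.
Proof. by move=> mA; exact: fin_num_measure. Qed.

Lemma ball_rVP (x y : V) (e : R) : 0 < e ->
  ball x e y <-> forall i, `|x ord0 i - y ord0 i| < e.
Proof.
move=> e0; split; first by move=> [_ xy] i; have := xy ord0 i.
by move=> xy; split=> // i j; rewrite ord1; exact: xy.
Qed.

Lemma coord_le_norm (x : V) (i : 'I_d) : `|x ord0 i| <= `|x|.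
Proof.
rewrite [leRHS]/Num.norm /= mx_normrE.
by apply/bigmax_geP; right => /=; exists (ord0, i).
Qed.

Lemma norm_le_coord (x : V) (M : R) : 0 <= M ->
  (forall i, `|x ord0 i| <= M) -> `|x| <= M.
Proof.
move=> M0 xM; rewrite [leLHS]/Num.norm /= mx_normrE.
by apply/bigmax_leP; split=> // -[i j] _; rewrite ord1.
Qed.

Lemma rat_ball (x : V) (U : set V) : open U -> U x ->
  exists (q : {ffun 'I_d -> rat}) (n : nat),
    ball (\row_i (ratr (q i) : R) : V) n.+1%:R^-1 x /\
    ball (\row_i (ratr (q i) : R) : V) n.+1%:R^-1 `<=` U.
Proof.
move=> oU Ux; have /nbhs_ballP[e /= e0 xeU] : nbhs x U by exact: open_nbhs_nbhs.
have [n ne] : exists n, n.+1%:R^-1 < e / 2.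
  by apply: small_inv; rewrite divr_gt0.
have n0 : 0 < n.+1%:R^-1 :> R by rewrite invr_gt0.
have qP i : exists q : rat, `|ratr q - x ord0 i| < n.+1%:R^-1.
  have /rat_in_itvoo[q /itvP qre] : x ord0 i < x ord0 i + n.+1%:R^-1 by rewrite ltrDl.
  exists q; rewrite ltr_distl qre andbT.
  by rewrite ltrBlDr (lt_trans (y := x ord0 i + n.+1%:R^-1)) ?qre // ltrD2r qre.
pose q := [ffun i => projT1 (cid (qP i))].
exists q, n; split.
  apply/ball_rVP => // i; rewrite mxE ffunE; exact: projT2 (cid (qP i)).
move=> y /ball_rVP-/(_ n0) yq; apply: xeU; apply/ball_rVP => // i.
have := yq i; rewrite mxE ffunE.
have := projT2 (cid (qP i)); set r := ratr _ => h1 h2.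
have -> : x ord0 i - y ord0 i = (r - y ord0 i) - (r - x ord0 i) by ring.
apply: (le_lt_trans (ler_normB _ _)); rewrite [e]splitr.
by apply: ltrD; [exact: lt_trans h2 ne|exact: lt_trans h1 ne].
Qed.

(** Every point outside of the support has a null neighbourhood, which may be taken
    among countably many rational balls. *)
Lemma msupport_compl_null (mu : probability BV R) : mu (~` msupport mu) = 0%E.
Proof.
pose B (p : {ffun 'I_d -> rat} * nat) : set V :=
  ball (\row_i (ratr (p.1 i) : R) : V) p.2.+1%:R^-1.
pose F (n : nat) : set BV :=
  if unpickle n is Some p then if mu (B p) == 0%E then B p else set0 else set0.
have oF n : open (F n : set V).
  rewrite /F; case: unpickle => [p|]; last exact: open0.
  by case: ifP => _; [exact: ball_open|exact: open0].
have -> : ~` msupport mu = \bigcup_n F n.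
  apply/seteqP; split => x.
    move=> /existsNP[U] /not_implyP[oU] /not_implyP[Ux] /negP.
    rewrite -leNgt => muU0.
    have [q [n [qx qU]]] := rat_ball oU Ux.
    exists (pickle (q, n)) => //; rewrite /F pickleK ifT //.
    rewrite eq_le measure_ge0 andbT (le_trans _ muU0) //.
    by apply: le_measure => //; rewrite inE; apply: open_borel => //; exact: ball_open.
  move=> [n _] Fx; apply/existsNP; exists (F n); apply/not_implyP; split; first exact: oF.
  apply/not_implyP; split=> //; apply/negP; rewrite -leNgt /F.
  case: unpickle => [p|]; last by rewrite measure0.
  by case: ifPn => [/eqP|_]; [move=> -> |rewrite measure0].
have mF n : measurable (F n) by apply: open_borel; exact: oF.
apply/(negligibleP _).
  exact: bigcup_measurable.
apply: negligible_bigcup => n; apply/(negligibleP _) => //.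
rewrite /F; case: unpickle => [p|]; last by rewrite measure0.
by case: ifPn => [/eqP|_]; [exact|rewrite measure0].
Qed.

End Borel.

Section Cube.
Variables (R : realType) (d : nat).

Lemma closed_cube : closed (unit_cube R d).
Proof.
rewrite (_ : unit_cube R d = \bigcap_(i in [set: 'I_d])
    [set x : 'rV[R]_d | x ord0 i \in `[0%R, 1%R]]); last first.
  by apply/seteqP; split=> x H i => [_|]; have := H i; rewrite /= in_itv /=; apply.
apply: closed_bigI => i _.
apply: (@preimage_closed _ _ (fun x : 'rV[R]_d => x ord0 i) [set` `[0%R, 1%R]]).
  by move=> x _; exact: coord_continuous.
exact: itv_closed.
Qed.

Lemma measurable_cube : measurable (unit_cube R d : set (borel_rV R d)).
Proof. by apply: closed_borel; exact: closed_cube. Qed.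
End Cube.

Section Trig.
Variable R : realType.
Implicit Types a b : R.

Lemma sin_lip a b : `|sin a - sin b| <= `|a - b|.
Proof.
wlog ab : a b / b < a.
  move=> H; have [/H//|/H|->] := ltgtP b a; last by rewrite !subrr.
  by rewrite distrC (distrC a).
have dsin x : x \in `]b, a[%R -> is_derive x 1 sin (cos x) by move=> _; exact: is_derive_sin.
have csin : {within `[b, a], continuous (@sin R)}.
  by apply: continuous_subspaceT => x; exact: continuous_sin.
by have [c _ ->] := MVT ab dsin csin; rewrite normrM ler_piMl // cos_max.
Qed.

Lemma cos_lip a b : `|cos a - cos b| <= `|a - b|.
Proof.
rewrite -!sinDpihalf; apply: (le_trans (sin_lip _ _)).
by rewrite le_eqVlt (_ : a + _ - _ = a - b) ?eqxx //; ring.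
Qed.
End Trig.

Section Fourier.
Variables (R : realType) (d : nat).
Local Notation V := 'rV[R]_d.
Local Notation BV := (borel_rV R d).
Implicit Types (x y xi : V) (mu : probability BV R).

Lemma dotpDr xi x y : dotp xi (x + y) = dotp xi x + dotp xi y.
Proof. by rewrite /dotp -big_split; apply: eq_bigr => i _; rewrite mxE mulrDr. Qed.

Lemma dotpC x y : dotp x y = dotp y x.
Proof. by apply: eq_bigr => i _; rewrite mulrC. Qed.

Lemma dotpDl xi x y : dotp (x + y) xi = dotp x xi + dotp y xi.
Proof. by rewrite dotpC dotpDr !(dotpC xi). Qed.

Lemma dotpNr xi x : dotp xi (- x) = - dotp xi x.
Proof. by rewrite /dotp -sumrN; apply: eq_bigr => i _; rewrite mxE mulrN. Qed.

Lemma dotpBr xi x y : dotp xi (x - y) = dotp xi x - dotp xi y.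
Proof. by rewrite dotpDr dotpNr. Qed.

Lemma dotpBl xi x y : dotp (x - y) xi = dotp x xi - dotp y xi.
Proof. by rewrite dotpC dotpBr !(dotpC xi). Qed.

Lemma dotpZr xi (a : R) x : dotp xi (a *: x) = a * dotp xi x.
Proof. by rewrite /dotp mulr_sumr; apply: eq_bigr => i _; rewrite mxE mulrCA. Qed.

Lemma dotp_ub xi x : `|dotp xi x| <= d%:R * `|xi| * `|x|.
Proof.
apply: (le_trans (ler_norm_sum _ _ _)).
apply: (@le_trans _ _ (\sum_(i < d) (`|xi| * `|x|))).
  by apply: ler_sum => i _; rewrite normrM ler_pM // coord_le_norm.
by rewrite sumr_const card_ord -mulrA mulr_natl.
Qed.

Lemma lip_continuous (h : V -> R) (K : R) :
  (forall x y, `|h x - h y| <= K * `|x - y|) -> continuous h.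
Proof.
move=> hK x; have FF := nbhs_filter x.
apply/(@cvgrPdist_lt R R V (nbhs x) FF h (h x)) => e e0.
have K1 : 0 < `|K| + 1 by rewrite ltr_wpDl.
have r0 : 0 < e / (`|K| + 1) by rewrite divr_gt0.
near=> y.
apply: (le_lt_trans (hK _ _)).
apply: (@le_lt_trans _ _ ((`|K| + 1) * `|x - y|)).
  by rewrite ler_wpM2r // ler_wpDr // ler_norm.
rewrite -ltr_pdivlMl // mulrC.
near: y; have := @nbhsx_ballx R V x _ r0.
by rewrite -ball_normE.
Unshelve. all: by end_near. Qed.

Lemma cos_dotp_lip xi x y :
  `|cos (dotp xi x) - cos (dotp xi y)| <= d%:R * `|xi| * `|x - y|.
Proof. by apply: (le_trans (cos_lip _ _)); rewrite -dotpBr; exact: dotp_ub. Qed.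

Lemma sin_dotp_lip xi x y :
  `|sin (dotp xi x) - sin (dotp xi y)| <= d%:R * `|xi| * `|x - y|.
Proof. by apply: (le_trans (sin_lip _ _)); rewrite -dotpBr; exact: dotp_ub. Qed.

Lemma lip_bounded_borel (h : V -> R) (K M : R) :
  (forall x y, `|h x - h y| <= K * `|x - y|) -> (forall x, `|h x| <= M) ->
  bounded_mfun (h : BV -> R).
Proof.
move=> hK hM; split; last by exists M.
by apply: continuous_borel; exact: (lip_continuous hK).
Qed.

Lemma cos_dotp_bounded xi : bounded_mfun (fun x : BV => cos (dotp xi x)).
Proof. exact: (lip_bounded_borel (cos_dotp_lip xi) (fun x => cos_max _)). Qed.

Lemma sin_dotp_bounded xi : bounded_mfun (fun x : BV => sin (dotp xi x)).
Proof. exact: (lip_bounded_borel (sin_dotp_lip xi) (fun x => sin_max _)). Qed.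

Definition cosint mu xi : R := \int[mu]_x cos (dotp xi x).
Definition sinint mu xi : R := \int[mu]_x sin (dotp xi x).

Lemma normc_fourier mu xi : ComplexField.Normc.normc (fourier mu xi) =
  Num.sqrt (cosint mu xi ^+ 2 + sinint mu xi ^+ 2).
Proof.
rewrite /fourier /cintegral /=; congr (Num.sqrt (_ ^+ 2 + _)).
  by apply: eq_Rintegral => x _; rewrite cosN.
rewrite -sqrrN; congr (_ ^+ 2).
rewrite -mulN1r -RintegralZl //.
  by apply: eq_Rintegral => x _; rewrite sinN mulN1r opprK.
apply: bounded_mfun_integrable => //.
have [h1 [M hM]] := sin_dotp_bounded xi; split; last first.
  by exists M => x; rewrite sinN normrN.
rewrite (_ : (fun _ => _) = (fun x : BV => - sin (dotp xi x))).
  exact: measurableT_comp.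
by apply/funext => x; rewrite sinN.
Qed.

End Fourier.

(** * Weak compactness of the probability measures on the cube *)

Section Bisection.
Variables (R : realType) (d : nat).
Local Notation V := 'rV[R]_d.
Local Notation BV := (borel_rV R d).

(** The unit cube is bisected repeatedly, at level [k] in the direction [k mod d],
    and the cell [j] of a level has the halves [j.*2] and [j.*2.+1]. All the cells
    of a level are translates of each other, with sides [width k i]. *)
Fixpoint width (k i : nat) : R :=
  if k is k'.+1 then
    if i == (k' %% d)%N then width k' i / 2 else width k' i
  else 1.

Fixpoint corner (k j : nat) : V :=
  if k is k'.+1 then
    corner k' j./2 + \row_i (if odd j && (i == k' %% d :> nat)%N
                             then width k' i / 2 else 0)
  else 0.

Definition in_cell (k j : nat) (x : V) : Prop :=
  forall i, corner k j ord0 i <= x ord0 i <= corner k j ord0 i + width k i.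

Lemma width_gt0 k i : 0 < width k i.
Proof. by elim: k => [|k IHk] //=; case: ifP => _; rewrite ?divr_gt0. Qed.

Lemma in_cellS k j x : in_cell k.+1 j x -> in_cell k j./2 x.
Proof.
move=> xj i; have := xj i; rewrite /= !mxE; have := width_gt0 k i.
by case: (odd j); case: eqP => _ /= w0 /andP[]; lra.
Qed.

Lemma corner_in_cell k j : in_cell k j (corner k j).
Proof. by move=> i; rewrite lexx lerDl ltW ?width_gt0. Qed.

Lemma width_small (hd : (0 < d)%N) (e : R) : 0 < e ->
  exists k, forall i : 'I_d, width k i <= e.
Proof.
move=> e0.
have H n r (i : 'I_d) : (r <= d)%N ->
    width (n * d + r) i = 2^-1 ^+ (n + (i < r)%N).
  have step m r' : width (m * d) i = 2^-1 ^+ m -> (r' <= d)%N ->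
      width (m * d + r') i = 2^-1 ^+ (m + (i < r')%N).
    move=> m0; elim: r' => [_|r' IHr rd]; first by rewrite !addn0.
    rewrite addnS /= modnMDl modn_small // IHr ?(ltnW rd) // ltnS.
    by case: ltngtP => ir //=; rewrite addn0 addn1 [in RHS]exprS mulrC.
  move=> rd; apply: (step) => //; elim: n => [|n IHn] //.
  have -> : (n.+1 * d = n * d + d)%N by rewrite mulSn addnC.
  by rewrite step // ltn_ord addn1.
have [n ne] := small_inv e0.
exists (n * d)%N => i; rewrite -[(n * d)%N]addn0 H // ltn0 addn0.
apply: le_trans (ltW ne); rewrite exprVn lef_pV2 ?posrE ?exprn_gt0 ?ltr0Sn //.
by rewrite -natrX ler_nat ltn_expl.
Qed.

Definition upper_half (k j : nat) (x : V) : bool :=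
  [forall i : 'I_d, (i == k %% d :> nat)%N ==>
    (corner k j ord0 i + width k i / 2 <= x ord0 i)].

(** The closed cells overlap, but the sets [addr x k = j] for fixed [k] form a
    partition: a point on a common face is sent to the upper half. *)
Fixpoint addr (x : V) (k : nat) : nat :=
  if k is k'.+1 then (upper_half k' (addr x k') x + (addr x k').*2)%N else 0%N.

Lemma addr_ltn x k : (addr x k < 2 ^ k)%N.
Proof.
elim: k => [|k IHk] //=; rewrite expnS mul2n -!addnn.
by case: upper_half => /=; rewrite ?add1n ?add0n; lia.
Qed.

Lemma half_addrS x k : (addr x k.+1)./2 = addr x k.
Proof. by rewrite /= half_bit_double. Qed.

Lemma addr_in_cell x k : unit_cube R d x -> in_cell k (addr x k) x.
Proof.
move=> xc; elim: k => [|k IHk] i; first by rewrite /= !mxE add0r; exact: xc.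
rewrite [addr x k.+1]/=; set b := upper_half _ _ _.
have hb := half_bit_double (addr x k) b.
have ob : odd (b + (addr x k).*2) = b by rewrite oddD odd_double addbF oddb.
have := IHk i; rewrite [corner k.+1 _]/= hb ob !mxE.
have w0 := width_gt0 k i.
rewrite [width k.+1 i]/=.
case: (eqVneq (i : nat) (k %% d)%N) => [ik|_]; last by rewrite andbF addr0.
rewrite andbT /b /upper_half.
case: forallP => [/(_ i)|H]; first by rewrite ik eqxx /=; set w := width _ _; lra.
suff : x ord0 i < corner k (addr x k) ord0 i + width k i / 2.
  by rewrite -?ik; set w := width _ _; lra.
rewrite ltNge; apply: contra_notN H => H j.
by apply/implyP => /eqP jk; have -> : j = i by apply/val_inj; rewrite /= ik.
Qed.

Lemma measurable_addr k j : measurable [set x : BV | addr x k = j].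
Proof.
elim: k j => [|k IHk] j.
  have [->|j0] := eqVneq j 0%N; first by rewrite (_ : [set _ | _] = setT) //; apply/seteqP.
  rewrite (_ : [set _ | _] = set0) //; apply/seteqP; split=> // x /= j0'.
  by rewrite -j0' eqxx in j0.
pose B : set BV := [set x : BV | upper_half k j./2 x].
have mB : measurable B.
  apply: closed_borel.
  rewrite (_ : B = \bigcap_(i in [set i : 'I_d | (i == k %% d :> nat)%N])
      [set x : V | corner k j./2 ord0 i + width k i / 2 <= x ord0 i]).
    apply: closed_bigI => i _.
    apply: (@preimage_closed _ _ (fun x : V => x ord0 i) [set y | _ <= y]).
      by move=> x _; exact: coord_continuous.
    exact: closed_ge.
  apply/seteqP; split => x /=.
    by move=> /forallP H i ik; have := H i; rewrite ik.
  by move=> H; apply/forallP => i; apply/implyP => ik; exact: H.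
have -> : [set x : BV | addr x k.+1 = j] =
    [set x : BV | addr x k = j./2] `&` (if odd j then B else ~` B).
  apply/seteqP; split => x.
    move=> /= xj; have xk : addr x k = j./2 by rewrite -xj half_bit_double.
    split=> //; rewrite -xj oddD odd_double addbF oddb.
    by rewrite /B -xk; case: ifPn => //= /negP.
  move=> [/= xk]; rewrite xk -[in RHS](odd_double_half j) /B.
  by case: (odd j) => /= [->|/negP/negbTE ->].
by apply: measurableI; [exact: IHk|case: ifP => _ //; exact: measurableC].
Qed.


(** What remains of a probability measure when only the masses of the cells are
    recorded. *)
Definition tree_weight (w : nat -> nat -> R) :=
  [/\ forall k j, 0 <= w k j, w 0%N 0%N = 1 &
      forall k j, w k j = w k.+1 j.*2 + w k.+1 j.*2.+1].

Section Quantile.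
Variable w : nat -> nat -> R.

(** The unit interval is divided among the cells of a level in proportion to their
    weights, in the order of their indices: the cell [j] receives the half-open
    interval of length [w k j] starting at [lo k j]. *)
Fixpoint lo (k j : nat) : R :=
  if k is k'.+1 then
    lo k' j./2 + (if odd j then w k'.+1 (j./2).*2 else 0)
  else 0.

(** The quantile transform: the cell of level [k] reached from [t], when the
    unit interval is subdivided according to the weights. *)
Fixpoint idx (t : R) (k : nat) : nat :=
  if k is k'.+1 then
    ((lo k' (idx t k') + w k (idx t k').*2 <= t)%R + (idx t k').*2)%N
  else 0%N.

Lemma idx_ltn t k : (idx t k < 2 ^ k)%N.
Proof.
elim: k => [|k IHk] //=; rewrite expnS mul2n -!addnn.
by case: (_ <= t) => /=; rewrite ?add1n ?add0n; lia.
Qed.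

Lemma half_idxS t k : (idx t k.+1)./2 = idx t k.
Proof. by rewrite /= half_bit_double. Qed.

Lemma measurable_idx k j : measurable [set t : R | idx t k = j].
Proof.
elim: k j => [|k IHk] j.
  have [->|j0] := eqVneq j 0%N; first by rewrite (_ : [set _ | _] = setT) //; apply/seteqP.
  rewrite (_ : [set _ | _] = set0) //; apply/seteqP; split=> // x /= j0'.
  by rewrite -j0' eqxx in j0.
pose B : set R := [set t | lo k j./2 + w k.+1 (j./2).*2 <= t].
have mB : measurable B.
  by rewrite (_ : B = `[lo k j./2 + w k.+1 (j./2).*2, +oo[%classic) //;
     apply/seteqP; split=> x; rewrite /B /= in_itv /= andbT.
have -> : [set t | idx t k.+1 = j] =
    [set t | idx t k = j./2] `&` (if odd j then B else ~` B).
  apply/seteqP; split => x.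
    move=> xj; have xk : idx x k = j./2 by rewrite -xj half_idxS.
    split=> //; rewrite -xj /= oddD odd_double addbF oddb.
    by rewrite /B -xk; case: ifPn => //= /negP.
  move=> [/= xk]; rewrite xk -[in RHS](odd_double_half j) /B.
  by case: (odd j) => /= [->|/negP/negbTE ->].
by apply: measurableI; [exact: IHk|case: ifP => _ //; exact: measurableC].
Qed.

Hypothesis tw : tree_weight w.

Let w_parity k j : w k j = if odd j then w k (j./2).*2.+1 else w k (j./2).*2.
Proof. by rewrite -{1}(odd_double_half j); case: odd. Qed.

(** At each level the half-open intervals partition [0, 1[, compatibly with the
    bisection, so that the greedy choice of halves finds the right one. *)
Lemma idxP k j t : (j < 2 ^ k)%N -> 0 <= t < 1 ->
  idx t k = j <-> lo k j <= t < lo k j + w k j.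
Proof.
case: tw => w0 w1 wS.
elim: k j => [|k IHk] j; first by rewrite ltnS leqn0 => /eqP -> tI /=; rewrite w1 add0r tI.
move=> jk tI.
have jk2 : (j./2 < 2 ^ k)%N by rewrite ltn_half_double -mul2n -expnS.
have := w0 k.+1 (j./2).*2; have := w0 k.+1 (j./2).*2.+1.
have := IHk _ jk2 tI; rewrite wS (w_parity k.+1 j) [lo k.+1 j]/=.
set a := lo k _; set b := w _ _; set c := w _ _ => H c0 b0.
have -> : (idx t k.+1 = j) <-> (idx t k = j./2 /\ (a + b <= t) = odd j).
  split.
    move=> tj; have tk : idx t k = j./2 by rewrite -tj half_idxS.
    split=> //; rewrite -tj /= oddD odd_double addbF oddb.
    by rewrite /a /b -tk.
  by move=> [tk tb]; rewrite /= tk tb odd_double_half.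
split=> [[/H/andP[h1 h2] <-]|].
  by case: (lerP (a + b) t) => h; apply/andP; split; lra.
move=> h; have h1 : idx t k = j./2 by apply/H; move: h; case: odd; lra.
by split=> //; move: h; case: odd => /andP[h2 h3]; [lra|apply/negbTE; lra].
Qed.

Lemma lo_bounds k j : (j < 2 ^ k)%N -> 0 <= lo k j /\ lo k j + w k j <= 1.
Proof.
case: tw => w0 w1 wS.
elim: k j => [|k IHk] j; first by rewrite ltnS leqn0 => /eqP -> /=; rewrite w1 add0r.
move=> jk.
have jk2 : (j./2 < 2 ^ k)%N by rewrite ltn_half_double -mul2n -expnS.
have [] := IHk _ jk2; rewrite wS (w_parity k.+1 j) /=.
have := w0 k.+1 (j./2).*2; have := w0 k.+1 (j./2).*2.+1.
by case: (odd j) => /=; lra.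
Qed.

Lemma prob_idx k j : (j < 2 ^ k)%N ->
  fine (uniform_prob (@ltr01 R) [set t : R | idx t k = j]) = w k j.
Proof.
move=> jk; have [w0 _ _] := tw; have [l0 l1] := lo_bounds jk.
have := w0 k j => wkj.
rewrite /uniform_prob integral_uniform_pdf.
suff -> : (\int[@lebesgue_measure R]_(x in [set t : R | idx t k = j] `&` `[0%R, 1%R]%classic)
    (uniform_pdf 0 1 x)%:E = (w k j)%:E)%E by [].
transitivity (\int[@lebesgue_measure R]_(x in [set t : R | idx t k = j] `&` `[0%R, 1%R]%classic)
    (cst 1%E x))%E.
  apply: eq_integral => x; rewrite inE => -[_ /=]; rewrite in_itv /= => x01.
  by rewrite /uniform_pdf x01 subr0 invr1.
have mI : measurable ([set t : R | idx t k = j] `&` `[0%R, 1%R]%classic).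
  by apply: measurableI => //; exact: measurable_idx.
rewrite integral_cst // mul1e.
have leb a b : a <= b -> lebesgue_measure (`[a, b[%classic : set R) = (b - a)%:E.
  by move=> ab; rewrite lebesgue_measure_itv /= lte_fin; case: ltgtP ab => // ->; rewrite subrr.
apply/eqP; rewrite eq_le; apply/andP; split.
  apply: (@le_trans _ _ (lebesgue_measure (`[lo k j, lo k j + w k j[%classic `|` [set (1 : R)]))).
    apply: le_measure; rewrite ?inE //; first exact: measurableU.
    move=> x [/= xj]; rewrite in_itv /= => /andP[x0]; rewrite le_eqVlt => /predU1P[->|x1].
      by right.
    by left; rewrite /= in_itv /=; apply/(idxP jk) => //; rewrite x0 x1.
  pose A : set R := `[lo k j, lo k j + w k j[%classic.
  have h : (lebesgue_measure A + lebesgue_measure [set (1%R : R)] <= (w k j)%:E)%E.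
    by rewrite /A lebesgue_measure_set1 adde0 leb ?lerDl // addrAC subrr add0r.
  by apply: (le_trans (measureU2 _ _ _)).
rewrite (_ : (w k j)%:E = lebesgue_measure (`[lo k j, lo k j + w k j[%classic : set R)); last first.
  by rewrite leb ?lerDl // addrAC subrr add0r.
apply: le_measure; rewrite ?inE // => x /=; rewrite !in_itv /= => /andP[x1 x2].
have x01 : 0 <= x < 1 by rewrite (le_trans l0) // (lt_le_trans x2).
split; first by apply/(idxP jk) => //; rewrite x1 x2.
by case/andP: x01 => -> /ltW ->.
Qed.

End Quantile.


Section QuantileLimit.
Hypothesis d_gt0 : (0 < d)%N.
Variable w : nat -> nat -> R.

Lemma idx_in_cell t k n : in_cell k (idx w t k) (corner (k + n) (idx w t (k + n))).
Proof.
elim: n => [|n IHn]; first by rewrite addn0; exact: corner_in_cell.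
have H m : forall x, in_cell (k + m) (idx w t (k + m)) x -> in_cell k (idx w t k) x.
  elim: m => [|m IHm] x; first by rewrite addn0.
  by rewrite addnS => /in_cellS; rewrite half_idxS; exact: IHm.
exact/(H n.+1)/corner_in_cell.
Qed.

(** The cells visited by [t] are nested and shrink to a point, whose coordinates are
    the suprema of those of the corners. *)
Definition quantile (t : R) : V :=
  \row_i sup [set corner k (idx w t k) ord0 i | k in [set: nat]].

Lemma quantile_in_cell t k : in_cell k (idx w t k) (quantile t).
Proof.
have H i l m : corner l (idx w t l) ord0 i <=
    corner m (idx w t m) ord0 i + width m i.
  have [/subnKC <-|/ltnW/subnKC <-] := leqP m l.
    by have /andP[] := idx_in_cell t m (l - m) i.
  have /andP[h _] := idx_in_cell t l (m - l) i.
  by rewrite (le_trans h) // lerDl ltW ?width_gt0.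
move=> i; rewrite mxE; apply/andP; split.
  apply: ub_le_sup; last by exists k.
  by exists (corner k (idx w t k) ord0 i + width k i) => _ [l _ <-]; exact: H.
apply: ge_sup; first by exists (corner k (idx w t k) ord0 i); exists k.
by move=> _ [l _ <-]; exact: H.
Qed.

Lemma in_cell_dist k j x (e : R) : 0 <= e -> (forall i : 'I_d, width k i <= e) ->
  in_cell k j x -> `|x - corner k j| <= e.
Proof.
move=> e0 we xj; apply: norm_le_coord => // i; rewrite !mxE.
by have /andP[h1 h2] := xj i; rewrite ger0_norm ?subr_ge0 // lerBlDl (le_trans h2) // lerD2l.
Qed.

Lemma measurable_quantile : measurable_fun [set: measurableTypeR R] (quantile : measurableTypeR R -> BV).
Proof.
apply: (@measurability _ _ (measurableTypeR R) BV setT quantile (@open V) erefl).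
move=> _ [W oW <-]; rewrite setTI.
pose good n k := [set t : R | (forall i : 'I_d, width k i < n.+1%:R^-1) /\
  ball (corner k (idx w t k)) n.+1%:R^-1 `<=` W].
have -> : quantile @^-1` W = \bigcup_n \bigcup_k good n k.
  apply/seteqP; split => t.
    move=> /= gO; have /nbhs_ballP[e /= e0 geO] : nbhs (quantile t) W by exact: open_nbhs_nbhs.
    have [n ne] : exists n, n.+1%:R^-1 < e / 2 by apply: small_inv; rewrite divr_gt0.
    have n0 : 0 < n.+1%:R^-1 :> R by rewrite invr_gt0.
    have [k kn] : exists k, forall i : 'I_d, width k i <= n.+1%:R^-1 / 2.
      by apply: width_small => //; rewrite divr_gt0.
    exists n => //; exists k => //; split.
      by move=> i; rewrite (le_lt_trans (kn i)) // ltr_pdivrMr // ltr_pMr // ltr1n.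
    move=> y; rewrite -ball_normE /ball_ /= => yc; apply: geO.
    rewrite -ball_normE /ball_ /= (le_lt_trans (ler_distD (corner k (idx w t k)) _ _)) //.
    rewrite [e]splitr; apply: ltrD; last exact: lt_trans ne.
    apply: le_lt_trans ne; apply: in_cell_dist (quantile_in_cell t k); first exact: ltW.
    by move=> i; rewrite (le_trans (kn i)) // ler_pdivrMr // ler_pMr // ler1n.
  move=> [n _ [k _ [kn H]]]; apply: H.
  rewrite -[_ (quantile t)]/((ball _ _) (quantile t)).
  have n0 : 0 < n.+1%:R^-1 :> R by rewrite invr_gt0.
  apply/ball_rVP => // i; have := quantile_in_cell t k i.
  set a := corner _ _ _ _; set b := quantile t _ _ => /andP[h1 h2].
  by rewrite distrC ger0_norm ?subr_ge0 // ltrBlDl (le_lt_trans h2) // ltrD2l.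
apply: bigcup_measurable => n _; apply: bigcup_measurable => k _.
have -> : good n k = \bigcup_j (if `[< (forall i : 'I_d, width k i < n.+1%:R^-1) /\
    ball (corner k j) n.+1%:R^-1 `<=` W >] then [set t | idx w t k = j] else set0).
  apply/seteqP; split => t; first by move=> gt; exists (idx w t k) => //; rewrite asboolT.
  by move=> [j _]; case: asboolP => // H /= tj; rewrite /good /= tj.
by apply: bigcup_measurable => j _; case: asboolP => // _; exact: measurable_idx.
Qed.

End QuantileLimit.

End Bisection.

Section WeakLimit.
Variables (R : realType) (d : nat).
Hypothesis d_gt0 : (0 < d)%N.
Local Notation V := 'rV[R]_d.
Local Notation BV := (borel_rV R d).
Variables (I : Type) (U : set_system I).
Hypothesis UU : UltraFilter U.

Lemma ultra_bounded_cvg (f : I -> R) (M : R) : (forall i, `|f i| <= M) ->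
  exists l : R, f i @[i --> U] --> l.
Proof.
move=> fM.
have cI : compact (`[- M, M]%classic : set R) by exact: segment_compact.
have FI : (f i @[i --> U]) `[- M, M]%classic.
  rewrite /fmap /=; apply: (@filterE _ U _ _) => i /=; rewrite in_itv /=.
  by rewrite -ler_norml fM.
have [l [_ cl]] := cI _ (fmap_proper_filter f _) FI.
exists l => A lA; have [//|UA] := in_ultra_setVsetC (f @^-1` A) UU.
by have [x [nAx Ax]] := cl (~` A) A UA lA.
Qed.

Variable mu_ : I -> probability BV R.
Hypothesis mu_cube : forall i, mu_ i (unit_cube R d) = 1%E.

Let wt (i : I) (k j : nat) : R := fine (mu_ i [set x : BV | addr x k = j]).

Let wt_bound i k j : 0 <= wt i k j /\ `|wt i k j| <= 1.
Proof.
have mA : measurable [set x : BV | addr x k = j] by exact: measurable_addr.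
have w0 : 0 <= wt i k j by rewrite /wt fine_ge0.
split=> //; rewrite ger0_norm // /wt -lee_fin fineK ?probability_le1 //.
exact: prob_fin_num.
Qed.

Let wt_split i k j : wt i k j = wt i k.+1 j.*2 + wt i k.+1 j.*2.+1.
Proof.
have mA := @measurable_addr R d.
rewrite /wt -fineD ?prob_fin_num // -measureU //; last first.
  apply/seteqP; split=> // x [] /= -> /eqP.
  by rewrite -[X in _ == X]addn1 -{1}[j.*2]addn0 eqn_add2l.
congr (fine (mu_ i _)); apply/seteqP; split => x.
  move=> /= <-; case: upper_half; first by right.
  by left.
by move=> [] xj; rewrite /= -half_addrS xj ?uphalf_double ?half_double //= uphalf_double.
Qed.

Let wlim k j : {l : R | wt i k j @[i --> U] --> l}.
Proof. by apply: cid; apply: (ultra_bounded_cvg (M := 1)) => i; case: (wt_bound i k j). Qed.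

Let w k j : R := projT1 (wlim k j).

Let wE k j : wt i k j @[i --> U] --> w k j.
Proof. exact: (projT2 (wlim k j)). Qed.

Let tw : tree_weight w.
Proof.
split=> [k j||k j].
- have PF : ProperFilter U by exact: ultra_proper.
  have H := @closed_cvg I R U _ (fun i => wt i k j) (fun x : R => 0 <= x) (@closed_ge R 0) _ _ (@wE k j).
  apply: H.
  apply: filterE => i.
  by case: (wt_bound i k j).
- have H : (fun i => wt i 0%N 0%N) = (fun=> 1).
    apply/funext => i; rewrite /wt (_ : [set _ | _] = setT); last by apply/seteqP.
    exact: (congr1 fine (probability_setT (mu_ i))).
  have := @wE 0%N 0%N; rewrite H => /cvg_unique; apply=> //; exact: cvg_cst.
- have H : (fun i => wt i k j) = (fun i => wt i k.+1 j.*2) \+ (fun i => wt i k.+1 j.*2.+1).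
    by apply/funext => i; rewrite wt_split.
  have := @wE k j; rewrite H => /cvg_unique; apply=> //.
  exact: cvgD (@wE k.+1 j.*2) (@wE k.+1 j.*2.+1).
Qed.

(** Weak compactness of the probability measures on the unit cube. Along an
    ultrafilter every cell has a limit weight; the limit weights are those of
    the image of the uniform distribution under the quantile transform. *)
Theorem weak_limit : exists mu : probability BV R, forall (h : V -> R) (K M : R), 0 <= K ->
  (forall x y, `|h x - h y| <= K * `|x - y|) -> (forall x, `|h x| <= M) ->
  \int[mu_ i]_x h x @[i --> U] --> \int[mu]_x h x.
Proof.
pose P : probability (measurableTypeR R) R := uniform_prob (@ltr01 R).
have mq := measurable_quantile d_gt0 w.
pose mixin := isMeasurableFun.Build _ _ _ _ _ mq.
pose X : {mfun measurableTypeR R >-> BV} := HB.pack (quantile d w) mixin.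
pose mu : probability BV R := distribution P X.
exists mu => h K M K0 hK hM.
have bh : bounded_mfun (h : BV -> R) := lip_bounded_borel hK hM.
have bhX : bounded_mfun (fun t => h (quantile d w t)).
  by split; [exact: (measurableT_comp (proj1 bh) mq)|exists M].
have muE : \int[mu]_x h x = \int[P]_t h (quantile d w t).
  rewrite /Rintegral; congr fine; apply: integral_distribution.
    by apply/measurable_EFinP; exact: (proj1 bh).
  by apply: bounded_mfun_integrable.
rewrite muE.
apply/cvgrPdist_lt => e e0.
pose eta := e / (4 * (K + 1)).
have K1 : 0 < K + 1 by rewrite ltr_wpDl.
have eta0 : 0 < eta by rewrite divr_gt0 // mulr_gt0.
have Keta : K * eta <= e / 4.
  by rewrite /eta invfM mulrCA ler_wpM2l ?(ltW e0) // mulrCA ler_piMr // ler_pdivrMr // mul1r lerDl.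
have [k kw] := width_small d_gt0 eta0.
have near_corner j x : in_cell k j x -> `|h x - h (corner R d k j)| <= e / 4.
  move=> xj; apply: le_trans Keta; apply: (le_trans (hK _ _)).
  by rewrite ler_wpM2l // in_cell_dist // ltW.
pose S (v : nat -> nat -> R) := \sum_(j < 2 ^ k) h (corner R d k j) * v k j.
have Si i : `|\int[mu_ i]_x h x - S (wt i)| <= e / 4.
  have bc : bounded_mfun (fun x : BV => h (corner R d k (addr x k))).
    apply: (@bounded_mfun_finite_range _ BV R (fun x => addr x k) (2 ^ k)
      (fun j => h (corner R d k j))) => [x|j]; last first.
      exact: measurable_addr.
    exact: addr_ltn.
  have -> : S (wt i) = \int[mu_ i]_x h (corner R d k (addr x k)).
    by rewrite (@Rintegral_finite_range _ BV R (fun x => addr x k) (2 ^ k)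
      (fun j => h (corner R d k j)) (fun x => addr_ltn x k) (@measurable_addr R d k)).
  rewrite -RintegralB //; try exact: bounded_mfun_integrable.
  apply: (Rintegral_norm_le_full _ (mu_cube i)).
  - exact: measurable_cube.
  - apply: bounded_mfunB => //.
  - by move=> x xc; apply: near_corner; exact: addr_in_cell.
have SP : `|\int[P]_t h (quantile d w t) - S w| <= e / 4.
  have bc : bounded_mfun (fun t : measurableTypeR R => h (corner R d k (idx w t k))).
    apply: (@bounded_mfun_finite_range _ (measurableTypeR R) R (fun t => idx w t k) (2 ^ k)
      (fun j => h (corner R d k j))) => [x|j]; last first.
      exact: measurable_idx.
    exact: idx_ltn.
  have -> : S w = \int[P]_t h (corner R d k (idx w t k)).
    rewrite (@Rintegral_finite_range _ (measurableTypeR R) R (fun t => idx w t k) (2 ^ k)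
      (fun j => h (corner R d k j)) (fun t => idx_ltn w t k) (@measurable_idx R w k)).
    by apply: eq_bigr => j _; rewrite prob_idx.
  rewrite -RintegralB //; try exact: bounded_mfun_integrable.
  apply: Rintegral_norm_le; first exact: (proj1 (bounded_mfunB bhX bc)).
  by move=> x; apply: near_corner; exact: quantile_in_cell.
have Scvg : S (wt i) @[i --> U] --> S w.
  apply: cvg_big => [|j _]; first exact: add_continuous.
  by apply: cvgM; [exact: cvg_cst|exact: wE].
have e4 : 0 < e / 4 by rewrite divr_gt0.
move/cvgrPdist_lt : Scvg => /(_ _ e4); apply: filterS => i Swi.
have -> : \int[P]_t h (quantile d w t) - \int[mu_ i]_x h x =
    (\int[P]_t h (quantile d w t) - S w) + (S w - S (wt i))
      - (\int[mu_ i]_x h x - S (wt i)) by ring.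
apply: (le_lt_trans (ler_normB _ _)).
apply: (@lt_le_trans _ _ (e / 4 + e / 4 + e / 4)); last by lra.
apply: ltr_leD; last exact: Si.
by apply: (le_lt_trans (ler_normD _ _)); apply: ler_ltD.
Qed.

End WeakLimit.

(** * Sets covered by few small cubes are null for fast Fourier decay *)

Section PowerSums.
Variable R : realType.

(** The concavity of [x^b], in a form that is also correct at [0]; it telescopes. *)
Lemma powR_increment (b : R) (l : nat) : 0 < b <= 1 ->
  b / 2 * l.+1%:R `^ (b - 1) <= l.+1%:R `^ b - l%:R `^ b.
Proof.
move=> /andP[b0 b1]; case: l => [|l].
  by rewrite powR0 ?gt_eqF // powR1 subr0 mulr1 ler_pdivrMr //; lra.
set x : R := l.+2%:R; have x0 : 0 < x by rewrite /x.
have x1 : 1 < x by rewrite /x ltr1n.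
have -> : l.+1%:R = x * (1 - x^-1) :> R.
  by rewrite mulrBr mulr1 divff ?gt_eqF // /x -[l.+2]addn1 natrD addrK.
have u0 : 0 < x^-1 by rewrite invr_gt0.
have u1 : x^-1 < 1 by rewrite invf_lt1.
rewrite powRM ?(ltW x0) ?subr_ge0 ?(ltW u1) //.
have -> : x `^ (b - 1) = x `^ b * x^-1.
  by rewrite powRD ?(gt_eqF x0) ?implybT // powR_inv1 // ltW.
have H : (1 - x^-1) `^ b <= 1 - b * x^-1 / 2.
  rewrite /powR gt_eqF ?subr_gt0 //.
  apply: (@le_trans _ _ (expR (- (b * x^-1)))).
    rewrite ler_expR -mulrN ler_wpM2l ?(ltW b0) //.
    by apply: le_ln1Dx; rewrite ltrN2.
  rewrite expRN; set v := b * x^-1.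
  have v0 : 0 < v by rewrite mulr_gt0.
  have v1 : v <= 1 by rewrite /v (le_trans (ler_wpM2r (ltW u0) b1)) // mul1r ltW.
  apply: (@le_trans _ _ (1 + v)^-1).
    by rewrite lef_pV2 ?posrE ?expR_gt0 ?expR_ge1Dx // ltr_wpDl.
  rewrite -div1r ler_pdivrMr ?ltr_wpDl //; nra.
have xb : 0 <= x `^ b by exact: powR_ge0.
have := ler_wpM2l xb H; move: (x `^ b) ((1 - x^-1) `^ b) x^-1 => A B u; lra.
Qed.

Lemma sum_powRN (a : R) (N : nat) : 0 <= a < 1 -> (0 < N)%N ->
  \sum_(l < N) (maxn 1 l)%:R `^ (- a) <= 3 / (1 - a) * N%:R `^ (1 - a).
Proof.
move=> /andP[a0 a1]; case: N => // N _.
have b0 : 0 < 1 - a by rewrite subr_gt0.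
have H n : \sum_(l < n.+1) (maxn 1 l)%:R `^ (- a) <= 1 + 2 / (1 - a) * n%:R `^ (1 - a).
  elim: n => [|n IHn]; first by rewrite big_ord1 powR1 lerDl mulr_ge0 ?divr_ge0 ?(ltW b0) ?powR_ge0.
  rewrite big_ord_recr /= (maxn_idPr _) //.
  apply: (le_trans (lerD IHn (lexx _))); rewrite -addrA lerD2l.
  have := @powR_increment (1 - a) n; rewrite b0 /= lerBlDr lerDl a0 => /(_ isT).
  rewrite (_ : 1 - a - 1 = - a); last by lra.
  set p := _ `^ (- a); set A := _ `^ (1 - a); set B := _ `^ (1 - a) => hp.
  have := ler_wpM2l (_ : 0 <= 2 / (1 - a)) hp; rewrite divr_ge0 ?(ltW b0) // => /(_ isT).
  rewrite mulrA (_ : 2 / (1 - a) * ((1 - a) / 2) = 1); last by field; rewrite gt_eqF.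
  by rewrite mul1r mulrBr; lra.
apply: (le_trans (H N)).
have h1 : N%:R `^ (1 - a) <= N.+1%:R `^ (1 - a).
  by apply: ge0_ler_powR; rewrite ?nnegrE ?ler0n ?ler_nat // ltW.
have h2 : 1 <= N.+1%:R `^ (1 - a) :> R.
  by rewrite -[leLHS](powRr0 N.+1%:R); apply: ler_powR; rewrite ?ler1n // ltW.
have h3 : 1 <= (1 - a)^-1 by rewrite invf_ge1 // lerBlDr lerDl.
have h4 : 0 <= N%:R `^ (1 - a) by exact: powR_ge0.
set A := N%:R `^ _ in h1 h4 *; set B := N.+1%:R `^ _ in h1 h2 *; set i := (1 - a)^-1 in h3 *.
nra.
Qed.

Lemma sum_sqr_ge (n : nat) (p : 'I_n -> R) :
  (\sum_(j < n) p j) ^+ 2 <= n%:R * \sum_(j < n) p j ^+ 2.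
Proof.
rewrite expr2 big_distrlr /=.
apply: (@le_trans _ _ (\sum_(i < n) \sum_(j < n) ((p i ^+ 2 + p j ^+ 2) / 2))).
  by apply: ler_sum => i _; apply: ler_sum => j _; have := sqr_ge0 (p i - p j); lra.
have -> : \sum_(i < n) \sum_(j < n) ((p i ^+ 2 + p j ^+ 2) / 2) =
    \sum_(i < n) (n%:R * p i ^+ 2 + \sum_(j < n) p j ^+ 2) / 2.
  apply: eq_bigr => i _; rewrite -mulr_suml big_split /=.
  by rewrite sumr_const card_ord [in RHS]mulr_natl.
by rewrite -mulr_suml big_split /= -mulr_sumr sumr_const card_ord -[X in _ + X]mulr_natl; lra.
Qed.

Lemma cos_ge_half (t : R) : `|t| <= 1 -> 1 / 2 <= cos t.
Proof.
move=> t1; have -> : cos t = 1 - 2 * sin (t / 2) ^+ 2.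
  have {1}-> : t = t / 2 + t / 2 by rewrite -splitr.
  by rewrite cosD; have := cos2Dsin2 (t / 2); rewrite !expr2; lra.
have := sin_lip (t / 2) 0; rewrite sin0 !subr0 normrM [`|2^-1|]gtr0_norm ?invr_gt0 // => h.
have h2 : `|sin (t / 2)| <= 1 / 2 by lra.
have -> : sin (t / 2) ^+ 2 = `|sin (t / 2)| ^+ 2 by rewrite real_normK ?num_real.
have := normr_ge0 (sin (t / 2)); nra.
Qed.

End PowerSums.

(** The decay required in the Fourier dimension, with an explicit constant since
    only bounded constants pass to weak limits. *)
Definition fourier_decay (R : realType) (d : nat) (mu : probability (borel_rV R d) R)
    (c s : R) : Prop :=
  0 < c /\ forall x : 'rV[R]_d, x != 0 ->
    ComplexField.Normc.normc (fourier mu x) <= c * enorm x `^ (- s / 2).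

Section FejerKernel.
Variables (R : realType) (d : nat).
Local Notation V := 'rV[R]_d.
Local Notation BV := (borel_rV R d).
Variables (mu : probability BV R) (N : nat).
Hypothesis N_gt0 : (0 < N)%N.

Local Notation freq := {ffun 'I_d -> 'I_N}.
Definition fvec (a : freq) : V := \row_i (a i : nat)%:R.

(** The squared modulus of the exponential sum over the box of frequencies [0, N[^d:
    an unnormalized Fejer kernel in [x - y]. *)
Definition kernel (x y : V) : R :=
  (\sum_(a : freq) cos (dotp (fvec a) (x - y))) ^+ 2 +
  (\sum_(a : freq) sin (dotp (fvec a) (x - y))) ^+ 2.

Lemma kernelE x y : kernel x y = \sum_(a : freq) \sum_(b : freq)
  (cos (dotp (fvec a - fvec b) x) * cos (dotp (fvec a - fvec b) y) +
   sin (dotp (fvec a - fvec b) x) * sin (dotp (fvec a - fvec b) y)).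
Proof.
rewrite /kernel !expr2 !big_distrlr /= -big_split; apply: eq_bigr => a _ /=.
rewrite -big_split; apply: eq_bigr => b _ /=.
rewrite -cosB -cosB -dotpBr; congr cos.
by rewrite !dotpBr !dotpBl; ring.
Qed.

Lemma kernel_ge0 x y : 0 <= kernel x y.
Proof. by rewrite addr_ge0 // sqr_ge0. Qed.

(** When the coordinates differ by at most [1 / (d N)], all the phases are at most
    [1] and no cosine is smaller than [1 / 2]. *)
Lemma kernel_ge (x y : V) : (forall i, `|x ord0 i - y ord0 i| <= (d * N)%:R^-1) ->
  (N ^ d)%:R ^+ 2 / 4 <= kernel x y.
Proof.
move=> xy; have H (a : freq) : 1 / 2 <= cos (dotp (fvec a) (x - y)).
  apply: cos_ge_half; apply: (le_trans (ler_norm_sum _ _ _)).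
  apply: (@le_trans _ _ (\sum_(i < d) d%:R^-1)).
    apply: ler_sum => i _; rewrite !mxE normrM ger0_norm ?ler0n //.
    apply: (@le_trans _ _ (N%:R * (d * N)%:R^-1)).
      by apply: ler_pM; rewrite ?ler0n ?normr_ge0 ?ler_nat ?(ltnW (ltn_ord _)) ?xy.
    rewrite natrM invfM mulrCA mulfV ?mulr1 // pnatr_eq0 -lt0n //.
  rewrite sumr_const card_ord; case: (posnP d) => [->|d0].
    by rewrite mulr0n.
  by rewrite -[leLHS]mulr_natl mulfV // pnatr_eq0 -lt0n.
have C : (N ^ d)%:R / 2 <= \sum_(a : freq) cos (dotp (fvec a) (x - y)).
  apply: (@le_trans _ _ (\sum_(a : freq) 1 / 2)); last exact: ler_sum.
  by rewrite -mulr_suml sumr_const card_ffun !card_ord.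
have h0 : 0 <= (N ^ d)%:R :> R by rewrite ler0n.
rewrite /kernel; set S := \sum_(a : freq) sin _; have := sqr_ge0 S.
by set X := (_ ^ _)%:R in C h0 *; nra.
Qed.

Definition energy : R := \sum_(a : freq) \sum_(b : freq)
  (cosint mu (fvec a - fvec b) ^+ 2 + sinint mu (fvec a - fvec b) ^+ 2).

Let bc xi : bounded_mfun (fun x : BV => cos (dotp xi x)) := cos_dotp_bounded xi.
Let bs xi : bounded_mfun (fun x : BV => sin (dotp xi x)) := sin_dotp_bounded xi.

Let bterm xi (p q : R) :
  bounded_mfun (fun x : BV => cos (dotp xi x) * p + sin (dotp xi x) * q).
Proof.
by apply: bounded_mfunD; apply: bounded_mfunM => //; exact: bounded_mfun_cst.
Qed.

Let int_term xi (p q : R) :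
  \int[mu]_x (cos (dotp xi x) * p + sin (dotp xi x) * q) =
  cosint mu xi * p + sinint mu xi * q.
Proof.
rewrite RintegralD //; last 2 first.
- by apply: bounded_mfun_integrable => //; apply: bounded_mfunM => //; exact: bounded_mfun_cst.
- by apply: bounded_mfun_integrable => //; apply: bounded_mfunM => //; exact: bounded_mfun_cst.
by rewrite !RintegralZr //; apply: bounded_mfun_integrable.
Qed.

Lemma int_kernel x : \int[mu]_y kernel x y = \sum_(a : freq) \sum_(b : freq)
  (cos (dotp (fvec a - fvec b) x) * cosint mu (fvec a - fvec b) +
   sin (dotp (fvec a - fvec b) x) * sinint mu (fvec a - fvec b)).
Proof.
under eq_Rintegral do rewrite kernelE.
rewrite Rintegral_sum //; last first.
  move=> a; apply: bounded_mfun_sum => b.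
  by under eq_fun do rewrite mulrC [X in _ + X]mulrC; exact: bterm.
apply: eq_bigr => a _; rewrite Rintegral_sum //; last first.
  by move=> b; under eq_fun do rewrite mulrC [X in _ + X]mulrC; exact: bterm.
apply: eq_bigr => b _; under eq_Rintegral do rewrite mulrC [X in _ + X]mulrC.
by rewrite int_term mulrC [X in _ + X]mulrC.
Qed.

Lemma bounded_kernel x : bounded_mfun (fun y : BV => kernel x y).
Proof.
under eq_fun do rewrite kernelE.
apply: bounded_mfun_sum => a; apply: bounded_mfun_sum => b.
by under eq_fun do rewrite mulrC [X in _ + X]mulrC; exact: bterm.
Qed.

Lemma bounded_int_kernel : bounded_mfun (fun x : BV => \int[mu]_y kernel x y).
Proof.
under eq_fun do rewrite int_kernel.
by apply: bounded_mfun_sum => a; apply: bounded_mfun_sum => b; exact: bterm.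
Qed.

Lemma int_int_kernel : \int[mu]_x \int[mu]_y kernel x y = energy.
Proof.
under eq_Rintegral do rewrite int_kernel.
rewrite Rintegral_sum //; last first.
  by move=> a; apply: bounded_mfun_sum => b; exact: bterm.
apply: eq_bigr => a _; rewrite Rintegral_sum.
- by apply: eq_bigr => b _; rewrite int_term !expr2.
- exact: measurableT.
- by move=> b; exact: bterm.
Qed.

Section Cover.
Variables (n : nat) (phi : V -> nat).
Hypothesis phi_le : forall x, (phi x < n.+1)%N.
Hypothesis mphi : forall j, measurable [set x : BV | phi x = j].
Hypothesis phi_close : forall x y, (phi x < n)%N -> phi x = phi y ->
  forall i, `|x ord0 i - y ord0 i| <= (d * N)%:R^-1.

(** Two points with the same label [j < n] are close, so the kernel is large on the
    [n] diagonal blocks; Cauchy-Schwarz compares the sum of the squares of the masses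
    of the parts with the square of their total mass. *)
Lemma energy_ge :
  (N ^ d)%:R ^+ 2 / 4 * (fine (mu [set x : BV | (phi x < n)%N])) ^+ 2 <= n%:R * energy.
Proof.
pose p (j : nat) := fine (mu [set x : BV | phi x = j]).
have -> : fine (mu [set x : BV | (phi x < n)%N]) = \sum_(j < n) p j.
  have bI : bounded_mfun (fun x : BV => (phi x < n)%N%:R : R).
    exact: (@bounded_mfun_finite_range _ BV R phi n.+1 (fun j => (j < n)%N%:R)).
  have mI : measurable [set x : BV | (phi x < n)%N].
    rewrite (_ : [set _ | _] = \bigcup_(j in [set j | (j < n)%N]) [set x : BV | phi x = j]).
      by apply: bigcup_measurable => j _; exact: mphi.
    by apply/seteqP; split=> [x xn|x [j jn /= ->]] //; exists (phi x).
  rewrite -Rintegral_indic // (_ : \1_ _ = (fun x : BV => (phi x < n)%N%:R : R)).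
    rewrite (@Rintegral_finite_range _ BV R phi n.+1 (fun j => (j < n)%N%:R)) //.
    rewrite big_ord_recr /= ltnn mul0r addr0.
    by apply: eq_bigr => j _; rewrite ltn_ord mul1r.
  apply/funext => x; rewrite indicE; congr (_%:R).
  by case: (boolP (phi x < n)%N) => h; [rewrite mem_set|rewrite memNset //; exact/negP].
have c0 : 0 <= (N ^ d)%:R ^+ 2 / 4 :> R by rewrite divr_ge0 // sqr_ge0.
apply: (le_trans (ler_wpM2l c0 (sum_sqr_ge _))); rewrite mulrCA ler_wpM2l //.
rewrite -int_int_kernel.
pose H (j : nat) : R := (N ^ d)%:R ^+ 2 / 4 * (if (j < n)%N then p j else 0).
have -> : (N ^ d)%:R ^+ 2 / 4 * \sum_(j < n) p j ^+ 2 = \int[mu]_x H (phi x).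
  rewrite (@Rintegral_finite_range _ BV R phi n.+1 H) // big_ord_recr /=.
  rewrite /H ltnn mulr0 mul0r addr0 mulr_sumr; apply: eq_bigr => j _.
  by rewrite ltn_ord expr2 mulrA.
apply: le_Rintegral_prob; [exact: bounded_mfun_finite_range|exact: bounded_int_kernel|].
move=> x; rewrite /H; case: ifP => xn; last first.
  by rewrite mulr0; apply: Rintegral_ge0 => y _; exact: kernel_ge0.
rewrite /p -Rintegral_indic // -RintegralZl //; last first.
  by apply: bounded_mfun_integrable => //; exact: bounded_mfun_indic.
apply: le_Rintegral_prob.
- by apply: bounded_mfunM; [exact: bounded_mfun_cst|exact: bounded_mfun_indic].
- exact: bounded_kernel.
- move=> y; rewrite indicE; case: (boolP (_ \in _)) => [|_]; last by rewrite mulr0 kernel_ge0.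
  rewrite in_setE /= => yx; rewrite mulr1; apply: kernel_ge.
  exact: phi_close.
Qed.
End Cover.

Lemma enorm_ge_coord (x : V) i : `|x ord0 i| <= enorm x.
Proof.
rewrite /enorm -sqrtr_sqr; apply: ler_wsqrtr.
rewrite /dotp (bigD1 i) //= -expr2 lerDl sumr_ge0 // => j _.
by rewrite -expr2 sqr_ge0.
Qed.

Let dist (p q : nat) := (p - q + (q - p))%N.

Let dist_gt0 (p q : nat) : p != q -> (0 < dist p q)%N.
Proof. by rewrite /dist; lia. Qed.

Lemma sum_dist (g : nat -> R) (p : nat) : (forall l, 0 <= g l) -> (p < N)%N ->
  \sum_(q < N) g (dist p q) <= 2 * \sum_(l < N) g l.
Proof.
move=> g0 pN.
rewrite -(big_mkord xpredT (fun q => g (dist p q))) (@big_cat_nat _ _ _ p) //=; last exact: ltnW.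
have -> : \sum_(l < N) g l = \sum_(0 <= l < N) g l by rewrite big_mkord.
rewrite (_ : 2 = 1 + 1) // mulrDl mul1r; apply: lerD.
  rewrite big_nat_rev /= add0n.
  rewrite (@eq_big_nat _ _ _ _ _ _ (fun i => g i.+1)); last first.
    move=> i /andP[_ ip]; congr g; rewrite /dist; lia.
  rewrite [leRHS]big_ltn // big_add1 (@big_cat_nat _ _ _ p 0%N N.-1) //=; last first.
    by rewrite -ltnS prednK.
  by rewrite addrCA lerDl addr_ge0 // sumr_ge0.
rewrite -[X in \sum_(X <= _ < _) _]add0n big_addn.
rewrite (@eq_bigr _ _ _ _ _ _ _ (fun i => g i)); last first.
  by move=> i _; congr g; rewrite /dist; lia.
rewrite [leRHS](@big_cat_nat _ _ _ (N - p)%N) //= ?leq_subr //.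
by rewrite lerDl sumr_ge0.
Qed.

(** The decay bounds the energy: [|m|^-s <= prod_i max(1,|m_i|)^(-s/d)] turns
    the sum over the frequencies into a power of a one-dimensional sum. *)
Lemma energy_le (c s : R) : (0 < d)%N -> 0 < s < d%:R -> fourier_decay mu c s ->
  energy <= (2 + c ^+ 2) * (6 / (1 - s / d%:R) * (N%:R * N%:R `^ (1 - s / d%:R))) ^+ d.
Proof.
move=> d0 /andP[s0 sd] [c0 hc].
have d0' : 0 < d%:R :> R by rewrite ltr0n.
set a := s / d%:R; have a0 : 0 < a by rewrite divr_gt0.
have a1 : a < 1 by rewrite /a ltr_pdivrMr // mul1r.
pose g (l : nat) : R := (maxn 1 l)%:R `^ (- a).
have g0 l : 0 <= g l by exact: powR_ge0.
have c2 : 0 <= 2 + c ^+ 2 by rewrite addr_ge0 // sqr_ge0.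
have pw (f f' : freq) : cosint mu (fvec f - fvec f') ^+ 2 + sinint mu (fvec f - fvec f') ^+ 2
    <= (2 + c ^+ 2) * \prod_i g (dist (f i) (f' i)).
  have [->|ff'] := eqVneq f f'.
    rewrite big1 ?mulr1; last by move=> i _; rewrite /g /dist subnn powR1.
    have h1 : `|cosint mu (fvec f' - fvec f')| <= 1.
      by apply: Rintegral_norm_le; [exact: (proj1 (bc _))|move=> x; exact: cos_max].
    have h2 : `|sinint mu (fvec f' - fvec f')| <= 1.
      by apply: Rintegral_norm_le; [exact: (proj1 (bs _))|move=> x; exact: sin_max].
    have q1 (r : R) : `|r| <= 1 -> r ^+ 2 <= 1 by rewrite -(real_normK (num_real r)); have := normr_ge0 r; nra.
    have := q1 _ h1; have := q1 _ h2; have := sqr_ge0 c; lra.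
  set xi := fvec f - fvec f'.
  have xiE i : `|xi ord0 i| = (dist (f i) (f' i))%:R.
    rewrite !mxE /dist; case: (leqP (f i) (f' i)) => h.
      by rewrite (eqP h) add0n distrC -natrB // normr_nat.
    by rewrite (eqP (ltnW h)) addn0 -natrB ?normr_nat // ltnW.
  have [j fj] : exists j, f j != f' j.
    apply/existsP; apply: contraR ff'; rewrite negb_exists => /forallP H.
    by apply/eqP/ffunP => i; apply/eqP; have := H i; rewrite negbK.
  have dj : (1 <= dist (f j) (f' j))%N.
    exact: dist_gt0.
  have e1 : 1 <= enorm xi by apply: le_trans (enorm_ge_coord xi j); rewrite xiE ler1n.
  have e0 : 0 < enorm xi by rewrite (lt_le_trans _ e1).
  have xi0 : xi != 0.
    apply/eqP => xi0; have := xiE j; rewrite xi0 mxE normr0 => /esym/eqP.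
    by rewrite pnatr_eq0 eqn0Ngt dj.
  have := hc xi xi0; rewrite normc_fourier => hsq.
  have CS0 : 0 <= cosint mu xi ^+ 2 + sinint mu xi ^+ 2 by rewrite addr_ge0 // sqr_ge0.
  rewrite -[leLHS]sqr_sqrtr //.
  have em i : enorm xi `^ (- a) <= g (dist (f i) (f' i)).
    rewrite /g !powRN lef_pV2 ?posrE ?powR_gt0 ?ltr0n ?leq_max //.
    apply: ge0_ler_powR; rewrite ?nnegrE ?ler0n ?(ltW a0) ?(ltW e0) //.
    case: (leqP (dist (f i) (f' i)) 1) => h.
      by rewrite ?(maxn_idPl h) e1.
    by rewrite ?(maxn_idPr (ltnW h)) -xiE enorm_ge_coord.
  apply: (@le_trans _ _ (c ^+ 2 * \prod_(i < d) enorm xi `^ (- a))); last first.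
    apply: ler_pM; rewrite ?sqr_ge0 ?lerDr //; first by apply: prodr_ge0 => i _; exact: powR_ge0.
    by apply: ler_prod => i _; rewrite powR_ge0 em.
  have -> : \prod_(i < d) enorm xi `^ (- a) = (enorm xi `^ (- s / 2)) ^+ 2.
    move: (enorm xi) => E; rewrite prodr_const card_ord.
    rewrite -(powR_mulrn d (powR_ge0 E _)) -(powR_mulrn 2 (powR_ge0 E _)) -!powRrM.
    have -> : - a * d%:R = - s by rewrite /a mulNr divfK // lt0r_neq0.
    by have -> : - s / 2 * 2 = - s by rewrite divfK.
  rewrite -exprMn; apply: lerXn2r => //; rewrite ?nnegrE ?sqrtr_ge0 //.
  by rewrite mulr_ge0 ?powR_ge0 // ltW.
apply: (@le_trans _ _ (\sum_(f : freq) \sum_(f' : freq) (2 + c ^+ 2) * \prod_i g (dist (f i) (f' i)))).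
  by apply: ler_sum => f _; apply: ler_sum => f' _; exact: pw.
under eq_bigr do rewrite -mulr_sumr.
rewrite -mulr_sumr ler_wpM2l //.
under eq_bigr => f _ do
  rewrite -(bigA_distr_bigA (fun (i : 'I_d) (q : 'I_N) => g (dist (f i) q))).
rewrite -(bigA_distr_bigA (fun (i : 'I_d) (p : 'I_N) => \sum_(q < N) g (dist p q))).
rewrite prodr_const card_ord; apply: lerXn2r; rewrite ?nnegrE.
- by apply: sumr_ge0 => p _; apply: sumr_ge0.
- by rewrite !mulr_ge0 ?powR_ge0 ?invr_ge0 ?subr_ge0 // ltW.
apply: (@le_trans _ _ (\sum_(p < N) 2 * (3 / (1 - a) * N%:R `^ (1 - a)))).
  apply: ler_sum => p _; apply: (le_trans (sum_dist g0 (ltn_ord p))).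
  by rewrite ler_wpM2l // sum_powRN // a1 ltW.
by rewrite sumr_const card_ord -mulr_natl; lra.
Qed.

End FejerKernel.

Section FejerNull.
Variables (R : realType) (d : nat).
Local Notation V := 'rV[R]_d.
Local Notation BV := (borel_rV R d).

Definition in_box (e : R) (z x : V) : bool :=
  [forall i, z ord0 i <= x ord0 i <= z ord0 i + e].

Definition box_covered (n : nat) (e : R) (B : set V) : Prop :=
  exists2 zs : seq V, (size zs <= n)%N & B `<=` [set x | has (in_box e ^~ x) zs].

Lemma closed_box e z : closed [set x : V | in_box e z x].
Proof.
rewrite (_ : [set x | _] = \bigcap_(i in [set: 'I_d])
    [set x : V | x ord0 i \in `[z ord0 i, z ord0 i + e]]); last first.
  apply/seteqP; split=> x /=.
    by move=> /forallP H i _ /=; rewrite in_itv /=; exact: H.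
  by move=> H; apply/forallP => i; have := H i I; rewrite /= in_itv.
apply: closed_bigI => i _.
apply: (@preimage_closed _ _ (fun x : V => x ord0 i) [set` `[z ord0 i, z ord0 i + e]]).
  by move=> x _; exact: coord_continuous.
exact: itv_closed.
Qed.

Lemma measurable_find (e : R) (zs : seq V) (j : nat) :
  measurable [set x : BV | find (in_box e ^~ x) zs = j].
Proof.
elim: zs j => [|z zs IHzs] j.
  have [->|j0] := eqVneq j 0%N; first by rewrite (_ : [set _ | _] = setT) //; apply/seteqP.
  rewrite (_ : [set _ | _] = set0) //; apply/seteqP; split=> // x /= j0'.
  by rewrite -j0' eqxx in j0.
have mz : measurable [set x : BV | in_box e z x] by apply: closed_borel; exact: closed_box.
case: j => [|j].
  rewrite (_ : [set _ | _] = [set x : BV | in_box e z x]) //.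
  by apply/seteqP; split=> x /=; case: ifP.
rewrite (_ : [set _ | _] = ~` [set x : BV | in_box e z x] `&`
    [set x : BV | find (in_box e ^~ x) zs = j]).
  by apply: measurableI; [exact: measurableC|exact: IHzs].
apply/seteqP; split=> x /=; case: ifP => //; last by move=> _ [_ ->].
  by move=> _ [->].
by move=> _ [].
Qed.

(** Up to constants the energy is at least [(mu B)^2 N^(2 d) / n] and at most
    [N^(2 d - s)]. Hence [(mu B)^2] is bounded by [n N^(-s)], which tends to zero along
    the scales with [n <= C N^q], as [q < s]. *)
Lemma fejer_null (mu : probability BV R) (c s q C : R) (B : set BV) :
  (0 < d)%N -> measurable B -> 0 < s < d%:R -> fourier_decay mu c s -> q < s ->
  (forall N0, exists N n, [/\ (N0 <= N)%N, (0 < N)%N,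
     box_covered n (d * N)%:R^-1 B & n%:R <= C * N%:R `^ q]) ->
  mu B = 0%E.
Proof.
move=> d0 mB /andP[s0 sd] dec qs cov.
have d0' : 0 < d%:R :> R by rewrite ltr0n.
pose a := s / d%:R; have a1 : a < 1 by rewrite /a ltr_pdivrMr // mul1r.
pose K := (2 + c ^+ 2) * (6 / (1 - a)) ^+ d.
have K0 : 0 <= K.
  by rewrite mulr_ge0 ?exprn_ge0 ?divr_ge0 ?subr_ge0 ?(ltW a1) // addr_ge0 // sqr_ge0.
pose m := fine (mu B).
have m0 : 0 <= m by rewrite /m fine_ge0.
have key N n : (0 < N)%N -> box_covered n (d * N)%:R^-1 B -> n%:R <= C * N%:R `^ q ->
    m ^+ 2 <= 4 * K * C * N%:R `^ (q - s).
  move=> N0 [zs szs Bzs] nC.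
  have N0' : 0 < N%:R :> R by rewrite ltr0n.
  pose phi (x : V) := find (in_box (d * N)%:R^-1 ^~ x) zs.
  have phi_le x : (phi x < (size zs).+1)%N by rewrite ltnS find_size.
  have phi_close x y : (phi x < size zs)%N -> phi x = phi y ->
      forall i, `|x ord0 i - y ord0 i| <= (d * N)%:R^-1.
    move=> hx xy i; have hy : (phi y < size zs)%N by rewrite -xy.
    rewrite -has_find in hx; rewrite -has_find in hy.
    have /forallP/(_ i) := nth_find 0 hx; have /forallP/(_ i) := nth_find 0 hy.
    rewrite -/(phi x) -/(phi y) -xy => /andP[h1 h2] /andP[h3 h4].
    by rewrite ler_norml; apply/andP; split; lra.
  have mle : m <= fine (mu [set x : BV | (phi x < size zs)%N]).
    have mI : measurable [set x : BV | (phi x < size zs)%N].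
      rewrite (_ : [set _ | _] = \bigcup_(j in [set j | (j < size zs)%N]) [set x : BV | phi x = j]).
        by apply: bigcup_measurable => j _; exact: measurable_find.
      by apply/seteqP; split=> [x xn|x [j jn /= ->]] //; exists (phi x).
    apply: fine_le; rewrite ?prob_fin_num //; apply: le_measure; rewrite ?inE //.
    by move=> x /Bzs /=; rewrite has_find.
  have E1 := @energy_ge R d mu N N0 _ phi phi_le (fun j => measurable_find _ zs j) phi_close.
  have E2 := @energy_le R d mu N N0 c s d0 _ dec; rewrite s0 sd /= in E2.
  have {}E2 := E2 isT; rewrite -/a in E2.
  set E := energy mu N in E1 E2; set p := fine _ in mle E1.
  have Nd0 : 0 < (N ^ d)%:R ^+ 2 :> R by rewrite exprn_gt0 // ltr0n expn_gt0 N0.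
  have NE : (N%:R * N%:R `^ (1 - a)) ^+ d = (N ^ d)%:R ^+ 2 * N%:R `^ (- s) :> R.
    rewrite powRD ?(gt_eqF N0') ?implybT // powRr1 ?(ltW N0') // !exprMn mulrA.
    rewrite -expr2 -exprM natrX -exprM mulnC; congr (_ * _).
    rewrite -powR_mulrn ?powR_ge0 // -powRrM; congr (_ `^ _).
    by rewrite /a; field; rewrite gt_eqF.
  rewrite exprMn NE in E2.
  have E0 : 0 <= E by apply: sumr_ge0 => f _; apply: sumr_ge0 => g _; rewrite addr_ge0 // sqr_ge0.
  have P0 : 0 <= N%:R `^ (- s) by exact: powR_ge0.
  have H : (N ^ d)%:R ^+ 2 / 4 * m ^+ 2 <=
      C * N%:R `^ q * (K * ((N ^ d)%:R ^+ 2 * N%:R `^ (- s))).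
    apply: (@le_trans _ _ ((N ^ d)%:R ^+ 2 / 4 * p ^+ 2)).
      rewrite ler_wpM2l ?divr_ge0 ?(ltW Nd0) //.
      by rewrite lerXn2r ?nnegrE // (le_trans m0).
    apply: (le_trans E1); apply: ler_pM => //; rewrite ?ler0n //.
      by apply: le_trans nC; rewrite ler_nat.
    by rewrite /K -mulrA.
  rewrite powRD ?(gt_eqF N0') ?implybT //.
  move: H Nd0; move: (_ ^+ 2) (N%:R `^ q) (N%:R `^ (- s)) (m ^+ 2) => D Q S M H D0.
  have : D * M <= D * (4 * K * C * (Q * S)) by lra.
  by rewrite ler_pM2l.
have [mE|mN] := eqVneq m 0.
  by rewrite -(fineK (prob_fin_num mu mB)) -/m mE.
have mp : 0 < m by rewrite lt_def mN m0.
have qs' : 0 < s - q by rewrite subr_gt0.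
pose X := `|4 * K * C| / m ^+ 2 + 1.
have X1 : 1 <= X by rewrite lerDr divr_ge0 // sqr_ge0.
have [N [n [NX N0 hcov nC]]] := cov (Num.truncn (X `^ (s - q)^-1)).+1.
have N0' : 0 < N%:R :> R by rewrite ltr0n.
have := key _ _ N0 hcov nC.
have XN : X <= N%:R `^ (s - q).
  have hX : X `^ (s - q)^-1 <= N%:R.
    by apply: (le_trans (ltW (truncnS_gt _))); rewrite ler_nat.
  have X0 : 0 <= X by apply: le_trans X1.
  have XE : X = (X `^ (s - q)^-1) `^ (s - q) by rewrite -powRrM mulVf ?lt0r_neq0 ?powRr1.
  rewrite [leLHS]XE.
  by apply: ge0_ler_powR; rewrite ?nnegrE ?powR_ge0 ?ler0n // ltW.
rewrite -opprB powRN => h.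
suff : m ^+ 2 < m ^+ 2 by rewrite ltxx.
apply: (le_lt_trans h).
have X0 : 0 < X by rewrite (lt_le_trans _ X1).
apply: (@le_lt_trans _ _ (`|4 * K * C| / X)).
  apply: (@le_trans _ _ (`|4 * K * C| * (N%:R `^ (s - q))^-1)).
    by rewrite ler_wpM2r ?invr_ge0 ?powR_ge0 ?ler_norm.
  by rewrite ler_wpM2l // lef_pV2 ?posrE ?powR_gt0.
have m2 : 0 < m ^+ 2 by rewrite exprn_gt0.
rewrite ltr_pdivrMr // /X mulrDr mulr1 [m ^+ 2 * _]mulrC divfK ?gt_eqF //.
by rewrite ltrDl.
Qed.

End FejerNull.

(** * Refining a finite cloud of points *)

Section Derandomize.
Variables (R : realType) (V : eqType).

Lemma expR_le_quad (u : R) : `|u| <= 1 / 2 -> expR u <= 1 + u + 2 * u ^+ 2.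
Proof.
move=> hu; have [h1 h2] : - (1 / 2) <= u /\ u <= 1 / 2 by move: hu; rewrite ler_norml => /andP[].
have E : 1 - u <= expR (- u) by apply: le_trans (expR_ge1Dx _); rewrite lexx.
have u1 : 0 < 1 - u by lra.
have -> : expR u = (expR (- u))^-1 by rewrite expRN invrK.
apply: (@le_trans _ _ (1 - u)^-1); first by rewrite lef_pV2 ?posrE ?expR_gt0.
rewrite -div1r ler_pdivrMr //; nra.
Qed.

Definition mean (S : seq V) (f : V -> R) : R := (\sum_(y <- S) f y) / (size S)%:R.

Lemma mean_sum (I : Type) (T : seq I) (S : seq V) (f : I -> V -> R) :
  mean S (fun y => \sum_(t <- T) f t y) = \sum_(t <- T) mean S (f t).
Proof. by rewrite /mean exchange_big /= mulr_suml. Qed.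

Lemma exists_le_mean (S : seq V) (g : V -> R) : S != [::] ->
  exists2 y, y \in S & g y <= mean S g.
Proof.
move=> S0; apply: contrapT => /forall2NP H.
have S0' : 0 < (size S)%:R :> R by rewrite ltr0n; case: (S) S0.
suff : mean S g < mean S g by rewrite ltxx.
rewrite [ltRHS]/mean ltr_pdivlMr //.
have -> : mean S g * (size S)%:R = \sum_(y <- S) mean S g.
  by rewrite big_const_seq count_predT iter_addr_0 mulr_natr.
have [y0 y0S] : exists y, y \in S by case: (S) S0 => // y S' _; exists y; rewrite mem_head.
rewrite !big_seq; apply: ltr_sum; last first.
  by move=> y yS; have [//|/negP] := H y; rewrite -ltNge.
by apply/hasP; exists y0.
Qed.

Lemma le_mean (S : seq V) (f g : V -> R) : (forall y, y \in S -> f y <= g y) ->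
  mean S f <= mean S g.
Proof.
by move=> fg; rewrite /mean ler_wpM2r ?invr_ge0 // !big_seq; apply: ler_sum.
Qed.

Lemma mean_cst (S : seq V) (c : R) : S != [::] -> mean S (fun=> c) = c.
Proof.
move=> S0; rewrite /mean big_const_seq count_predT iter_addr_0 -[c *+ _]mulr_natr mulfK //.
by rewrite pnatr_eq0; case: (S) S0.
Qed.

Lemma meanD (S : seq V) (f g : V -> R) :
  mean S (fun y => f y + g y) = mean S f + mean S g.
Proof. by rewrite /mean big_split /= mulrDl. Qed.

Lemma meanZ (S : seq V) (c : R) (f : V -> R) : mean S (fun y => c * f y) = c * mean S f.
Proof. by rewrite /mean -mulr_sumr mulrA. Qed.

Lemma mean_norm_le (S : seq V) (f : V -> R) (M : R) : S != [::] ->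
  (forall y, y \in S -> `|f y| <= M) -> `|mean S f| <= M.
Proof.
move=> S0 fM; rewrite ler_norml -{1}(mean_cst (- M) S0) -{2}(mean_cst M S0).
by apply/andP; split; apply: le_mean => y yS; have := fM y yS; rewrite ler_norml => /andP[].
Qed.

(** One step of the exponential-moment method: averaged over a candidate list,
    the exponential of a centred bounded variable grows by at most
    [expR (8 lambda^2)]. *)
Lemma mean_expR (S : seq V) (f : V -> R) (l : R) : S != [::] ->
  (forall y, `|f y| <= 1) -> `|l| <= 1 / 4 ->
  mean S (fun y => expR (l * (f y - mean S f))) <= expR (8 * l ^+ 2).
Proof.
move=> S0 f1 l4.
have m1 : `|mean S f| <= 1 by exact: mean_norm_le.
have D2 y : `|f y - mean S f| <= 2 by rewrite (le_trans (ler_normB _ _)) //; have := f1 y; lra.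
apply: (@le_trans _ _ (mean S (fun y => 1 + l * (f y - mean S f) + 8 * l ^+ 2))).
  apply: le_mean => y _; apply: (le_trans (expR_le_quad _)).
    rewrite normrM (_ : 1 / 2 = 1 / 4 * 2); last by lra.
    exact: ler_pM.
  rewrite lerD2l exprMn.
  have h : (f y - mean S f) ^+ 2 <= 4.
    by rewrite -(real_normK (num_real _)); have := D2 y; have := normr_ge0 (f y - mean S f); nra.
  by have := sqr_ge0 l; nra.
rewrite !meanD !mean_cst // meanZ meanD mean_cst // subrr mulr0 addr0.
exact: expR_ge1Dx.
Qed.

Variables (J : eqType) (T : seq J) (f : J -> V -> R).
Hypothesis f1 : forall t y, `|f t y| <= 1.

Let dev (ys : seq V) (Ss : seq (seq V)) t :=
  \sum_(y <- ys) f t y - \sum_(S <- Ss) mean S (f t).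

Let potential (l : R) ys Ss :=
  \sum_(t <- T) (expR (l * dev ys Ss t) + expR (- l * dev ys Ss t)).

Let choice_potential (l : R) (Ss : seq (seq V)) : 0 < l <= 1 / 4 ->
  all (fun S => S != [::]) Ss ->
  exists2 ys, all2 (fun y S => y \in S) ys Ss &
    potential l ys Ss <= 2 * (size T)%:R * expR (8 * l ^+ 2 * (size Ss)%:R).
Proof.
move=> /andP[l0 l4]; elim: Ss => [|S Ss IH] /=.
  move=> _; exists [::] => //; rewrite /potential /dev.
  under eq_bigr do rewrite !big_nil subrr !mulr0 expR0.
  by rewrite big_const_seq count_predT iter_addr_0 mulr0 expR0 mulr1 -mulr_natr; lra.
move=> /andP[S0 /IH[ys ysS hys]].
pose g y := potential l (y :: ys) (S :: Ss).
have [y yS hy] := exists_le_mean g S0.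
exists (y :: ys); rewrite /= ?yS ?ysS //; apply: (le_trans hy).
have -> : expR (8 * l ^+ 2 * (size Ss).+1%:R) =
    expR (8 * l ^+ 2) * expR (8 * l ^+ 2 * (size Ss)%:R).
  by rewrite -expRD; congr expR; rewrite -natr1; ring.
rewrite mulrCA -[leLHS]mulr1; rewrite mulr1.
apply: (@le_trans _ _ (expR (8 * l ^+ 2) * potential l ys Ss)); last first.
  by rewrite ler_wpM2l ?expR_ge0.
rewrite /g /potential mean_sum mulr_sumr; apply: ler_sum => t _.
have devS z : dev (z :: ys) (S :: Ss) t = dev ys Ss t + (f t z - mean S (f t)).
  by rewrite /dev !big_cons; ring.
have -> : (fun y => expR (l * dev (y :: ys) (S :: Ss) t) + expR (- l * dev (y :: ys) (S :: Ss) t)) =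
    (fun y => expR (l * dev ys Ss t) * expR (l * (f t y - mean S (f t))) +
      expR (- l * dev ys Ss t) * expR (- l * (f t y - mean S (f t)))).
  by apply/funext => z; rewrite devS -!expRD -!mulrDr.
rewrite meanD !meanZ [leRHS]mulrDr; apply: lerD; rewrite mulrC ler_wpM2r ?expR_ge0 //.
  by apply: mean_expR => //; rewrite gtr0_norm.
rewrite -[l ^+ 2]sqrrN; apply: mean_expR => //.
by rewrite normrN gtr0_norm.
Qed.

(** Choosing one point in each candidate list so that every test function has
    almost its expected sum. *)
Lemma exists_choice (l : R) (Ss : seq (seq V)) : 0 < l <= 1 / 4 ->
  all (fun S => S != [::]) Ss ->
  exists2 ys, all2 (fun y S => y \in S) ys Ss &
    forall t, t \in T ->
    `|\sum_(y <- ys) f t y - \sum_(S <- Ss) mean S (f t)| <=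
      ln (2 * (size T)%:R) / l + 8 * l * (size Ss)%:R.
Proof.
move=> l14 Ss0; have [ys ysS hys] := choice_potential l14 Ss0.
have /andP[l0 l4] := l14.
exists ys => // t tT; rewrite -/(dev ys Ss t).
have T0 : 0 < 2 * (size T)%:R :> R by rewrite mulr_gt0 // ltr0n; case: (T) tT.
suff H : l * `|dev ys Ss t| <= ln (2 * (size T)%:R) + 8 * l ^+ 2 * (size Ss)%:R.
  rewrite -(ler_pM2l l0) (le_trans H) // mulrDr [l * (_ / _)]mulrC divfK ?gt_eqF // lerD2l.
  by rewrite expr2 !mulrA [l * 8]mulrC.
rewrite -ler_expR expRD lnK ?posrE //; apply: le_trans hys.
apply: (@le_trans _ _ (expR (l * dev ys Ss t) + expR (- l * dev ys Ss t))).
  case: (ler0P (dev ys Ss t)) => _.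
    by rewrite mulrN mulNr lerDr expR_ge0.
  by rewrite lerDl expR_ge0.
rewrite /potential (perm_big _ (perm_to_rem tT)) big_cons /= lerDl.
by apply: sumr_ge0 => t' _; rewrite addr_ge0 // expR_ge0.
Qed.

End Derandomize.

Section Spread.
Variables (R : realType) (d : nat).
Local Notation V := 'rV[R]_d.

Fixpoint spread (x : V) (vs : seq V) : seq V :=
  if vs is v :: vs' then spread (x + v) vs' ++ spread (x - v) vs' else [:: x].

Lemma size_spread x vs : size (spread x vs) = (2 ^ size vs)%N.
Proof.
elim: vs x => [|v vs IH] x //=; by rewrite size_cat !IH expnS mul2n addnn.
Qed.

Lemma spread_neq0 x vs : spread x vs != [::].
Proof. by rewrite -size_eq0 size_spread -lt0n expn_gt0. Qed.

Lemma sum_cos_spread xi x vs :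
  \sum_(y <- spread x vs) cos (dotp xi y) =
  (2 ^ size vs)%:R * (cos (dotp xi x) * \prod_(v <- vs) cos (dotp xi v)).
Proof.
elim: vs x => [|v vs IH] x /=; first by rewrite big_seq1 big_nil mulr1 mul1r.
rewrite big_cat /= !IH big_cons dotpDr dotpBr cosD cosB expnS natrM; ring.
Qed.

Lemma sum_sin_spread xi x vs :
  \sum_(y <- spread x vs) sin (dotp xi y) =
  (2 ^ size vs)%:R * (sin (dotp xi x) * \prod_(v <- vs) cos (dotp xi v)).
Proof.
elim: vs x => [|v vs IH] x /=; first by rewrite big_seq1 big_nil mulr1 mul1r.
rewrite big_cat /= !IH big_cons dotpDr dotpBr sinD sinB expnS natrM; ring.
Qed.

Lemma mean_cos_spread xi x vs : mean (spread x vs) (fun y => cos (dotp xi y)) =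
  cos (dotp xi x) * \prod_(v <- vs) cos (dotp xi v).
Proof.
rewrite /mean sum_cos_spread size_spread mulrAC mulfV ?mul1r //.
Qed.

Lemma mean_sin_spread xi x vs : mean (spread x vs) (fun y => sin (dotp xi y)) =
  sin (dotp xi x) * \prod_(v <- vs) cos (dotp xi v).
Proof.
rewrite /mean sum_sin_spread size_spread mulrAC mulfV ?mul1r //.
Qed.

Lemma spread_dist x vs y : y \in spread x vs -> `|y - x| <= \sum_(v <- vs) `|v|.
Proof.
elim: vs x => [|v vs IH] x /=.
  by rewrite inE big_nil => /eqP ->; rewrite subrr normr0.
rewrite mem_cat big_cons => /orP[] /IH h.
  have -> : y - x = (y - (x + v)) + v by rewrite opprD addrA subrK.
  by rewrite (le_trans (ler_normD _ _)) // addrC lerD2l.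
have -> : y - x = (y - (x - v)) - v by rewrite opprB addrCA addrC addrK.
by rewrite (le_trans (ler_normB _ _)) // addrC lerD2l.
Qed.

(** The signed sums of the steps [rho / (r 2^j)] are nearly uniform on an interval of
    length proportional to [rho / r]; [r] copies give an [r]-fold convolution. *)
Definition steps (r n : nat) (rho : R) : seq V :=
  flatten [seq flatten (nseq r [seq (rho / r%:R / 2 ^+ j.+1) *: delta_mx ord0 i
    | j <- iota 0 n]) | i <- enum 'I_d].

(** Viete's product, by iterating [sin (2 u) = 2 (sin u) (cos u)]. *)
Lemma prod_cos (t : R) (n : nat) :
  2 ^+ n * sin (t / 2 ^+ n) * \prod_(j <- iota 0 n) cos (t / 2 ^+ j.+1) = sin t.
Proof.
elim: n => [|n IH]; first by rewrite big_nil mulr1 expr0 mul1r divr1.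
rewrite -[in iota _ _]addn1 iotaD big_cat big_seq1 /= add0n -IH.
set P := \prod_(_ <- _) _; set u := t / 2 ^+ n.+1.
have -> : t / 2 ^+ n = u + u by rewrite /u exprS; field; rewrite expf_neq0.
by rewrite sinD exprS; ring.
Qed.

Lemma sin_ge_half (t : R) : 0 <= t <= 1 -> t / 2 <= sin t.
Proof.
move=> /andP[t0 t1]; have [->|tn] := eqVneq t 0; first by rewrite mul0r sin0.
have tp : 0 < t by rewrite lt_def tn.
have dsin x : x \in `]0, t[%R -> is_derive x 1 sin (cos x) by move=> _; exact: is_derive_sin.
have csin : {within `[0, t], continuous (@sin R)}.
  by apply: continuous_subspaceT => x; exact: continuous_sin.
have [c /[!in_itv]/= /andP[c0 ct]] := MVT tp dsin csin.
rewrite sin0 !subr0 => ->.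
have h : 1 / 2 <= cos c by apply: cos_ge_half; rewrite gtr0_norm //; lra.
nra.
Qed.

Lemma prod_cos_le (t : R) (n : nat) : t != 0 -> `|t| <= 2 ^+ n ->
  `|\prod_(j <- iota 0 n) cos (t / 2 ^+ j.+1)| <= 2 / `|t|.
Proof.
move=> t0 tn; have n0 : 0 < 2 ^+ n :> R by rewrite exprn_gt0.
have at0 : 0 < `|t| by rewrite normr_gt0.
have h : `|t| / 2 <= 2 ^+ n * `|sin (t / 2 ^+ n)|.
  have -> : `|sin (t / 2 ^+ n)| = `|sin (`|t| / 2 ^+ n)|.
    by case: (ler0P t) => _ //; rewrite mulNr sinN normrN.
  have := @sin_ge_half (`|t| / 2 ^+ n); rewrite divr_ge0 ?(ltW n0) //=.
  rewrite ler_pdivrMr // mul1r tn => /(_ isT) hs.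
  apply: (@le_trans _ _ (2 ^+ n * (`|t| / 2 ^+ n / 2))).
    by rewrite -mulrA mulrCA [X in _ <= X](_ : _ = `|t| / 2) //; field; rewrite gt_eqF.
  by rewrite ler_wpM2l ?(ltW n0) // (le_trans hs) // ler_norm.
have := congr1 Num.norm (prod_cos t n); rewrite !normrM [`|2 ^+ n|]gtr0_norm //.
set P := `|\prod_(_ <- _) _| => E.
have P0 : 0 <= P by exact: normr_ge0.
have S1 : `|sin t| <= 1 by exact: sin_max.
rewrite ler_pdivlMr //.
have := ler_wpM2r P0 h; rewrite E; lra.
Qed.

(** The Fourier transform of the uniform measure on [spread 0 vs]. *)
Definition psi (vs : seq V) (xi : V) : R := \prod_(v <- vs) cos (dotp xi v).

Lemma prod_norm_le1 (I : eqType) (s : seq I) (F : I -> R) :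
  (forall i, `|F i| <= 1) -> `|\prod_(i <- s) F i| <= 1.
Proof.
move=> F1; elim: s => [|i s IH]; first by rewrite big_nil normr1.
by rewrite big_cons normrM mulr_ile1.
Qed.

Lemma psi_le1 vs xi : `|psi vs xi| <= 1.
Proof. by apply: prod_norm_le1 => v; exact: cos_max. Qed.

Lemma dotp_delta (xi : V) (i : 'I_d) : dotp xi (delta_mx ord0 i) = xi ord0 i.
Proof.
rewrite /dotp (bigD1 i) //= mxE !eqxx mulr1 big1 ?addr0 // => j ji.
by rewrite mxE (negbTE ji) andbF mulr0.
Qed.

(** The average of the characters over the displaced points decays as fast as
    the transform of an [r]-fold convolution of uniform laws of scale [rho]. *)
Lemma psi_steps_le (r n : nat) (rho : R) (xi : V) : 0 < rho -> (0 < r)%N ->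
  xi != 0 -> rho / r%:R * `|xi| <= 2 ^+ n ->
  `|psi (steps r n rho) xi| <= (2 * r%:R / (rho * `|xi|)) ^+ r.
Proof.
move=> rho0 r0 xi0 hn; have r0' : 0 < r%:R :> R by rewrite ltr0n.
have [i xiE] : exists i, `|xi| = `|xi ord0 i|.
  have nz : mx_norm xi != 0 by rewrite -[mx_norm xi]/(`|xi|) normr_eq0.
  by have [[a i] E] := mx_norm_neq0 nz; exists i; rewrite [LHS]E ord1.
have xip : 0 < `|xi ord0 i| by rewrite -xiE normr_gt0.
rewrite /psi /steps big_flatten /= big_map (bigD1_seq i) ?enum_uniq ?mem_enum //=.
rewrite normrM -[leRHS]mulr1; apply: ler_pM => //; last first.
  by rewrite big_mkcond prod_norm_le1 // => j; case: ifP => _; rewrite ?normr1 // psi_le1.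
rewrite big_flatten /= big_nseq iter_mulr_1 normrX.
apply: lerXn2r; rewrite ?nnegrE ?divr_ge0 ?mulr_ge0 ?(ltW rho0) ?ler0n //.
rewrite big_map; set t := rho / r%:R * xi ord0 i.
have rr : 0 < rho / r%:R by rewrite divr_gt0.
rewrite (eq_bigr (fun j => cos (t / 2 ^+ j.+1))); last first.
  by move=> j _; rewrite dotpZr dotp_delta /t mulrAC.
have tE : `|t| = rho / r%:R * `|xi| by rewrite /t normrM (gtr0_norm rr) -xiE.
apply: (le_trans (prod_cos_le _ _)).
- by rewrite -normr_gt0 tE mulr_gt0 // xiE.
- by rewrite tE.
- rewrite tE le_eqVlt; apply/orP; left; apply/eqP; field.
  by rewrite ?gt_eqF // xiE.
Qed.

Lemma steps_norm (r n : nat) (rho : R) : 0 < rho -> (0 < r)%N ->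
  (forall x y, y \in spread x (steps r n rho) -> `|y - x| <= d%:R * rho).
Proof.
move=> rho0 r0 x y /spread_dist; move/le_trans; apply.
have r0' : 0 < r%:R :> R by rewrite ltr0n.
rewrite /steps big_flatten /= big_map.
apply: (@le_trans _ _ (\sum_(i <- enum 'I_d) rho)); last first.
  by rewrite big_const_seq count_predT size_enum_ord iter_addr_0 -[rho *+ _]mulr_natl.
apply: ler_sum => i _; rewrite big_flatten /= big_nseq iter_addr_0.
rewrite -[leLHS]mulr_natl -ler_pdivlMl // [leRHS]mulrC big_map.
have dn : `|delta_mx ord0 i : V| <= 1.
  by apply: norm_le_coord => // j; rewrite mxE; case: (_ && _); rewrite ?normr1 ?normr0.
have H m : \sum_(j <- iota 0 m) `|(rho / r%:R / 2 ^+ j.+1) *: (delta_mx ord0 i : V)| <=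
    rho / r%:R * (1 - 2^-1 ^+ m).
  elim: m => [|m IH]; first by rewrite big_nil expr0 subrr mulr0.
  rewrite -[in iota _ _]addn1 iotaD big_cat big_seq1 /= add0n normrZ.
  apply: (@le_trans _ _ (rho / r%:R * (1 - 2^-1 ^+ m) + rho / r%:R / 2 ^+ m.+1)).
    apply: lerD => //; rewrite gtr0_norm; last by rewrite !divr_gt0 // exprn_gt0.
    by rewrite ler_piMr // ltW // !divr_gt0 // exprn_gt0.
  rewrite -exprVn [2^-1 ^+ m.+1]exprS; set u := 2^-1 ^+ m; set a := rho / r%:R; lra.
apply: (le_trans (H n)); rewrite ler_piMr ?divr_ge0 ?(ltW rho0) // lerBlDr lerDl.
Qed.

End Spread.

Section CloudExtension.
Variables (R : realType) (d J : nat).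
Hypotheses (d_gt0 : (0 < d)%N) (J_gt2 : (2 < J)%N).
Local Notation V := 'rV[R]_d.

(** With [N <= m^(2 rank + 2)] points resolving the frequencies up to
    [m^(2 J)], the decay exponent is [beta = rank / (2 J)], so that the Fourier
    dimension [2 beta = d - (d + 1) / J] tends to [d] with [J]. *)
Definition rank : nat := (d * J - d - 1)%N.
Definition beta : R := rank%:R / (2 * J)%:R.
Definition weight (xi : V) : R := (1 + `|xi|) `^ (- beta).

Lemma rank_gt0 : (0 < rank)%N.
Proof. by rewrite /rank; nia. Qed.

Lemma beta_gt0 : 0 < beta.
Proof. by rewrite divr_gt0 // ltr0n ?rank_gt0 //; lia. Qed.

Lemma beta_le : beta <= d%:R.
Proof.
rewrite ler_pdivrMr ?ltr0n; last by lia.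
by rewrite -natrM ler_nat /rank; nia.
Qed.

Lemma weight_ge (m : nat) (xi : V) : (0 < m)%N -> `|xi| <= m%:R ^+ (2 * J) ->
  2^-1 ^+ d * m%:R ^- rank <= weight xi.
Proof.
move=> m0 xim; have m1 : 1 <= m%:R :> R by rewrite ler1n.
have mJ : 1 <= m%:R ^+ (2 * J) :> R by rewrite exprn_ege1.
have X0 : 0 < m%:R ^+ (2 * J) :> R by rewrite (lt_le_trans _ mJ).
apply: (@le_trans _ _ ((2 * m%:R ^+ (2 * J)) `^ (- beta))).
  rewrite powRM ?(ltW X0) // ; apply: ler_pM; rewrite ?exprn_ge0 ?invr_ge0 ?exprn_ge0 //.
    rewrite exprVn -powR_invn // ; apply: ler_powR; first by rewrite ler1n.
    by rewrite lerN2 beta_le.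
  rewrite powRN lef_pV2 ?posrE ?powR_gt0 ?exprn_gt0 ?ltr0n //.
  rewrite -powR_mulrn ?ler0n // -powRrM /beta mulrC divfK ?powR_mulrn ?ler0n //.
  by rewrite pnatr_eq0; lia.
have w1 : 0 < 1 + `|xi| by rewrite ltr_wpDr.
rewrite /weight !powRN lef_pV2 ?posrE ?powR_gt0 ?mulr_gt0 //.
apply: ge0_ler_powR; rewrite ?nnegrE ?(ltW beta_gt0) ?addr_ge0 ?mulr_ge0 ?(ltW X0) //.
by lra.
Qed.

Definition pcos (P : seq V) (xi : V) : R := mean P (fun y => cos (dotp xi y)).
Definition psin (P : seq V) (xi : V) : R := mean P (fun y => sin (dotp xi y)).

Definition trig (t : bool * V) (y : V) : R :=
  if t.1 then cos (dotp t.2 y) else sin (dotp t.2 y).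

Lemma trig_le1 t y : `|trig t y| <= 1.
Proof. by rewrite /trig; case: ifP => _; [exact: cos_max|exact: sin_max]. Qed.

Lemma trig_lip (b : bool) (xi xi' y : V) (h : R) : `|xi - xi'| <= h -> `|y| <= 2 ->
  `|trig (b, xi) y - trig (b, xi') y| <= 2 * d%:R * h.
Proof.
move=> xih y2; have h0 : 0 <= h by exact: le_trans xih.
apply: (@le_trans _ _ (`|dotp (xi - xi') y|)).
  by rewrite dotpBl /trig /=; case: b; [exact: cos_lip|exact: sin_lip].
apply: (le_trans (dotp_ub _ _)); rewrite -mulrA [2 * _]mulrC -mulrA ler_wpM2l ?ler0n //.
by rewrite [X in _ <= X]mulrC; exact: ler_pM.
Qed.

Definition net (h : R) (K : nat) : seq V :=
  [seq \row_i (((k i : nat)%:R - K%:R) * h) | k : {ffun 'I_d -> 'I_(2 * K).+1}].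

Lemma size_net h K : size (net h K) = ((2 * K).+1 ^ d)%N.
Proof. by rewrite size_map -cardT card_ffun !card_ord. Qed.

Lemma net_dense (h r : R) (K : nat) (xi : V) : 0 < h -> `|xi| <= r -> r / h <= K%:R ->
  exists2 xi', xi' \in net h K & `|xi - xi'| <= h.
Proof.
move=> h0 xir rK.
have kP i : {k : 'I_(2 * K).+1 | `|xi ord0 i - ((k : nat)%:R - K%:R) * h| <= h}.
  apply: cid.
  have := coord_le_norm xi i; rewrite ler_norml => /andP[].
  set u := xi ord0 i => u1 u2.
  have b1 : 0 <= u / h + K%:R.
    have : - (r / h) <= u / h by rewrite -mulNr ler_pM2r ?invr_gt0 //; lra.
    lra.
  have b2 : u / h + K%:R <= (2 * K)%:R.
    have : u / h <= r / h by rewrite ler_pM2r ?invr_gt0 //; lra.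
    by rewrite natrM; lra.
  have kn : (Num.truncn (u / h + K%:R) < (2 * K).+1)%N.
    by rewrite ltnS -(ler_nat R) (le_trans _ b2) // truncn_le.
  exists (Ordinal kn) => /=.
  have t1 := truncn_le (u / h + K%:R); rewrite b1 in t1.
  have t2 := truncnS_gt (u / h + K%:R).
  rewrite -natr1 in t2.
  move: t1 t2; set k := (Num.truncn _)%:R => t1 t2.
  have -> : u - (k - K%:R) * h = (u / h + K%:R - k) * h by field; rewrite gt_eqF.
  by rewrite normrM (gtr0_norm h0) ler_piMl ?(ltW h0) // ger0_norm; lra.
exists (\row_i (((sval (kP i) : nat)%:R - K%:R) * h)).
  apply/mapP; exists [ffun i => sval (kP i)]; first by rewrite mem_enum.
  by apply/rowP => i; rewrite !mxE ffunE.
apply: norm_le_coord; first exact: ltW.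
by move=> i; rewrite !mxE; exact: svalP (kP i).
Qed.

Lemma mem_all2 (ys : seq V) (Ss : seq (seq V)) (y : V) :
  all2 (fun y S => y \in S) ys Ss -> y \in ys -> exists2 S, S \in Ss & y \in S.
Proof.
elim: ys Ss => [|z ys IH] [|S Ss] //= /andP[zS ysS]; rewrite inE => /orP[/eqP ->|yys].
  by exists S; rewrite ?mem_head.
by have [S' S'Ss yS'] := IH _ ysS yys; exists S' => //; rewrite inE S'Ss orbT.
Qed.

Lemma size_all2 (ys : seq V) (Ss : seq (seq V)) :
  all2 (fun y S => y \in S) ys Ss -> size ys = size Ss.
Proof. by elim: ys Ss => [|z ys IH] [|S Ss] //= /andP[_ /IH ->]. Qed.

(** Each point is replaced by [q] of its displacements. One candidate list for each
    of these [q] children is enough room for the exponential moments to control all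
    the test functions in [T] simultaneously, as soon as [q theta^2] exceeds a
    multiple of the logarithm of their number. *)
Lemma sample (P vs : seq V) (q : nat) (T : seq (bool * V)) (theta : R) :
  0 < theta <= 1 -> P != [::] -> (0 < q)%N ->
  32 * ln (2 * (size T)%:R) / theta ^+ 2 <= q%:R ->
  exists P' : seq V, [/\ size P' = (size P * q)%N,
    forall y, y \in P' -> exists2 x, x \in P & y \in spread x vs &
    forall t, t \in T ->
      `|mean P' (trig t) - mean P (trig t) * psi vs t.2| <= theta].
Proof.
move=> /andP[th0 th1] P0 q0 hq.
pose Ss := flatten [seq nseq q (spread x vs) | x <- P].
have Ss0 : all (fun S : seq V => S != [::]) Ss.
  apply/allP => S /flatten_mapP[x xP]; rewrite mem_nseq => /andP[_ /eqP ->].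
  exact: spread_neq0.
have sSs : size Ss = (size P * q)%N.
  rewrite /Ss size_flatten /shape -map_comp; elim: (P) => //= x P' ->.
  by rewrite size_nseq mulSn.
have l14 : 0 < theta / 16 <= 1 / 4 by apply/andP; split; lra.
have [ys ysS hys] := exists_choice T (fun t y => trig_le1 t y) l14 Ss0.
exists ys; split.
- by rewrite (size_all2 ysS).
- move=> y yys; have [S + yS] := mem_all2 ysS yys.
  move=> /flatten_mapP[x xP]; rewrite mem_nseq => /andP[_ /eqP SE].
  by exists x => //; rewrite -SE.
move=> t tT; have := hys t tT.
have sP : (0 < size P)%N by rewrite lt0n size_eq0.
have n0 : 0 < (size Ss)%:R :> R by rewrite ltr0n sSs muln_gt0 sP.
have -> : \sum_(S <- Ss) mean S (trig t) = (size Ss)%:R * (mean P (trig t) * psi vs t.2).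
  rewrite /Ss big_flatten /= big_map sSs natrM /mean.
  have -> : \sum_(x <- P) \sum_(S <- nseq q (spread x vs)) mean S (trig t) =
      \sum_(x <- P) q%:R * (trig t x * psi vs t.2).
    apply: eq_bigr => x _; rewrite big_nseq iter_addr_0 -[LHS]mulr_natl; congr (_ * _).
    by rewrite /trig; case: ifP => _; [exact: mean_cos_spread|exact: mean_sin_spread].
  rewrite -mulr_sumr -mulr_suml; field.
  by rewrite pnatr_eq0 -lt0n.
rewrite /mean (size_all2 ysS) => h.
have -> : (\sum_(y <- ys) trig t y) / (size Ss)%:R - (\sum_(y <- P) trig t y) / (size P)%:R * psi vs t.2
    = (\sum_(y <- ys) trig t y - (size Ss)%:R * ((\sum_(y <- P) trig t y) / (size P)%:R * psi vs t.2))
      / (size Ss)%:R by field; rewrite ?pnatr_eq0 -?lt0n // -(ltr0n R) n0.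
rewrite normrM [`|_^-1|]gtr0_norm ?invr_gt0 // ler_pdivrMr //.
apply: (le_trans h).
have nq : q%:R <= (size Ss)%:R :> R by rewrite ler_nat sSs leq_pmull.
have := le_trans hq nq; rewrite ler_pdivrMr ?exprn_gt0 // => h2.
set n := (size Ss)%:R in h2 *; set L := ln _ in h2 *.
suff : L / (theta / 16) <= n * theta / 2 by lra.
by rewrite ler_pdivrMr ?divr_gt0 //; lra.
Qed.

(** The displacements are those of [steps], whose average character is [psi]: this is
    the damping factor [p], which decays beyond the frequency [1 / rho]. The children
    are chosen so that the error is small at a finite net of frequencies, hence, by
    Lipschitz continuity, at all the frequencies up to [m^(2 J)]; the net has
    polynomial size in [m], so that its logarithm is negligible, while the error must
    be compared with the lower bound [2^(-d) m^(-rank)] of the weight, which costs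
    about [m^(2 rank)] children for each point. *)
Lemma extend_cloud (P : seq V) (rho eps : R) (m1 : nat) :
  P != [::] -> (forall x, x \in P -> `|x| <= 1) -> 0 < rho -> d%:R * rho <= 1 -> 0 < eps ->
  exists (P' : seq V) (m : nat), [/\ (m1 <= m)%N, (0 < m)%N, P' != [::] &
    [/\ (size P' <= m ^ (2 * rank + 2))%N,
     (forall y, y \in P' -> exists2 x, x \in P & `|y - x| <= d%:R * rho) &
     (forall xi : V, xi != 0 -> `|xi| <= m%:R ^+ (2 * J) ->
      exists2 p : R, `|p| <= 1 /\ `|p| <= (2 * rank%:R / (rho * `|xi|)) ^+ rank &
      `|pcos P' xi - pcos P xi * p| <= eps * weight xi /\
      `|psin P' xi - psin P xi * p| <= eps * weight xi)]].
Proof.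
move=> P0 P1 rho0 drho eps0.
have d1 : 1 <= d%:R :> R by rewrite ler1n.
have rho1 : rho <= 1 by nra.
pose kappa : R := Num.min eps 1 * 2^-1 ^+ d / 8.
have h2d : 0 < 2^-1 ^+ d :> R by rewrite exprn_gt0.
have h2d1 : 2^-1 ^+ d <= 1 :> R by rewrite exprn_ile1 // invf_le1 // ler1n.
have mn0 : 0 < Num.min eps 1 by rewrite lt_min eps0 ltr01.
have mn1 : Num.min eps 1 <= 1 by rewrite ge_min lexx orbT.
have mne : Num.min eps 1 <= eps by rewrite ge_min lexx.
have k0 : 0 < kappa by rewrite /kappa !mulr_gt0.
have k1 : kappa <= 1 by rewrite /kappa; nra.
pose A : R := 20 * d%:R / kappa.
have A1 : 1 <= A by rewrite /A ler_pdivlMr // mul1r; lra.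
pose C1 : R := 4 + d%:R * (ln A + (2 * J + rank)%:R).
have C10 : 0 < C1.
  by rewrite /C1 ltr_wpDr // mulr_ge0 ?ler0n // addr_ge0 ?ln_ge0 ?ler0n.
pose C2 : nat := (Num.truncn (32 * C1 / kappa ^+ 2)).+1.
pose m : nat := (m1 + size P * C2 + 1)%N.
have m0 : (0 < m)%N by rewrite /m addn1.
have mr1 : 1 <= m%:R :> R by rewrite ler1n.
have mr0 : 0 < m%:R :> R by rewrite ltr0n.
(* [kappa] makes [2 theta] at most [eps] times the lower bound [weight_ge]. *)
pose theta : R := kappa * m%:R ^- rank.
have me1 : 1 <= m%:R ^+ rank :> R by rewrite exprn_ege1.
have me0 : 0 < m%:R ^+ rank :> R by rewrite exprn_gt0.
have th0 : 0 < theta by rewrite mulr_gt0 // invr_gt0.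
have th1 : theta <= 1 by rewrite /theta ler_pdivrMr // mul1r (le_trans k1).
pose h : R := theta / (4 * d%:R).
have h0 : 0 < h by rewrite divr_gt0 // mulr_gt0 // ltr0n.
have h1 : h <= 1 by rewrite /h ler_pdivrMr ?mulr_gt0 ?ltr0n //; lra.
pose R' : R := m%:R ^+ (2 * J).
have R'1 : 1 <= R' by rewrite exprn_ege1.
pose K : nat := (Num.truncn (R' / h)).+1.
pose T : seq (bool * V) := [seq (b, xi) | b <- [:: true; false], xi <- net h K].
have sT : size T = (2 * (2 * K).+1 ^ d)%N by rewrite size_allpairs size_net.
pose q : nat := (C2 * m ^ (2 * rank + 1))%N.
have q0 : (0 < q)%N by rewrite muln_gt0 expn_gt0 m0.
(* The net of step [h] has at most [(A m^(2 J + rank))^d] points, so [C1 m] bounds the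
   logarithm of the number of tests and one factor [m] in [q] absorbs it. *)
have hq : 32 * ln (2 * (size T)%:R) / theta ^+ 2 <= q%:R.
  have K1 : (2 * K).+1%:R <= A * m%:R ^+ (2 * J + rank).
    have hK : K%:R <= R' / h + 1.
      rewrite /K -natr1 lerD2r truncn_le divr_ge0 ?(ltW h0) //; lra.
    have Rh : 1 <= R' / h by rewrite ler_pdivlMr // mul1r (le_trans h1).
    rewrite -natr1 natrM; apply: (@le_trans _ _ (5 * (R' / h))); first by lra.
    rewrite le_eqVlt; apply/orP; left; apply/eqP.
    rewrite /R' /h /A /theta exprD; field.
    by rewrite ?gt_eqF ?ltr0n.
  have lnK' : ln (2 * (size T)%:R) <= C1 * m%:R.
    have K0 : 0 < (2 * K).+1%:R :> R by rewrite ltr0n.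
    rewrite sT natrM natrX mulrA lnM ?posrE ?mulr_gt0 ?exprn_gt0 // lnXn //.
    have l4 : ln (2 * 2) <= 4 :> R.
      by apply: (@le_trans _ _ (2 * 2)); [apply: ltW; apply: ln_sublinear; lra|lra].
    have lK : ln (2 * K).+1%:R <= ln A + (2 * J + rank)%:R * m%:R.
      apply: (@le_trans _ _ (ln (A * m%:R ^+ (2 * J + rank)))).
        by rewrite ler_ln ?posrE // mulr_gt0 ?exprn_gt0 // (lt_le_trans _ A1).
      rewrite lnM ?posrE ?exprn_gt0 //; last by rewrite (lt_le_trans _ A1).
      rewrite lnXn // lerD2l -[leLHS]mulr_natl ler_wpM2l ?ler0n //.
      by apply: ltW; apply: ln_sublinear.
    rewrite -[X in _ + X]mulr_natl /C1.
    have lA : 0 <= ln A by rewrite ln_ge0.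
    apply: (@le_trans _ _ (4 + d%:R * (ln A + (2 * J + rank)%:R * m%:R))).
      by apply: lerD => //; rewrite ler_wpM2l ?ler0n.
    move: lA d1 mr1 (ler0n R (2 * J + rank)).
    move: (ln A) (d%:R) (m%:R) ((2 * J + rank)%:R) => a b c f' a0 b1 c1 f0.
    have ba : 0 <= b * a * (c - 1) by apply: mulr_ge0; [apply: mulr_ge0|]; lra.
    lra.
  have C2' : 32 * C1 / kappa ^+ 2 <= C2%:R by exact: ltW (truncnS_gt _).
  have -> : 32 * ln (2 * (size T)%:R) / theta ^+ 2 =
      32 * ln (2 * (size T)%:R) / kappa ^+ 2 * m%:R ^+ (2 * rank).
    rewrite /theta [(2 * rank)%N]mulnC exprM; field.
    by rewrite ?gt_eqF.
  rewrite /q natrM natrX exprD expr1 [_ ^+ _ * m%:R]mulrC mulrA ler_wpM2r ?exprn_ge0 ?ler0n //.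
  apply: (@le_trans _ _ (32 * C1 / kappa ^+ 2 * m%:R)); last by rewrite ler_wpM2r ?ler0n.
  rewrite [leRHS]mulrAC ler_wpM2r ?invr_ge0 ?sqr_ge0 // -mulrA ler_wpM2l //.
have th01 : 0 < theta <= 1 by rewrite th0.
pose n : nat := (m ^ (2 * J))%N.
have [P' [sP' P'P hP']] := sample (steps d rank n rho) th01 P0 q0 hq.
have sP : (0 < size P)%N by rewrite lt0n size_eq0.
have P'd y : y \in P' -> exists2 x, x \in P & `|y - x| <= d%:R * rho.
  move=> /P'P[x xP ys]; exists x => //.
  exact: (steps_norm rho0 rank_gt0 ys).
have P'0 : P' != [::] by rewrite -size_eq0 sP' -lt0n muln_gt0 sP.
exists P', m; split => //; first by rewrite /m -addnA leq_addr.
split => //.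
  rewrite sP' /q mulnA (_ : (2 * rank + 2 = (2 * rank + 1).+1)%N); last exact: addnS.
  rewrite expnS leq_mul2r; apply/orP; right.
  by rewrite /m -addnA (leq_trans (leq_addr 1 _)) // leq_addl.
move=> xi xi0 xiR; exists (psi (steps d rank n rho) xi).
  split; first exact: psi_le1.
  apply: psi_steps_le => //; first exact: rank_gt0.
  apply: (@le_trans _ _ R').
    rewrite -[leRHS]mul1r; apply: ler_pM; rewrite ?divr_ge0 ?(ltW rho0) ?ler0n //.
    by rewrite ler_pdivrMr ?ltr0n ?rank_gt0 // mul1r (le_trans rho1) // ler1n rank_gt0.
  by rewrite /R' -!natrX ler_nat ltnW // /n ltn_expl.
have [xi' xi'net xixi'] : exists2 xi', xi' \in net h K & `|xi - xi'| <= h.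
  by apply: (net_dense h0 xiR); exact: ltW (truncnS_gt _).
have Pn1 (x : V) : x \in P -> forall y, y \in spread x (steps d rank n rho) -> `|y| <= 2.
  move=> xP y ys; have := steps_norm rho0 rank_gt0 ys; have := P1 _ xP.
  have -> : y = (y - x) + x by rewrite subrK.
  by rewrite addrK => a b; rewrite (le_trans (ler_normD _ _)) //; lra.
have key b : `|mean P' (trig (b, xi)) - mean P (trig (b, xi)) * psi (steps d rank n rho) xi|
    <= eps * weight xi.
  have tT : (b, xi') \in T by apply/allpairsP; exists (b, xi'); split=> //; case: (b).
  have := hP' _ tT; rewrite /= => H0.
  have H1 : `|mean P' (trig (b, xi)) - mean P' (trig (b, xi'))| <= theta / 2.
    have -> : mean P' (trig (b, xi)) - mean P' (trig (b, xi')) =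
        mean P' (fun y => trig (b, xi) y - trig (b, xi') y).
      by rewrite /mean -mulrBl -sumrB.
    apply: mean_norm_le => // y /P'P[x xP ys].
    have -> : theta / 2 = 2 * d%:R * h by rewrite /h; field; rewrite gt_eqF ?ltr0n.
    exact: trig_lip (Pn1 _ xP _ ys).
  have mE (z : V) : mean P (trig (b, z)) * psi (steps d rank n rho) z =
      mean P (fun x => mean (spread x (steps d rank n rho)) (trig (b, z))).
    rewrite /mean mulrAC mulr_suml; congr (_ / _); apply: eq_bigr => x _.
    by rewrite -/(mean _ _) /trig /=; case: (b); rewrite ?mean_cos_spread ?mean_sin_spread.
  have H2 : `|mean P (trig (b, xi)) * psi (steps d rank n rho) xi -
      mean P (trig (b, xi')) * psi (steps d rank n rho) xi'| <= theta / 2.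
    rewrite !mE.
    have -> : mean P (fun x => mean (spread x (steps d rank n rho)) (trig (b, xi))) -
        mean P (fun x => mean (spread x (steps d rank n rho)) (trig (b, xi'))) =
        mean P (fun x => mean (spread x (steps d rank n rho))
          (fun y => trig (b, xi) y - trig (b, xi') y)).
      rewrite /mean -mulrBl -sumrB; congr (_ / _); apply: eq_bigr => x _.
      by rewrite -mulrBl -sumrB.
    apply: mean_norm_le => // x xP; apply: mean_norm_le => [|y ys]; first exact: spread_neq0.
    have -> : theta / 2 = 2 * d%:R * h by rewrite /h; field; rewrite gt_eqF ?ltr0n.
    exact: trig_lip (Pn1 _ xP _ ys).
  have H3 : 2 * theta <= eps * weight xi.
    apply: (@le_trans _ _ (eps * (2^-1 ^+ d * m%:R ^- rank))); last first.
      by rewrite ler_wpM2l ?(ltW eps0) // weight_ge.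
    have mi0 : 0 < m%:R ^- rank :> R by rewrite invr_gt0.
    rewrite /theta /kappa [X in X <= _](_ : _ =
      (Num.min eps 1 / 4) * (2^-1 ^+ d * m%:R ^- rank)); last by field; rewrite gt_eqF.
    rewrite ler_wpM2r ?mulr_ge0 ?(ltW h2d) ?(ltW mi0) //; lra.
  move: H0 H1 H2 H3; move: (mean P' _) (mean P' _) (mean P _ * _) (mean P _ * _) => a1 a2 a3 a4.
  move=> H0 H1 H2 H3.
  have -> : a1 - a3 = (a1 - a2) + (a2 - a4) - (a3 - a4) by ring.
  apply: (le_trans (ler_normB _ _)).
  apply: (@le_trans _ _ (theta / 2 + theta + theta / 2)); last lra.
  apply: lerD => //; apply: (le_trans (ler_normD _ _)); exact: lerD.
by split; [exact: (key true)|exact: (key false)].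
Qed.

End CloudExtension.

(** * Uniform measures on clouds, and supports of weak limits *)

Section UniformCloud.
Variables (R : realType) (d : nat).
Local Notation V := 'rV[R]_d.
Local Notation BV := (borel_rV R d).

(** The uniform probability on the points of a nonempty cloud, given by a head
    and a tail so that it is a probability unconditionally. *)
Fact inv_size_ge0 (s : seq V) : 0 <= (size s).+1%:R^-1 :> R.
Proof. by rewrite invr_ge0 ler0n. Qed.

Definition cloud_prob (x0 : V) (s : seq V) : set BV -> \bar R :=
  mscale (NngNum (inv_size_ge0 s))
    (msum (fun i => \d_(nth 0 (x0 :: s) i : BV)) (size s).+1).

HB.instance Definition _ x0 s := Measure.on (cloud_prob x0 s).

Lemma cloud_prob_full x0 s (A : set BV) :
  (forall x, x \in x0 :: s -> A x) -> cloud_prob x0 s A = 1%E.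
Proof.
move=> PA; rewrite /cloud_prob /mscale /= /msum.
have -> : (\sum_(i < (size s).+1) \d_(nth 0%R (x0 :: s) i : BV) A = ((size s).+1%:R : R)%:E)%E.
  rewrite -[X in X%:R]card_ord -sum1_card natr_sum -sumEFin.
  apply: eq_bigr => i _; rewrite diracE mem_set //; apply: PA; exact: mem_nth.
by rewrite -EFinM mulVf // gt_eqF // ltr0n.
Qed.

HB.instance Definition _ x0 s := Measure_isProbability.Build _ _ _
  (cloud_prob x0 s) (cloud_prob_full (A := setT) (fun x _ => I)).

Lemma uniform_cloud (P : seq V) : P != [::] ->
  exists mu : probability BV R,
    (forall h : BV -> R, bounded_mfun h -> \int[mu]_x h x = mean P h) /\
    (forall A : set BV, measurable A -> (forall x, x \in P -> A x) -> mu A = 1%E).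
Proof.
case: P => // x0 s _; set P := x0 :: s; set n := size P.
pose mu : probability BV R := cloud_prob x0 s.
exists mu; split; last by move=> A _; exact: cloud_prob_full.
move=> h [mh [M hM]].
have M0 : 0 <= M by exact: le_trans (hM 0).
have pos (g : BV -> R) : measurable_fun setT g -> (forall x, 0 <= g x) -> \int[mu]_x g x = mean P g.
  move=> mg g0; rewrite /Rintegral /mu.
  have mgE : measurable_fun setT (EFin \o g) by apply/measurable_EFinP.
  rewrite ge0_integral_mscale //=; last by move=> x _; rewrite lee_fin.
  rewrite ge0_integral_measure_sum //; last by move=> x _; rewrite lee_fin.
  rewrite (eq_bigr (fun i : 'I_n => (g (nth 0 P i))%:E)); last first.
    by move=> i _; rewrite integral_dirac // diracT mul1e.
  rewrite sumEFin -EFinM /= /mean mulrC; congr (_ / _).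
  by rewrite [RHS](big_nth 0) big_mkord.
have bM : bounded_mfun (fun _ : BV => M) by exact: bounded_mfun_cst.
have bh : bounded_mfun h by split=> //; exists M.
have -> : \int[mu]_x h x = \int[mu]_x (h x + M) - M.
  rewrite RintegralD //; last 2 first.
  - exact: bounded_mfun_integrable.
  - exact: bounded_mfun_integrable.
  by rewrite Rintegral_prob_cst addrK.
rewrite pos; first by rewrite meanD mean_cst // addrK.
- by apply: measurable_funD.
- by move=> x; have := hM x; rewrite ler_norml => /andP[]; lra.
Qed.

End UniformCloud.

Section LimitSupport.
Variables (R : realType) (d : nat).
Local Notation V := 'rV[R]_d.
Local Notation BV := (borel_rV R d).

Definition bump (y : V) (r : R) (x : V) : R := Num.max 0 (r - `|x - y|).

Lemma bump_lip y r x x' : `|bump y r x - bump y r x'| <= 1 * `|x - x'|.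
Proof.
rewrite mul1r /bump.
have h : `| `|x' - y| - `|x - y| | <= `|x - x'|.
  apply: (le_trans (ler_dist_dist _ _)).
  have -> : x' - y - (x - y) = x' - x by rewrite opprB addrA subrK.
  by rewrite distrC.
move: h; rewrite !ler_norml => /andP[h1 h2].
by case: (leP 0 (r - `|x - y|)) => a; case: (leP 0 (r - `|x' - y|)) => b; apply/andP; split; lra.
Qed.

Lemma bump_bounded y r x : 0 <= r -> `|bump y r x| <= r.
Proof.
move=> r0; rewrite /bump ger0_norm ?le_max ?lexx // ge_max r0 /= lerBlDr lerDl.
exact: normr_ge0.
Qed.

Variables (I : Type) (U : set_system I).
Hypothesis UU : UltraFilter U.
Variables (mu_ : I -> probability BV R) (mu : probability BV R).
Hypothesis lim_mu : forall (h : V -> R) (K M : R), 0 <= K ->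
  (forall x y, `|h x - h y| <= K * `|x - y|) -> (forall x, `|h x| <= M) ->
  \int[mu_ i]_x h x @[i --> U] --> \int[mu]_x h x.

(** The bump supported in the ball has zero integral in the limit, whereas it is at
    least [r / 2] on the ball of radius [r / 2]. *)
Lemma limit_support (y : V) (r : R) : 0 < r ->
  U [set i | mu_ i (ball y r) = 0%E] -> ~ msupport mu y.
Proof.
move=> r0 Ur; pose h := bump y r.
have hlip := bump_lip y r; have hb x := bump_bounded y x (ltW r0).
have bh : bounded_mfun (h : BV -> R) := lip_bounded_borel hlip hb.
have mball e : measurable (ball y e : set BV) by apply: open_borel; exact: ball_open.
have h0 : \int[mu]_x h x = 0.
  have ev : U [set i | \int[mu_ i]_x h x = 0].
    apply: filterS Ur => i /= mu0; apply/eqP; rewrite -normr_eq0 eq_le normr_ge0 andbT.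
    apply: (@Rintegral_norm_le_full _ BV R (mu_ i) (~` (ball y r)) h 0) => //.
    - exact: measurableC.
    - by rewrite probability_setC // mu0 sube0.
    - move=> x nx; rewrite /h /bump; case: (leP 0 (r - `|x - y|)) => //; last by rewrite normr0.
      rewrite le_eqVlt => /predU1P[<-|]; first by rewrite normr0.
      by rewrite subr_gt0 => xr; exfalso; apply: nx; rewrite -ball_normE /ball_ /= distrC.
  have c := lim_mu ler01 hlip hb.
  have c0 : \int[mu_ i]_x h x @[i --> U] --> (0 : R).
    apply/cvgrPdist_lt => e e0; apply: filterS ev => i /= ->.
    by rewrite subrr normr0.
  exact: (cvg_unique _ c c0).
move=> ys; have := ys (ball y (r / 2)) (ball_open _ _); rewrite -[_ y]/((ball y (r / 2)) y).
have r2 : 0 < r / 2 by rewrite divr_gt0.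
move=> /(_ (ballxx _ r2)).
suff H : r / 2 * fine (mu (ball y (r / 2))) <= 0.
  rewrite -(fineK (prob_fin_num mu (mball (r / 2)))) lte_fin => m0.
  by move: H; rewrite pmulr_rle0 // leNgt m0.
rewrite -h0 -Rintegral_indic // -RintegralZl //; last first.
  by apply: bounded_mfun_integrable => //; exact: bounded_mfun_indic.
apply: le_Rintegral_prob => //.
  by apply: bounded_mfunM; [exact: bounded_mfun_cst|exact: bounded_mfun_indic].
move=> x; rewrite indicE; case: (boolP (_ \in _)) => [/set_mem|_]; last first.
  by rewrite mulr0 /h /bump le_max lexx.
rewrite -ball_normE /ball_ /= distrC mulr1 /h /bump le_max => xr.
by apply/orP; right; lra.
Qed.

Lemma limit_cosint (xi : V) : cosint (mu_ i) xi @[i --> U] --> cosint mu xi.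
Proof.
by apply: (lim_mu _ (cos_dotp_lip xi) (fun x => cos_max _)); rewrite mulr_ge0 // ler0n.
Qed.

Lemma limit_sinint (xi : V) : sinint (mu_ i) xi @[i --> U] --> sinint mu xi.
Proof.
by apply: (lim_mu _ (sin_dotp_lip xi) (fun x => sin_max _)); rewrite mulr_ge0 // ler0n.
Qed.

Lemma limit_le (f : I -> R) (l c : R) : f i @[i --> U] --> l ->
  U [set i | `|f i| <= c] -> `|l| <= c.
Proof.
move=> fl Uc; apply/ler_addgt0Pr => e e0.
have PU := @ultra_proper _ _ UU.
have /cvgrPdist_lt/(_ e e0) := fl => H.
have [i [/= h1 h2]] := filter_ex (filterI H Uc).
have -> : l = (l - f i) + f i by rewrite subrK.
by rewrite (le_trans (ler_normD _ _)) // addrC lerD // ltW.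
Qed.

End LimitSupport.

(** * The tree of clouds driven by a sequence of bits *)

Section Decay.
Variables (R : realType) (d : nat).
Local Notation V := 'rV[R]_d.
Local Notation BV := (borel_rV R d).
Hypothesis d_gt0 : (0 < d)%N.

Lemma enorm_le (x : V) : enorm x <= d%:R * `|x|.
Proof.
rewrite -[leRHS]ger0_norm ?mulr_ge0 // -sqrtr_sqr ler_wsqrtr // exprMn.
apply: (@le_trans _ _ (d%:R * `|x| * `|x|)); first exact: le_trans (ler_norm _) (dotp_ub _ _).
by rewrite -mulrA -expr2 ler_wpM2r ?sqr_ge0 // expr2 ler_peMl ?ler1n.
Qed.

Lemma normc_fourier_le (mu : probability BV R) (xi : V) (a : R) :
  `|cosint mu xi| <= a -> `|sinint mu xi| <= a ->
  ComplexField.Normc.normc (fourier mu xi) <= 2 * a.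
Proof.
move=> ca sa; have a0 : 0 <= a by exact: le_trans ca.
rewrite normc_fourier -[2 * a]ger0_norm ?mulr_ge0 // -sqrtr_sqr ler_wsqrtr //.
rewrite -(real_normK (num_real (cosint mu xi))) -(real_normK (num_real (sinint mu xi))).
have := normr_ge0 (cosint mu xi); have := normr_ge0 (sinint mu xi).
by move: ca sa; move: (`|_|) (`|_|) => u v; nra.
Qed.

(** For [|x| >= 1] a smaller exponent gives a larger power, and for [|x| < 1] the power
    is at least [1] whereas the transform of a probability is bounded. *)
Lemma fourier_decay_weaken (mu : probability BV R) (c s s' : R) : 0 <= s' <= s ->
  fourier_decay mu c s -> fourier_decay mu (c + 2) s'.
Proof.
move=> /andP[s'0 s's] [c0 dec]; split=> [|x x0]; first by rewrite addr_gt0.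
have e0 : 0 <= enorm x by exact: sqrtr_ge0.
have [x1|x1] := leP 1 (enorm x).
  apply: (le_trans (dec x x0)); apply: (@le_trans _ _ (c * enorm x `^ (- s' / 2))).
    by rewrite ler_pM2l // ler_powR //; lra.
  by rewrite ler_wpM2r ?powR_ge0 // lerDl.
apply: (@le_trans _ _ (2 * 1)).
  apply: normc_fourier_le; apply: Rintegral_norm_le => [|y].
  - by have [] := cos_dotp_bounded x.
  - exact: cos_max.
  - by have [] := sin_dotp_bounded x.
  - exact: sin_max.
have h : 1 <= enorm x `^ (- s' / 2).
  have e1 : 0 < enorm x.
    rewrite lt_def e0 andbT; apply: contra x0 => /eqP h; apply/eqP/rowP => i; rewrite mxE.
    apply/eqP; rewrite -normr_eq0 eq_le normr_ge0 andbT -h; exact: enorm_ge_coord.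
  have e01 : 0 < enorm x <= 1 by rewrite e1 ltW.
  rewrite -[leLHS](powRr0 (enorm x)); apply: (ger_powR e01); lra.
by apply: ler_pM; rewrite // lerDr ltW.
Qed.

(** A point is covered by one cube of any size. *)
Lemma singleton_null (mu : probability BV R) (c s : R) (x : V) : 0 < s < d%:R ->
  fourier_decay mu c s -> mu [set x] = 0%E.
Proof.
move=> /andP[s0 sd] dec; apply: (@fejer_null _ _ mu c s 0 1 [set x] d_gt0 _ _ dec s0).
- apply: closed_borel; exact: accessible_closed_set1 (hausdorff_accessible (@norm_hausdorff _ _)) _.
- by rewrite s0.
move=> N0; exists N0.+1, 1%N; split=> //; last by rewrite powRr0 mulr1.
exists [:: x] => // y /= ->; rewrite orbF; apply/forallP => i.
by rewrite lexx lerDl invr_ge0 ler0n.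
Qed.

Lemma countable_negligible (mu : probability BV R) (c s : R) (P : nat -> seq V) :
  0 < s < d%:R -> fourier_decay mu c s ->
  mu.-negligible ([set x | exists k, x \in P k] : set BV).
Proof.
move=> s0 dec.
rewrite (_ : [set x | _] = \bigcup_k [set` P k]); last first.
  by apply/seteqP; split=> x [k xk]; [exists k|exists k; case: xk].
apply: negligible_bigcup => k; elim: (P k) => [|x p IH].
  by rewrite set_nil; exact: negligible_set0.
have -> : [set` x :: p] = [set x] `|` [set` p].
  apply/seteqP; split=> y /=; rewrite inE; first by move=> /orP[/eqP|]; [left|right].
  by move=> [->|->]; rewrite ?eqxx ?orbT.
apply: negligibleU => //.
exists [set x]; split=> //; last exact: singleton_null dec.
apply: closed_borel; exact: accessible_closed_set1 (hausdorff_accessible (@norm_hausdorff _ _)) _.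
Qed.

End Decay.

Section Tree.
Variables (R : realType) (d J m0 : nat).
Hypotheses (d_gt0 : (0 < d)%N) (J_gt2 : (2 < J)%N) (m0_gt0 : (0 < m0)%N).
Local Notation V := 'rV[R]_d.
Local Notation BV := (borel_rV R d).
Local Notation rk := (rank d J).
Local Notation cloud := (seq V * nat)%type.

(** The conclusion of [extend_cloud]; the second component of a cloud is its
    resolution [m], frequencies up to [m^(2 J)] being controlled. *)
Definition is_extension (P : seq V) (rho eps : R) (m1 : nat) (Q : cloud) : Prop :=
  [/\ (m1 <= Q.2)%N, (0 < Q.2)%N, Q.1 != [::] &
    [/\ (size Q.1 <= Q.2 ^ (2 * rk + 2))%N,
     (forall y, y \in Q.1 -> exists2 x, x \in P & `|y - x| <= d%:R * rho) &
     (forall xi : V, xi != 0 -> `|xi| <= Q.2%:R ^+ (2 * J) ->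
      exists2 p : R, `|p| <= 1 /\ `|p| <= (2 * rk%:R / (rho * `|xi|)) ^+ rk &
      `|pcos Q.1 xi - pcos P xi * p| <= eps * weight J xi /\
      `|psin Q.1 xi - psin P xi * p| <= eps * weight J xi)]].

(** The inverse scale of the displacements at stage [k]: a raised bit makes them
    minute compared with any power of the number of points. *)
Definition fineness (k : nat) (b : bool) (Q : cloud) : nat :=
  if b then maxn (Q.2 ^ (2 * J - 1)) (size Q.1 ^ k.+1) else (Q.2 ^ (2 * J - 1))%N.

Definition next_cloud (k : nat) (b : bool) (Q : cloud) : cloud :=
  let L := fineness k b Q in
  xget Q [set Q' | is_extension Q.1 (4 * d%:R ^+ 2 * L%:R)^-1 (2^-1 ^+ k) (2 * L) Q'].

(** For the displacement bound [rho = 1 / (4 d^2 n)] of a stage of fineness [n], this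
    is the bound [d rho] of the distance between a point and its parent. *)
Definition mesh (n : nat) : R := (4 * d * n)%:R^-1.
Definition tree_root : V := const_mx (2 * mesh (m0 ^ (2 * J - 1))).

Fixpoint tree (b : nat -> bool) (k : nat) : cloud :=
  if k is k'.+1 then next_cloud k' (b k') (tree b k') else ([:: tree_root], m0).

Definition tfine b k := fineness k (b k) (tree b k).

Lemma mesh_gt0 n : (0 < n)%N -> 0 < mesh n.
Proof. by move=> n0; rewrite invr_gt0 ltr0n !muln_gt0 d_gt0 n0. Qed.

Lemma le_mesh n n' : (0 < n)%N -> (n <= n')%N -> mesh n' <= mesh n.
Proof.
move=> n0 nn'; rewrite lef_pV2 ?posrE ?ltr0n ?muln_gt0 ?d_gt0 ?n0 ?(leq_trans n0 nn') //.
by rewrite ler_nat leq_mul2l nn' orbT.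
Qed.

Lemma mesh_double n : (0 < n)%N -> 2 * mesh (2 * n) = mesh n.
Proof.
move=> n0; rewrite /mesh !natrM; field.
by rewrite !pnatr_eq0 -!lt0n d_gt0 n0.
Qed.

Lemma fineness_ge k b Q : (Q.2 ^ (2 * J - 1) <= fineness k b Q)%N.
Proof. by rewrite /fineness; case: b => //; exact: leq_maxl. Qed.

Lemma fineness_gt0 k b Q : (0 < Q.2)%N -> (0 < fineness k b Q)%N.
Proof. by move=> q0; apply: leq_trans (fineness_ge _ _ _); rewrite expn_gt0 q0. Qed.

(** The last clause reserves room around the point [x] for all later displacements,
    which add up to at most twice the next one. *)
Definition tree_inv (Q : cloud) : Prop :=
  [/\ Q.1 != [::], (0 < Q.2)%N, (size Q.1 <= Q.2 ^ (2 * rk + 2))%N &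
   forall x, x \in Q.1 -> `|x - tree_root| + 2 * mesh (Q.2 ^ (2 * J - 1)) <=
     2 * mesh (m0 ^ (2 * J - 1))].

Let E0 : (0 < m0 ^ (2 * J - 1))%N. Proof. by rewrite expn_gt0 m0_gt0. Qed.

Lemma near_root (x : V) i : `|x - tree_root| <= 2 * mesh (m0 ^ (2 * J - 1)) ->
  0 <= x ord0 i <= m0%:R^-1.
Proof.
move=> xr; have := le_trans (coord_le_norm (x - tree_root) i) xr.
rewrite !mxE ler_norml => /andP[h1 h2].
suff : 4 * mesh (m0 ^ (2 * J - 1)) <= m0%:R^-1 by move=> h; apply/andP; split; lra.
rewrite /mesh -mulnA natrM invfM mulrA mulfV ?mul1r //.
rewrite lef_pV2 ?posrE ?ltr0n ?muln_gt0 ?d_gt0 ?E0 ?m0_gt0 // ler_nat.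
apply: (@leq_trans (m0 ^ (2 * J - 1))); last by rewrite -[X in (X <= _)%N]mul1n leq_mul.
by rewrite -[X in (X <= _)%N]expn1 leq_pexp2l // leq_subRL; lia.
Qed.

Lemma inv_near_root Q : tree_inv Q -> forall x, x \in Q.1 ->
  `|x - tree_root| <= 2 * mesh (m0 ^ (2 * J - 1)).
Proof.
move=> [_ q0 _ H] x /H; apply: le_trans; rewrite lerDl mulr_ge0 // ltW // mesh_gt0 //.
by rewrite expn_gt0 q0.
Qed.

Lemma inv_norm_le1 Q : tree_inv Q -> forall x, x \in Q.1 -> `|x| <= 1.
Proof.
move=> iQ x /(inv_near_root iQ) xr; apply: norm_le_coord => // i.
have /andP[h1 h2] := near_root i xr; rewrite ger0_norm // (le_trans h2) // invf_le1 ?ltr0n //.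
by rewrite ler1n.
Qed.

Lemma next_cloudP k b Q : tree_inv Q ->
  is_extension Q.1 (4 * d%:R ^+ 2 * (fineness k b Q)%:R)^-1 (2^-1 ^+ k)
    (2 * fineness k b Q) (next_cloud k b Q).
Proof.
move=> iQ; have [Q0 q0 _ _] := iQ; have L0 := fineness_gt0 k b q0.
have L0' : 0 < (fineness k b Q)%:R :> R by rewrite ltr0n.
have d0 : 0 < d%:R :> R by rewrite ltr0n.
have rho0 : 0 < (4 * d%:R ^+ 2 * (fineness k b Q)%:R)^-1 :> R.
  by rewrite invr_gt0 !mulr_gt0 // exprn_gt0.
have drho : d%:R * (4 * d%:R ^+ 2 * (fineness k b Q)%:R)^-1 <= 1 :> R.
  rewrite ler_pdivrMr ?mulr_gt0 ?exprn_gt0 // mul1r expr2.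
  have d1 : 1 <= d%:R :> R by rewrite ler1n.
  have L1 : 1 <= (fineness k b Q)%:R :> R by rewrite ler1n.
  by nra.
have eps0 : 0 < 2^-1 ^+ k :> R by rewrite exprn_gt0 // invr_gt0.
have [P' [m [h1 h2 h3 h4]]] :=
  extend_cloud d_gt0 J_gt2 (2 * fineness k b Q) Q0 (inv_norm_le1 iQ) rho0 drho eps0.
apply: (@xgetPex _ Q [set Q' | is_extension _ _ _ _ Q']).
by exists (P', m); split.
Qed.

Lemma d_rho n : (0 < n)%N -> d%:R * (4 * d%:R ^+ 2 * n%:R)^-1 = mesh n :> R.
Proof.
move=> n0; rewrite /mesh !natrM; field.
by rewrite !pnatr_eq0 -!lt0n d_gt0 n0.
Qed.

Lemma expJ_ge m : (0 < m)%N -> (m <= m ^ (2 * J - 1))%N.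
Proof. by move=> m_gt0; rewrite -[X in (X <= _)%N]expn1 leq_pexp2l // leq_subRL; lia. Qed.

Lemma next_inv k b Q : tree_inv Q -> tree_inv (next_cloud k b Q).
Proof.
move=> iQ; have [hm m'0 P'0 [sP' near_ _]] := next_cloudP k b iQ.
have [Q0 q0 _ Qr] := iQ; have L0 := fineness_gt0 k b q0.
split => // y /near_[x xQ]; rewrite d_rho // => yx.
have := Qr _ xQ; have q'0 : (0 < Q.2 ^ (2 * J - 1))%N by rewrite expn_gt0 q0.
have h1 : mesh (fineness k b Q) <= mesh (Q.2 ^ (2 * J - 1)) by apply: le_mesh => //; exact: fineness_ge.
have h2 : 2 * mesh ((next_cloud k b Q).2 ^ (2 * J - 1)) <= mesh (Q.2 ^ (2 * J - 1)).
  rewrite -(mesh_double q'0) ler_pM2l //; apply: le_mesh; first by rewrite muln_gt0.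
  apply: leq_trans (expJ_ge m'0); apply: leq_trans hm; rewrite leq_mul2l /=.
  exact: fineness_ge.
have h3 : `|y - tree_root| <= `|y - x| + `|x - tree_root| by rewrite -[y - tree_root](subrKA x); exact: ler_normD.
move: (mesh _) (mesh _) (mesh _) (mesh _) h1 h2 h3 yx => A B C D; lra.
Qed.

Lemma treeP b k : tree_inv (tree b k).
Proof.
elim: k => [|k IH] /=; last exact: next_inv.
split => //=; first by rewrite expn_gt0 m0_gt0.
by move=> x; rewrite inE => /eqP ->; rewrite subrr normr0 add0r.
Qed.

Lemma tree_step b k : is_extension (tree b k).1 (4 * d%:R ^+ 2 * (tfine b k)%:R)^-1
  (2^-1 ^+ k) (2 * tfine b k) (tree b k.+1).
Proof. by apply: next_cloudP; exact: treeP. Qed.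

Lemma tfine_gt0 b k : (0 < tfine b k)%N.
Proof. by apply: fineness_gt0; have [] := treeP b k. Qed.

Lemma tree_growth b k : (2 * tfine b k <= (tree b k.+1).2)%N.
Proof. by have [] := tree_step b k. Qed.

Lemma tree_le_tfine b k : ((tree b k).2 <= tfine b k)%N.
Proof.
by have [_ q0 _ _] := treeP b k; apply: leq_trans (expJ_ge q0) _; exact: fineness_ge.
Qed.

Lemma tree_size_ge b k : (2 ^ k <= (tree b k).2)%N.
Proof.
elim: k => [|k IH]; first exact: m0_gt0.
apply: leq_trans (tree_growth b k); rewrite expnS leq_mul2l /=.
exact: leq_trans IH (tree_le_tfine b k).
Qed.

Lemma tfine_ge b k : (2 ^ k <= tfine b k)%N.
Proof. exact: leq_trans (tree_size_ge b k) (tree_le_tfine b k). Qed.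

(** The first displacement bound and the later ones add up to less than twice the
    first, so the later clouds stay in this closed neighbourhood. *)
Definition stage b k : set V :=
  [set x | exists2 y, y \in (tree b k).1 & `|x - y| <= 2 * mesh (tfine b k)].

Lemma tree_near b k y : y \in (tree b k.+1).1 ->
  exists2 x, x \in (tree b k).1 & `|y - x| <= mesh (tfine b k).
Proof.
have [_ _ _ [_ H _]] := tree_step b k; move=> /H[x xP].
by rewrite d_rho ?tfine_gt0 //; exists x.
Qed.

Lemma mesh_tfineS b k : 2 * mesh (tfine b k.+1) <= mesh (tfine b k).
Proof.
rewrite -(mesh_double (tfine_gt0 b k)) ler_pM2l //; apply: le_mesh.
  by rewrite muln_gt0 tfine_gt0.
exact: leq_trans (tree_growth b k) (tree_le_tfine b k.+1).
Qed.

Lemma stageS b k : stage b k.+1 `<=` stage b k.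
Proof.
move=> x [y /tree_near[z zP yz] xy]; exists z => //.
have h := mesh_tfineS b k; rewrite -[x - z](subrKA y) (le_trans (ler_normD _ _)) //; lra.
Qed.

Lemma stage_mono b k k' : (k <= k')%N -> stage b k' `<=` stage b k.
Proof.
by move=> /subnK <-; elim: (k' - k)%N => // n IH; apply: subset_trans IH; rewrite addSn; exact: stageS.
Qed.

Lemma tree_sub_stage b k y : y \in (tree b k).1 -> stage b k y.
Proof.
by move=> yP; exists y => //; rewrite subrr normr0 mulr_ge0 // ltW // mesh_gt0 // tfine_gt0.
Qed.

Lemma closed_stage b k : closed (stage b k).
Proof.
rewrite (_ : stage b k = \bigcup_(y in [set` (tree b k).1])
    [set x : V | `|x - y| <= 2 * mesh (tfine b k)]); last first.
  by apply/seteqP; split=> x [y yP xy]; exists y.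
apply: closed_bigcup => [|y _]; first exact: finite_seq.
have -> : [set x : V | `|x - y| <= 2 * mesh (tfine b k)] =
    (fun x : V => `|x - y|) @^-1` [set r | r <= 2 * mesh (tfine b k)] by [].
apply: closed_comp; last exact: closed_le.
move=> x _; apply: (@lip_continuous _ _ (fun x : V => `|x - y|) 1) => u v.
rewrite mul1r; apply: (le_trans (ler_dist_dist _ _)).
by have -> : u - y - (v - y) = u - v by rewrite opprB addrA subrK.
Qed.

Lemma stage_near_root b k x : stage b k x -> `|x - tree_root| <= 2 * mesh (m0 ^ (2 * J - 1)).
Proof.
move=> [y yP xy]; have [_ q0 _ H] := treeP b k; have := H _ yP.
have h1 : mesh (tfine b k) <= mesh ((tree b k).2 ^ (2 * J - 1)).
  by apply: le_mesh; [rewrite expn_gt0 q0|exact: fineness_ge].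
have h3 : `|x - tree_root| <= `|x - y| + `|y - tree_root| by rewrite -[x - tree_root](subrKA y); exact: ler_normD.
move: (mesh _) (mesh _) (mesh _) h1 h3 xy => A B C; lra.
Qed.

Definition core b : set V := \bigcap_k stage b k.
(** A point of a cloud need not have descendants. Adding the countably many cloud
    points to the limit set makes it depend continuously on the bits, and does not
    change the measures with a Fourier decay that it carries. *)
Definition tree_set b : set V := core b `|` [set x | exists k, x \in (tree b k).1].

Lemma tree_set_near b k x : tree_set b x ->
  exists2 y, (exists2 j, (j <= k)%N & y \in (tree b j).1) & `|x - y| <= 2 * mesh (tfine b k).
Proof.
have m0' : 0 <= 2 * mesh (tfine b k) by rewrite mulr_ge0 // ltW // mesh_gt0 // tfine_gt0.
move=> [/(_ k I)[y yP xy]|[j xj]]; first by exists y => //; exists k.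
have [jk|/ltnW kj] := leqP j k; first by exists x; [exists j|rewrite subrr normr0].
by have [y yP xy] := stage_mono kj (tree_sub_stage xj); exists y => //; exists k.
Qed.

Lemma closed_tree_set b : closed (tree_set b).
Proof.
have -> : tree_set b = \bigcap_k (stage b k `|` [set x | exists2 j, (j < k)%N & x \in (tree b j).1]).
  apply/seteqP; split=> x.
    move=> [xc k _|[j xj] k _]; first by left; exact: xc.
    have [jk|kj] := ltnP j k; first by right; exists j.
    by left; exact: (stage_mono kj (tree_sub_stage xj)).
  move=> H; have [xT|nx] := pselect (exists k, x \in (tree b k).1); first by right.
  by left=> k _; have [//|[j _ xj]] := H k I; exfalso; apply: nx; exists j.
apply: closed_bigI => k _; apply: closedU; first exact: closed_stage.
rewrite (_ : [set x | _] = \bigcup_(j in [set j | (j < k)%N]) [set` (tree b j).1]); last first.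
  by apply/seteqP; split=> x [j jk xj]; exists j.
apply: closed_bigcup => [|j _]; first exact: finite_II.
have /accessible_finite_set_closed H : accessible_space V.
  exact: hausdorff_accessible (@norm_hausdorff _ _).
exact: H (finite_seq _).
Qed.

Lemma tree_set_box b x i : tree_set b x -> 0 <= x ord0 i <= m0%:R^-1.
Proof.
move=> [/(_ 0%N I)/stage_near_root|[k xk]]; first exact: near_root.
by apply: near_root; exact: inv_near_root (treeP b k) _ xk.
Qed.

Lemma eq_tree b b' k : (forall j, (j < k)%N -> b j = b' j) -> tree b k = tree b' k.
Proof.
by elim: k => //= k IH bb'; rewrite IH => [|j jk]; [rewrite bb'|apply: bb'; exact: ltnW].
Qed.

(** The first [k + 1] bits determine the clouds up to stage [k], which are contained in
    the set and approximate it within [2 mesh]. *)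
Lemma tree_set_uniform b b' k : (forall j, (j <= k)%N -> b j = b' j) ->
  forall x, tree_set b x -> exists2 y, tree_set b' y & `|x - y| <= k.+1%:R^-1.
Proof.
move=> bb' x /(tree_set_near k)[y [j jk yj] xy]; exists y.
  by right; exists j; rewrite -(@eq_tree b) // => i ij; apply: bb'; exact: leq_trans (ltnW ij) jk.
apply: (le_trans xy); apply: (@le_trans _ _ (4 * mesh (tfine b k))).
  by have := mesh_gt0 (tfine_gt0 b k); lra.
rewrite /mesh -mulnA natrM invfM mulrA mulfV ?mul1r //.
rewrite lef_pV2 ?posrE ?ltr0n ?muln_gt0 ?d_gt0 ?tfine_gt0 // ler_nat.
rewrite -[X in (X <= _)%N]mul1n leq_mul // (leq_trans _ (tfine_ge b k)) //.
exact: ltn_expl.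
Qed.

Lemma closed_core b : closed (core b).
Proof. by apply: closed_bigI => k _; exact: closed_stage. Qed.

Lemma core_covered b k :
  box_covered (size (tree b k).1) (d * tfine b k)%:R^-1 (core b).
Proof.
pose e := 2 * mesh (tfine b k).
exists [seq (y - const_mx e : V) | y <- (tree b k).1]; first by rewrite size_map.
move=> x /(_ k I)[y yP xy]; apply/hasP; exists (y - const_mx e); first exact: map_f.
apply/forallP => i; have := le_trans (coord_le_norm (x - y) i) xy.
rewrite !mxE -/e (_ : (d * tfine b k)%:R^-1 = 2 * e).
  by rewrite ler_norml => /andP[h1 h2]; apply/andP; split; lra.
rewrite /e /mesh !natrM; field.
by rewrite !pnatr_eq0 -!lt0n d_gt0 tfine_gt0.
Qed.

Lemma tree_set_null (mu : probability BV R) (c s q : R) b : 0 < s < d%:R ->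
  fourier_decay mu c s -> q < s ->
  (forall k0, exists2 k, (k0 <= k)%N & (size (tree b k).1)%:R <= (tfine b k)%:R `^ q) ->
  mu (tree_set b) = 0%E.
Proof.
move=> s0 dec qs hq.
have mT : measurable (tree_set b : set BV) by apply: closed_borel; exact: closed_tree_set.
apply/(negligibleP _ mT); apply: negligibleU; last exact: countable_negligible dec.
have mC : measurable (core b : set BV) by apply: closed_borel; exact: closed_core.
apply/(negligibleP _ mC).
apply: (@fejer_null _ _ mu c s q 1 _ d_gt0 mC s0 dec qs) => N0.
have [k N0k sk] := hq N0; exists (tfine b k), (size (tree b k).1).
split; rewrite ?tfine_gt0 ?mul1r //; last exact: core_covered.
by apply: leq_trans N0k _; apply: leq_trans (tfine_ge b k); rewrite ltnW // ltn_expl.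
Qed.

(** At a raised bit the set is covered by [n] boxes, [n] being the size of the cloud,
    whose side is at most [n^-(k + 1)]. *)
Lemma tree_null_often (mu : probability BV R) (c s : R) (b : nat -> bool) : 0 < s < d%:R ->
  fourier_decay mu c s -> (forall k0, exists2 k, (k0 <= k)%N & b k) ->
  mu (tree_set b) = 0%E.
Proof.
move=> s0 dec io; have /andP[s0' _] := s0; have s2 : 0 < s / 2 by rewrite divr_gt0.
apply: (@tree_set_null mu c s (s / 2)) => //; first by lra.
have [n hn] := small_inv s2.
move=> k0; have [k] := io (maxn k0 n); rewrite geq_max => /andP[k0k nk] bk; exists k => //.
have L1 : 1 <= (tfine b k)%:R :> R by rewrite ler1n tfine_gt0.
apply: (@le_trans _ _ ((tfine b k)%:R `^ k.+1%:R^-1)).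
  have -> : (size (tree b k).1)%:R = ((size (tree b k).1)%:R ^+ k.+1) `^ k.+1%:R^-1 :> R.
    by rewrite -powR_mulrn ?ler0n // -powRrM mulfV ?pnatr_eq0 // powRr1 ?ler0n.
  rewrite ge0_ler_powR ?nnegrE ?invr_ge0 ?ler0n ?exprn_ge0 //.
  by rewrite -natrX ler_nat /tfine /fineness bk leq_maxr.
apply: ler_powR => //; apply: ltW; apply: le_lt_trans hn.
by rewrite lef_pV2 ?posrE ?ltr0n // ler_nat ltnS.
Qed.

(** The quotient of the exponents of [m] in the bound [m^(2 rank + 2)] of the number
    of points and in the minimal fineness [m^(2 J - 1)]. *)
Definition box_exponent : R := d%:R - d%:R / (2 * J - 1)%:R.

Lemma tree_null (mu : probability BV R) (c s : R) b : 0 < s < d%:R ->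
  fourier_decay mu c s -> box_exponent < s -> mu (tree_set b) = 0%E.
Proof.
move=> s0 dec qs; apply: (@tree_set_null mu c s box_exponent) => // k0; exists k0 => //.
have [_ q0 sz _] := treeP b k0; set m := (tree b k0).2 in q0 sz *.
have m1 : 1 <= m%:R :> R by rewrite ler1n.
have J1 : 0 < (2 * J - 1)%:R :> R by rewrite ltr0n; lia.
have q_ge0 : 0 <= box_exponent.
  by rewrite subr_ge0 ler_pdivrMr // -natrM ler_nat leq_pmulr //; lia.
apply: (@le_trans _ _ ((m ^ (2 * J - 1))%:R `^ box_exponent)); last first.
  by rewrite ge0_ler_powR ?nnegrE ?ler0n // ler_nat; exact: fineness_ge.
apply: (@le_trans _ _ (m ^ (2 * rk + 2))%:R); first by rewrite ler_nat.
rewrite !natrX -!powR_mulrn ?ler0n // -powRrM le_eqVlt; apply/orP; left.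
apply/eqP; congr (_ `^ _); rewrite /box_exponent mulrBr mulrCA mulfV ?gt_eqF // mulr1.
rewrite -natrM -natrB; last by rewrite leq_pmull //; lia.
by congr (_%:R); rewrite /rank; nia.
Qed.

End Tree.

(** * Fourier decay on a tree with finitely many raised bits *)

Section TreeMeasure.
Variables (R : realType) (d J m0 : nat).
Hypotheses (d_gt0 : (0 < d)%N) (J_gt2 : (2 < J)%N) (m0_gt0 : (0 < m0)%N).
Local Notation V := 'rV[R]_d.
Local Notation BV := (borel_rV R d).
Local Notation rk := (rank d J).
Local Notation treeR := (@tree R d J m0).
Local Notation bt := (beta R d J).

Definition stage_bound (b : nat -> bool) (k : nat) (B : R) : Prop :=
  forall xi : V, xi != 0 -> `|xi| <= (treeR b k).2%:R ^+ (2 * J) ->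
  `|pcos (treeR b k).1 xi| <= B * weight J xi /\
  `|psin (treeR b k).1 xi| <= B * weight J xi.

Lemma weight_gt0 (xi : V) : 0 < weight J xi.
Proof. by rewrite powR_gt0 // ltr_pwDl. Qed.

Lemma stage_bound_le b k B B' : B <= B' -> stage_bound b k B -> stage_bound b k B'.
Proof.
move=> BB' H xi xi0 xim; have [h1 h2] := H _ xi0 xim.
have h : B * weight J xi <= B' * weight J xi by rewrite ler_wpM2r // ltW // weight_gt0.
by split; [exact: le_trans h1 h|exact: le_trans h2 h].
Qed.

Lemma pcos_le1 (P : seq V) (xi : V) : P != [::] -> `|pcos P xi| <= 1.
Proof. by move=> P0; apply: mean_norm_le => // y _; exact: cos_max. Qed.

Lemma psin_le1 (P : seq V) (xi : V) : P != [::] -> `|psin P xi| <= 1.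
Proof. by move=> P0; apply: mean_norm_le => // y _; exact: sin_max. Qed.

(** If [L = m^(2 J - 1)] and [|xi| > m^(2 J)], then [L / |xi| <= |xi|^(-1 / (2 J))],
    whose power of exponent [rank] is [|xi|^(-beta)]: this is where [beta] comes
    from. For larger [L] the constant deteriorates by a power of the quotient. *)
Lemma damping_le (m L : nat) (xi : V) : (0 < m)%N -> m%:R ^+ (2 * J) < `|xi| ->
  (2 * rk%:R / ((4 * d%:R ^+ 2 * L%:R)^-1 * `|xi|)) ^+ rk <=
  (8 * d%:R ^+ 2 * rk%:R * (L%:R / m%:R ^+ (2 * J - 1))) ^+ rk * 2 `^ bt * weight J xi.
Proof.
move=> m_gt0 mxi; set X := `|xi| in mxi *.
have m1 : 1 <= m%:R :> R by rewrite ler1n.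
have M1 : 1 <= m%:R ^+ (2 * J) :> R by rewrite exprn_ege1.
have X1 : 1 <= X by rewrite ltW // (le_lt_trans M1).
have X0 : 0 < X by rewrite (lt_le_trans _ X1).
have d0 : 0 < d%:R :> R by rewrite ltr0n.
have J0 : 0 < (2 * J)%:R :> R by rewrite ltr0n; lia.
have w : X `^ (- bt) <= 2 `^ bt * weight J xi.
  rewrite /weight -/X.
  have -> : 2 `^ bt * (1 + X) `^ (- bt) = ((1 + X) / 2) `^ (- bt).
    rewrite powRM ?invr_ge0 ?addr_ge0 ?(ltW X0) // mulrC; congr (_ * _).
    by rewrite -powR_inv1 // -powRrM mulN1r opprK.
  rewrite !powRN lef_pV2 ?posrE ?powR_gt0 ?divr_gt0 ?addr_gt0 //.
  rewrite ge0_ler_powR ?nnegrE ?(ltW (beta_gt0 _ d_gt0 J_gt2)) ?divr_ge0 ?addr_ge0 ?(ltW X0) //.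
  by rewrite ler_pdivrMr //; lra.
have mX : m%:R ^+ (2 * J - 1) <= X * X `^ (- (2 * J)%:R^-1).
  have e1 : m%:R ^+ (2 * J - 1) = (m%:R ^+ (2 * J)) `^ ((2 * J - 1)%:R / (2 * J)%:R) :> R.
    by rewrite -!powR_mulrn ?ler0n // -powRrM mulrCA mulfV ?gt_eqF // mulr1.
  have e2 : X * X `^ (- (2 * J)%:R^-1) = X `^ ((2 * J - 1)%:R / (2 * J)%:R).
    rewrite -{1}(powRr1 (ltW X0)) -powRD ?(gt_eqF X0) ?implybT //; congr (_ `^ _).
    rewrite natrB; last lia.
    by rewrite mulrBl mulfV ?gt_eqF // mul1r.
  rewrite e1 e2; apply: ge0_ler_powR; rewrite ?nnegrE ?divr_ge0 ?ler0n ?(ltW X0) ?exprn_ge0 //.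
  exact: ltW.
have key : (m%:R ^+ (2 * J - 1) / X) ^+ rk <= X `^ (- bt).
  apply: (@le_trans _ _ ((X `^ (- (2 * J)%:R^-1)) ^+ rk)).
    by rewrite lerXn2r ?nnegrE ?divr_ge0 ?exprn_ge0 ?ler0n ?powR_ge0 ?(ltW X0) // ler_pdivrMr // mulrC.
  by rewrite -powR_mulrn ?powR_ge0 // -powRrM mulNr mulrC.
have -> : 2 * rk%:R / ((4 * d%:R ^+ 2 * L%:R)^-1 * X) =
    8 * d%:R ^+ 2 * rk%:R * (L%:R / m%:R ^+ (2 * J - 1)) * (m%:R ^+ (2 * J - 1) / X).
  have [->|L0] := eqVneq L 0%N; first by rewrite !(mulr0, mul0r, invr0).
  field; rewrite (gt_eqF X0) gt_eqF ?(exprn_gt0, ltr0n) //= (gt_eqF d0) pnatr_eq0 L0.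
  by [].
by rewrite exprMn -[leRHS]mulrA ler_wpM2l //; exact: le_trans key w.
Qed.

Definition stage_const b k : R :=
  (8 * d%:R ^+ 2 * rk%:R * ((tfine R d J m0 b k)%:R / (treeR b k).2%:R ^+ (2 * J - 1))) ^+ rk * 2 `^ bt.

(** Below the old resolution the old bound persists since the damping factor is at
    most [1]; beyond it the damping factor itself is small enough. *)
Lemma stage_boundS b k B : 0 <= B -> stage_const b k <= B ->
  stage_bound b k B -> stage_bound b k.+1 (B + 2^-1 ^+ k).
Proof.
move=> B0 KB H xi xi0 xim.
have [_ _ _ [_ _ step]] := tree_step R d_gt0 J_gt2 m0_gt0 b k.
have [p [p1 pK] [hc hs]] := step xi xi0 xim.
have [P0 q0 _ _] := treeP R d_gt0 J_gt2 m0_gt0 b k.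
have w0 := weight_gt0 xi.
have damp a : `|a| <= 1 -> (`|xi| <= (treeR b k).2%:R ^+ (2 * J) -> `|a| <= B * weight J xi) ->
    `|a * p| <= B * weight J xi.
  move=> a1 aB; rewrite normrM; have [small|big] := leP `|xi| ((treeR b k).2%:R ^+ (2 * J)).
    by rewrite -[leRHS]mulr1; apply: ler_pM => //; exact: aB.
  rewrite -[leRHS]mul1r; apply: ler_pM => //; apply: (le_trans pK).
  apply: (le_trans (damping_le _ q0 big)).
  by rewrite ler_wpM2r ?(ltW w0) //; exact: KB.
have trans u v : `|u - v| <= 2^-1 ^+ k * weight J xi -> `|v| <= B * weight J xi ->
    `|u| <= (B + 2^-1 ^+ k) * weight J xi.
  move=> h1 h2; rewrite -[u](subrK v) mulrDl addrC [leRHS]addrC.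
  by apply: (le_trans (ler_normD _ _)); rewrite addrC lerD.
split; [apply: trans hc _|apply: trans hs _]; apply: damp.
- exact: pcos_le1.
- by move=> h; have [] := H xi xi0 h.
- exact: psin_le1.
- by move=> h; have [] := H xi xi0 h.
Qed.

Lemma stage_const_ge0 b k : 0 <= stage_const b k.
Proof.
by rewrite /stage_const mulr_ge0 ?powR_ge0 // exprn_ge0 // !mulr_ge0 ?ler0n ?exprn_ge0 ?ler0n.
Qed.

Lemma stage_bound_exists b k : exists2 B, 0 <= B & stage_bound b k B.
Proof.
elim: k => [|k [B B0 HB]].
  exists (2 ^+ d * m0%:R ^+ rk); first by rewrite mulr_ge0 ?exprn_ge0.
  move=> xi xi0 xim.
  have h : 1 <= 2 ^+ d * m0%:R ^+ rk * weight J xi.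
    apply: (@le_trans _ _ (2 ^+ d * m0%:R ^+ rk * (2^-1 ^+ d * m0%:R ^- rk))).
      rewrite mulrACA -exprMn mulfV // expr1n mul1r mulfV // expf_neq0 // pnatr_eq0 -lt0n //.
    rewrite ler_wpM2l ?mulr_ge0 ?exprn_ge0 //; exact: weight_ge.
  by split; apply: le_trans h; [exact: pcos_le1|exact: psin_le1].
set C := B + stage_const b k; have K0 := stage_const_ge0 b k.
exists (C + 2^-1 ^+ k); first by rewrite addr_ge0 ?exprn_ge0 ?invr_ge0 // addr_ge0.
apply: stage_boundS; rewrite ?addr_ge0 ?lerDr //.
by apply: stage_bound_le HB; rewrite lerDl.
Qed.

(** At unraised bits the stage constant does not depend on the stage, and the errors
    [2^(-k)] are summable. *)
Lemma stage_bound_uniform (b : nat -> bool) k0 : (forall k, (k0 <= k)%N -> ~~ b k) ->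
  exists2 B, 0 <= B & forall k, (k0 <= k)%N -> stage_bound b k B.
Proof.
move=> bk; have [B0 B00 HB0] := stage_bound_exists b k0.
pose K : R := (8 * d%:R ^+ 2 * rk%:R) ^+ rk * 2 `^ bt.
have K0 : 0 <= K by rewrite mulr_ge0 ?powR_ge0 // exprn_ge0 // !mulr_ge0 ?ler0n.
have h n : stage_bound b (k0 + n) (B0 + K + 2 - 2 * 2^-1 ^+ n).
  elim: n => [|n IH].
    by rewrite addn0 expr0; apply: stage_bound_le HB0; lra.
  have e0 : 0 <= 2^-1 ^+ n :> R by rewrite exprn_ge0.
  have e1 : 2^-1 ^+ n <= 1 :> R by rewrite exprn_ile1 // invf_le1 // ler1n.
  rewrite addnS; apply: (@stage_bound_le _ _ (B0 + K + 2 - 2 * 2^-1 ^+ n + 2^-1 ^+ (k0 + n))).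
    have : 2^-1 ^+ (k0 + n) <= 2^-1 ^+ n :> R.
      by rewrite exprD ler_piMl // exprn_ile1 // invf_le1 // ler1n.
    by rewrite exprS; lra.
  apply: stage_boundS => //; first by lra.
  have -> : stage_const b (k0 + n) = K.
    have [_ q0 _ _] := treeP R d_gt0 J_gt2 m0_gt0 b (k0 + n).
    rewrite /stage_const /tfine /fineness (negbTE (bk _ (leq_addr _ _))) natrX.
    by rewrite mulfV ?mulr1 // expf_neq0 // pnatr_eq0 -lt0n.
  by lra.
exists (B0 + K + 2); first by lra.
move=> k /subnKC <-; apply: stage_bound_le (h _).
by rewrite lerBlDr lerDl mulr_ge0 // exprn_ge0.
Qed.

Lemma weight_enorm (xi : V) : xi != 0 ->
  weight J xi <= d%:R `^ bt * enorm xi `^ (- (2 * bt) / 2).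
Proof.
move=> xi0; have x0 : 0 < `|xi| by rewrite normr_gt0.
have d0 : 0 < d%:R :> R by rewrite ltr0n.
have b0 := beta_gt0 R d_gt0 J_gt2.
have e := enorm_le d_gt0 xi.
have e0 : 0 < enorm xi.
  have [i /eqP xi0'] : exists i, xi ord0 i != 0.
    apply: contrapT => /forallNP h; move/eqP: xi0; apply; apply/rowP => i; rewrite mxE.
    by apply/eqP; apply: contrapT => /negP; exact: h.
  apply: lt_le_trans (enorm_ge_coord xi i); rewrite normr_gt0; exact/eqP.
rewrite (_ : - (2 * bt) / 2 = - bt); last by field.
apply: (@le_trans _ _ (`|xi| `^ (- bt))).
  rewrite /weight !powRN lef_pV2 ?posrE ?powR_gt0 ?ltr_pwDl //.
  by rewrite ge0_ler_powR ?nnegrE ?(ltW b0) ?addr_ge0 // lerDr.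
rewrite !powRN ler_pdivlMr ?powR_gt0 // ler_pdivrMl ?powR_gt0 // mulrC -powRM ?(ltW d0) //.
by rewrite ge0_ler_powR ?nnegrE ?(ltW b0) ?(ltW e0) ?mulr_ge0 ?(ltW d0).
Qed.

(** With finitely many raised bits, a weak limit of the uniform measures on the
    clouds lives on the core and has the decay of the weight. *)
Lemma tree_measure (b : nat -> bool) k0 : (forall k, (k0 <= k)%N -> ~~ b k) ->
  exists (mu : probability BV R) (c : R),
    msupport mu `<=` @tree_set R d J m0 b /\ fourier_decay mu c (2 * bt).
Proof.
move=> bk; have [B B0 HB] := stage_bound_uniform bk.
have tP k := treeP R d_gt0 J_gt2 m0_gt0 b k.
have nuP k : exists nu : probability BV R,
    (forall h : BV -> R, bounded_mfun h -> \int[nu]_x h x = mean (treeR b k).1 h) /\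
    (forall A : set BV, measurable A -> (forall x, x \in (treeR b k).1 -> A x) -> nu A = 1%E).
  by apply: uniform_cloud; have [] := tP k.
have [nu hnu] := choice nuP.
have [U [UU oU]] := @ultraFilterLemma nat \oo _.
have nu_cube k : nu k (unit_cube R d) = 1%E.
  apply: (hnu k).2; first exact: measurable_cube.
  move=> x xP i; have /andP[h1 h2] :=
    near_root d_gt0 J_gt2 m0_gt0 i (inv_near_root d_gt0 (tP k) xP).
  by rewrite h1 (le_trans h2) // invf_le1 ?ltr0n // ler1n.
have [mu lim] := weak_limit d_gt0 UU nu_cube.
have ev N (D : set nat) : (forall k, (N <= k)%N -> D k) -> U D.
  by move=> ND; apply: oU; exists N.
exists mu, (2 * (B * d%:R `^ bt) + 1); split.
  move=> y ys; left => k _; apply: contrapT => ny.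
  have oS : open (~` @stage R d J m0 b k) by apply: closed_openC; exact: closed_stage.
  have /nbhs_ballP[r /= r0 rS] : nbhs y (~` @stage R d J m0 b k) by exact: open_nbhs_nbhs.
  apply: (limit_support UU lim r0 _ ys); apply: (ev k) => j kj /=.
  have mb : measurable (ball y r : set BV) by apply: open_borel; exact: ball_open.
  have h1 : nu j (~` ball y r) = 1%E.
    apply: (hnu j).2; first exact: measurableC.
    move=> x xP xr; apply: (rS _ xr); apply: (stage_mono d_gt0 J_gt2 m0_gt0 kj).
    exact: tree_sub_stage.
  by rewrite -[ball y r]setCK probability_setC ?h1 ?subee //; exact: measurableC.
have d0 : 0 < d%:R :> R by rewrite ltr0n.
split; first by rewrite ltr_wpDl // !mulr_ge0 ?powR_ge0.
move=> xi xi0.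
have [N hN] : exists N, forall k, (N <= k)%N -> `|xi| <= (treeR b k).2%:R ^+ (2 * J).
  exists (Num.truncn `|xi|).+1 => k Nk; have [_ q0 _ _] := tP k.
  apply: (@le_trans _ _ (treeR b k).2%:R).
    apply: ltW; apply: (lt_le_trans (truncnS_gt _)); rewrite ler_nat (leq_trans Nk) //.
    by apply: leq_trans (tree_size_ge R d_gt0 J_gt2 m0_gt0 b k); rewrite ltnW // ltn_expl.
  by rewrite -[leLHS]expr1 ler_weXn2l ?ler1n //; lia.
have cE k : cosint (nu k) xi = pcos (treeR b k).1 xi.
  by rewrite /cosint (hnu k).1 //; exact: cos_dotp_bounded.
have sE k : sinint (nu k) xi = psin (treeR b k).1 xi.
  by rewrite /sinint (hnu k).1 //; exact: sin_dotp_bounded.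
have hc : `|cosint mu xi| <= B * weight J xi.
  have lc := @limit_cosint _ _ _ _ _ _ lim xi; apply: (limit_le UU lc); apply: (ev (maxn k0 N)) => k.
  rewrite geq_max => /andP[k0k Nk]; rewrite /= cE.
  by have [] := HB k k0k xi xi0 (hN k Nk).
have hs : `|sinint mu xi| <= B * weight J xi.
  have lc := @limit_sinint _ _ _ _ _ _ lim xi; apply: (limit_le UU lc); apply: (ev (maxn k0 N)) => k.
  rewrite geq_max => /andP[k0k Nk]; rewrite /= sE.
  by have [] := HB k k0k xi xi0 (hN k Nk).
apply: (le_trans (normc_fourier_le hc hs)).
set E := enorm xi `^ _; apply: (@le_trans _ _ (2 * (B * d%:R `^ bt) * E)).
  by rewrite -!mulrA ler_pM2l // ler_wpM2l //; exact: weight_enorm.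
by rewrite ler_wpM2r ?powR_ge0 // lerDl.
Qed.

End TreeMeasure.

(** * Hausdorff content *)

Section EuclideanNorm.
Variables (R : realType) (d : nat).
Local Notation V := 'rV[R]_d.

Lemma dotp_ge0 (x : V) : 0 <= dotp x x.
Proof. by apply: sumr_ge0 => i _; rewrite -expr2 sqr_ge0. Qed.

Lemma cauchy_schwarz (x y : V) : dotp x y <= enorm x * enorm y.
Proof.
rewrite /enorm -sqrtrM ?dotp_ge0 //.
have h : dotp x y ^+ 2 <= dotp x x * dotp y y.
  have q (a b : R) : 0 <= a ^+ 2 * dotp x x + 2 * a * b * dotp x y + b ^+ 2 * dotp y y.
    have := dotp_ge0 (a *: x + b *: y); rewrite !dotpDl !dotpDr !dotpZr.
    rewrite !(dotpC _ x) !(dotpC _ y) !dotpZr (dotpC y x).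
    by move/le_trans; apply; rewrite le_eqVlt; apply/orP; left; apply/eqP; ring.
  have y0 := dotp_ge0 y; have x0 := dotp_ge0 x.
  have := q (dotp y y) (- dotp x y); have := q (- dotp x y) (dotp x x).
  move: x0 y0 q; move: (dotp x x) (dotp y y) (dotp x y) => a b c a0 b0 q q1 q2.
  have [a1|a1] := ltP 0 a; first by nra.
  have [b1|b1] := ltP 0 b; first by nra.
  have := q 1 (- c); have -> : a = 0 by lra.
  have -> : b = 0 by lra.
  nra.
apply: (le_trans (ler_norm _)); rewrite -sqrtr_sqr ler_wsqrtr //.
Qed.

Lemma enorm_triangle (x y : V) : enorm (x + y) <= enorm x + enorm y.
Proof.
have x0 : 0 <= enorm x by exact: sqrtr_ge0.
have y0 : 0 <= enorm y by exact: sqrtr_ge0.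
rewrite -[leRHS]ger0_norm ?addr_ge0 // -sqrtr_sqr ler_wsqrtr // sqrrD.
rewrite !sqr_sqrtr ?dotp_ge0 // !dotpDl !dotpDr (dotpC y x).
have := cauchy_schwarz x y; move: (dotp _ _) (dotp _ _) (dotp _ _) (_ * _) => a b c e; lra.
Qed.

Lemma enormN (x : V) : enorm (- x) = enorm x.
Proof. by rewrite /enorm dotpNr dotpC dotpNr opprK. Qed.

End EuclideanNorm.

Section Content.
Variables (R : realType) (d : nat).
Hypothesis d_gt0 : (0 < d)%N.
Local Notation V := 'rV[R]_d.
Implicit Types (s t e p eta : R) (U A : set V).

Lemma nneseries_term (u : nat -> \bar R) i : (forall n, 0 <= u n)%E ->
  (u i <= \sum_(0 <= n <oo) u n)%E.
Proof.
move=> u0; apply: (@le_trans _ _ (\sum_(0 <= n < i.+1) u n)%E); last first.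
  by apply: nneseries_lim_ge => n _ _.
by rewrite big_nat_recr //= leeDr // sume_ge0.
Qed.

Lemma nneseries_le (u : nat -> \bar R) (M : \bar R) : (forall n, 0 <= u n)%E ->
  (forall n, \sum_(0 <= i < n) u i <= M)%E -> (\sum_(0 <= n <oo) u n <= M)%E.
Proof.
move=> u0 H; apply: lime_le; first exact: is_cvg_nneseries.
by apply: nearW => n; exact: H.
Qed.

Lemma diam_ge U x y : U x -> U y -> ((enorm (x - y))%:E <= diam U)%E.
Proof. by move=> Ux Uy; apply: ereal_sup_ubound; exists (x, y). Qed.

Lemma diam_le U t : (forall x y, U x -> U y -> enorm (x - y) <= t) -> (diam U <= t%:E)%E.
Proof. by move=> H; apply: ge_ereal_sup => _ [[x y] /= [Ux Uy] <-]; rewrite lee_fin; exact: H. Qed.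

Lemma diam_pow_ge0 s U : (0 <= diam_pow s U)%E.
Proof. by rewrite /diam_pow; case: ifP => // _; exact: poweR_ge0. Qed.

Lemma diam_ge0 U : U !=set0 -> (0 <= diam U)%E.
Proof.
by move=> [x Ux]; apply: le_trans (diam_ge Ux Ux); rewrite lee_fin; exact: sqrtr_ge0.
Qed.

Lemma diam_pow_le s U t : 0 <= s -> (forall x y, U x -> U y -> enorm (x - y) <= t) ->
  (diam_pow s U <= (t `^ s)%:E)%E.
Proof.
move=> s0 H; rewrite /diam_pow; case: eqVneq => [_|/set0P U0]; first by rewrite lee_fin powR_ge0.
move: (diam_ge0 U0) (diam_le H); case: (diam U) => [r||] //.
rewrite !lee_fin => r0 rt.
by apply: ge0_ler_powR; rewrite ?nnegrE // (le_trans r0).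
Qed.

Lemma diam_pow_ge s U t : 0 <= s -> 0 <= t -> (t%:E < diam U)%E -> ((t `^ s)%:E <= diam_pow s U)%E.
Proof.
move=> s0 t0 tU; rewrite /diam_pow; case: eqVneq => [U0|_].
  by move: tU; rewrite U0 /diam setX0 image_set0 ereal_sup0.
case: (diam U) tU => [r||] //.
  rewrite lte_fin => tr; rewrite poweR_EFin lee_fin.
  by apply: ge0_ler_powR; rewrite ?nnegrE ?(ltW tr) // (le_trans t0 (ltW tr)).
move=> _; rewrite poweRE /=; case: eqP => [->|_]; last by rewrite leey.
by rewrite powRr0.
Qed.

Lemma diam_pow_fin s U : 0 < s -> (diam_pow s U < +oo)%E -> U !=set0 ->
  exists r, [/\ 0 <= r, diam_pow s U = (r `^ s)%:E &
    forall x y, U x -> U y -> enorm (x - y) <= r].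
Proof.
move=> s0; rewrite /diam_pow; case: eqVneq => [->|_]; first by move=> _ /set0P; rewrite eqxx.
move=> + U0; have := diam_ge0 U0; have H x y := @diam_ge U x y.
case: (diam U) H => [r||] // H; last by rewrite poweRyr ?gt_eqF.
rewrite lee_fin => r0 _; exists r; split=> // x y Ux Uy; by have := H x y Ux Uy.
Qed.

(** All covers of [A] have [s]-dimensional weight at least [e]; covers by large
    sets are allowed, which makes the condition stable under limits of sets. *)
Definition content_ge s e A : Prop := forall U : nat -> set V,
  A `<=` \bigcup_i U i -> (e%:E <= \sum_(0 <= i <oo) diam_pow s (U i))%E.

Lemma content_ge_sub s e A B : A `<=` B -> content_ge s e A -> content_ge s e B.
Proof. by move=> AB H U BU; apply: H; exact: subset_trans BU. Qed.

Lemma content_hausdorff s e A : 0 < e -> content_ge s e A -> (0 < hausdorff_measure s A)%E.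
Proof.
move=> e0 H; apply: (@lt_le_trans _ _ (hausdorff_premeasure s 1 A)); last first.
  by apply: ereal_sup_ubound; exists 1 => //; exact: ltr01.
apply: (@lt_le_trans _ _ e%:E) => //.
by apply: le_ereal_inf_tmp => _ [U [AU _] <-]; exact: H.
Qed.

(** A cover containing a set of diameter larger than [delta] already has weight at
    least [delta^s]. *)
Lemma hausdorff_content s A : 0 < s -> (0 < hausdorff_measure s A)%E ->
  exists2 e : R, 0 < e & content_ge s e A.
Proof.
move=> s0 /ereal_sup_gt[_ [delta /= delta0 <-] H].
have [e0 e00 he0] : exists2 e0 : R, 0 < e0 & (e0%:E <= hausdorff_premeasure s delta A)%E.
  move: H; case: (hausdorff_premeasure s delta A) => [r||] //; first by exists r.
  by move=> _; exists 1 => //; rewrite leey.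
exists (Num.min e0 (delta `^ s)); first by rewrite lt_min e00 powR_gt0.
move=> U AU; have [small|] := pselect (forall i, (diam (U i) <= delta%:E)%E).
  apply: (@le_trans _ _ e0%:E); first by rewrite lee_fin ge_min lexx.
  by apply: (le_trans he0); apply: ereal_inf_lbound; exists U.
move=> /existsNP[i /negP]; rewrite -ltNge => big.
apply: (@le_trans _ _ (delta `^ s)%:E); first by rewrite lee_fin ge_min lexx orbT.
apply: le_trans (nneseries_term i (fun n => diam_pow_ge0 s (U n))).
by apply: diam_pow_ge => //; exact: ltW.
Qed.

Lemma content_ge_weaken s s' e e' A : 0 < s' <= s -> e' <= e -> e' <= 1 -> content_ge s e A ->
  content_ge s' e' A.
Proof.
move=> /andP[s'0 s's] e'e e'1 H U AU.
have [small|] := pselect (forall i, (diam (U i) <= 1%:E)%E); last first.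
  move=> /existsNP[i /negP]; rewrite -ltNge => big.
  apply: (@le_trans _ _ (1 `^ s')%:E); first by rewrite lee_fin powR1.
  apply: le_trans (nneseries_term i (fun n => diam_pow_ge0 s' (U n))).
  by apply: diam_pow_ge => //; exact: ltW.
apply: (@le_trans _ _ e%:E); first by rewrite lee_fin.
apply: (le_trans (H U AU)); apply: lee_nneseries => [i _ _|i _]; first exact: diam_pow_ge0.
rewrite /diam_pow; case: eqVneq => // /set0P U0.
have := diam_ge0 U0; have := small i; case: (diam _) => [r||] //.
rewrite !lee_fin => r1; rewrite le_eqVlt => /predU1P[<-|r0].
  by rewrite !powR0 ?gt_eqF // (lt_le_trans s'0).
by apply: ger_powR => //; rewrite r0.
Qed.

(** Grids of cubes show that the unit cube has dimension at most [d]. *)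
Lemma hausdorff_measure_large s A : A `<=` unit_cube R d -> d%:R < s ->
  hausdorff_measure s A = 0%E.
Proof.
move=> Acube ds; have s0 : 0 < s by exact: le_lt_trans ds.
have d0 : 0 < d%:R :> R by rewrite ltr0n.
suff H delta : 0 < delta -> hausdorff_premeasure s delta A = 0%E.
  apply/eqP; rewrite eq_le; apply/andP; split.
    by apply: ge_ereal_sup => _ [delta /= /H -> <-].
  rewrite -(H 1 ltr01); by apply: ereal_sup_ubound; exists 1 => //; exact: ltr01.
move=> delta0; apply/eqP; rewrite eq_le; apply/andP; split; last first.
  by apply: le_ereal_inf_tmp => _ [U _ <-]; apply: nneseries_ge0 => i _ _; exact: diam_pow_ge0.
apply/lee_addgt0Pr => eta eta0; rewrite add0e.
pose K := d%:R `^ s; have K0 : 0 < K by rewrite powR_gt0.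
have sd : 0 < s - d%:R by rewrite subr_gt0.
have [n n1 n2] : exists2 n, d%:R / n.+1%:R <= delta & K * n.+1%:R `^ (d%:R - s) <= eta.
  have [n1 hn1] := small_inv (divr_gt0 delta0 d0).
  have [n2 hn2] : exists n2, n2.+1%:R^-1 < (eta / K) `^ (s - d%:R)^-1.
    by apply: small_inv; rewrite powR_gt0 // divr_gt0.
  have le_n m : (m <= maxn n1 n2)%N -> (maxn n1 n2).+1%:R^-1 <= m.+1%:R^-1 :> R.
    by move=> mn; rewrite lef_pV2 ?posrE ?ltr0n // ler_nat ltnS.
  exists (maxn n1 n2).
    rewrite mulrC -ler_pdivlMr // (le_trans (le_n n1 _)) ?leq_maxl //; exact: ltW.
  rewrite mulrC -ler_pdivlMr //.
  have -> : (maxn n1 n2).+1%:R `^ (d%:R - s) = (maxn n1 n2).+1%:R^-1 `^ (s - d%:R) :> R.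
    by rewrite -powR_inv1 ?ler0n // -powRrM mulN1r opprB.
  apply: (@le_trans _ _ (((eta / K) `^ (s - d%:R)^-1) `^ (s - d%:R))).
    apply: ge0_ler_powR; rewrite ?nnegrE ?powR_ge0 ?invr_ge0 ?ler0n ?(ltW sd) //.
    by apply: ltW; apply: le_lt_trans hn2; apply: le_n; exact: leq_maxr.
  by rewrite -powRrM mulVf ?gt_eqF // powRr1 // divr_ge0 // ltW.
set N := n.+1 in n1 n2; have N0 : 0 < N%:R :> R by rewrite ltr0n.
pose cube (k : {ffun 'I_d -> 'I_N}) : set V :=
  [set x | forall i, (k i)%:R / N%:R <= x ord0 i <= (k i)%:R / N%:R + N%:R^-1].
pose U (j : nat) : set V := nth set0 [seq cube k | k : {ffun 'I_d -> 'I_N}] j.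
have sz : size [seq cube k | k : {ffun 'I_d -> 'I_N}] = (N ^ d)%N.
  by rewrite size_map -cardT card_ffun !card_ord.
have cubeU : A `<=` \bigcup_i U i.
  move=> x /Acube xc.
  have kP i : exists k : 'I_N, k%:R / N%:R <= x ord0 i <= k%:R / N%:R + N%:R^-1.
    have /andP[x0 x1] := xc i.
    have [xN|xN] := ltP (x ord0 i) 1.
      have tN : (Num.truncn (x ord0 i * N%:R) < N)%N.
        rewrite truncn_lt_nat; last by rewrite mulr_ge0 // ltW.
        by rewrite -[ltRHS]mul1r ltr_pM2r.
      exists (Ordinal tN); rewrite /= ler_pdivrMr // -[X in _ + X]mul1r -mulrDl ler_pdivlMr //.
      by rewrite truncn_le ?mulr_ge0 ?(ltW N0) //= ltW // natr1 truncnS_gt.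
    exists ord_max; rewrite /= -[X in _ + X]mul1r -mulrDl natr1 mulfV ?gt_eqF // x1 andbT.
    by rewrite (le_trans _ xN) // ler_pdivrMr // mul1r ler_nat.
  pose k := [ffun i => projT1 (cid (kP i))].
  have kx : cube k x by move=> i; rewrite /k ffunE; exact: projT2 (cid (kP i)).
  exists (index k (enum {: {ffun 'I_d -> 'I_N}})) => //.
  rewrite /U (nth_map k); last by rewrite index_mem mem_enum.
  by rewrite nth_index // mem_enum.
have Ud j : forall x y, U j x -> U j y -> enorm (x - y) <= d%:R / N%:R.
  have [jN|jN] := ltnP j (N ^ d); last by rewrite /U nth_default ?sz.
  move=> x y; rewrite /U; have [k ->] : exists k, nth set0 [seq cube k | k : {ffun 'I_d -> 'I_N}] j = cube k.
    have /mapP[k _ ->] := @mem_nth _ set0 [seq cube k | k : {ffun 'I_d -> 'I_N}] j ltac:(by rewrite sz).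
    by exists k.
  move=> xk yk; apply: (le_trans (enorm_le d_gt0 _)); rewrite ler_pM2l //.
  apply: norm_le_coord => [|i]; first by rewrite invr_ge0 ltW.
  rewrite !mxE; have /andP[a b] := xk i; have /andP[a' b'] := yk i.
  by rewrite ler_norml; apply/andP; split; lra.
apply: (@le_trans _ _ (\sum_(0 <= j <oo) diam_pow s (U j))%E).
  apply: ereal_inf_lbound; exists U => //; split=> // j.
  by apply: le_trans (diam_le (@Ud j)) _; rewrite lee_fin.
apply: nneseries_le => [j|m]; first exact: diam_pow_ge0.
apply: (@le_trans _ _ (\sum_(0 <= j < N ^ d) ((d%:R / N%:R) `^ s)%:E)%E).
  have e0 : (0 <= ((d%:R / N%:R) `^ s)%:E)%E by rewrite lee_fin powR_ge0.
  have [mN|mN] := leqP m (N ^ d).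
    rewrite [leRHS](@big_cat_nat _ _ _ m) //= -[leLHS]adde0 leeD //; last exact: sume_ge0.
    by apply: lee_sum => j _; apply: diam_pow_le; [exact: ltW|exact: Ud].
  rewrite (@big_cat_nat _ _ _ (N ^ d)) ?(ltnW mN) //= [X in (_ + X)%E]big_nat_cond.
  rewrite [X in (_ + X)%E]big1 ?adde0.
    by apply: lee_sum => j _; apply: diam_pow_le; [exact: ltW|exact: Ud].
  by move=> j /andP[/andP[Nj _] _]; rewrite /U nth_default ?sz // /diam_pow eqxx.
rewrite sumEFin lee_fin sumr_const_nat subn0 -[leLHS]mulr_natl natrX.
rewrite powRM ?invr_ge0 ?ler0n // -/K -powR_inv1 ?ler0n // -powRrM mulN1r mulrCA.
by rewrite -powR_mulrn ?ler0n // -powRD ?(gt_eqF N0) ?implybT.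
Qed.

Lemma hausdorff_dim_bounded A : A `<=` unit_cube R d ->
  ubound [set s : R | 0 <= s /\ (0 < hausdorff_measure s A)%E] d%:R.
Proof.
move=> Acube s [s0 H]; rewrite leNgt; apply/negP => ds.
by move: H; rewrite hausdorff_measure_large // ltxx.
Qed.

(** Letting the exponent and the content vary together leaves one integer parameter. *)
Lemma hausdorff_dim_gtP A (p : R) : A `<=` unit_cube R d -> 0 <= p ->
  p < hausdorff_dim A <-> exists n, content_ge (p + n.+1%:R^-1) n.+1%:R^-1 A.
Proof.
move=> Acube p0; have ub := hausdorff_dim_bounded Acube; split=> [pA|[n H]].
  have S0 : [set s : R | 0 <= s /\ (0 < hausdorff_measure s A)%E] !=set0.
    apply/set0P/eqP => S0; move: pA; rewrite /hausdorff_dim S0 sup0 => /lt_le_trans/(_ p0).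
    by rewrite ltxx.
  have [s [s0 Hs] ps] := sup_gt S0 pA.
  have [e e0 He] := hausdorff_content (le_lt_trans p0 ps) Hs.
  have [n hn] : exists n, n.+1%:R^-1 < Num.min e (s - p).
    by apply: small_inv; rewrite lt_min e0 subr_gt0.
  move: hn; rewrite lt_min => /andP[n1 n2]; exists n.
  have i0 : 0 < n.+1%:R^-1 :> R by rewrite invr_gt0 ltr0n.
  apply: content_ge_weaken He; rewrite ?(ltW n1) ?invf_le1 ?ltr0n ?ler1n //.
  by rewrite ltr_wpDl //= addrC -lerBrDr ltW.
have i0 : 0 < n.+1%:R^-1 :> R by rewrite invr_gt0 ltr0n.
apply: (@lt_le_trans _ _ (p + n.+1%:R^-1)); first by rewrite ltrDl.
apply: ub_le_sup; first by exists d%:R.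
by split; [rewrite addr_ge0 // ltW|exact: content_hausdorff H].
Qed.

Lemma hausdorff_dim_ge0 A : A `<=` unit_cube R d -> 0 <= hausdorff_dim A.
Proof.
move=> Acube; have ub := hausdorff_dim_bounded Acube; rewrite leNgt; apply/negP => H.
have [S0|/set0P[s Ss]] := eqVneq [set s : R | 0 <= s /\ (0 < hausdorff_measure s A)%E] set0.
  by move: H; rewrite /hausdorff_dim S0 sup0 ltxx.
have : s <= hausdorff_dim A by apply: ub_le_sup => //; exists d%:R.
by have [s0 _] := Ss; move=> h; move: (le_lt_trans (le_trans s0 h) H); rewrite ltxx.
Qed.

Lemma hausdorff_dim_full A : A `<=` unit_cube R d ->
  (forall s, 0 < s < d%:R -> exists2 e : R, 0 < e & content_ge s e A) -> hausdorff_dim A = d%:R.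
Proof.
move=> Acube H; have ub := hausdorff_dim_bounded Acube.
have low s : 0 < s < d%:R -> s <= hausdorff_dim A.
  move=> s0; have [e e0 He] := H s s0; apply: ub_le_sup; first by exists d%:R.
  by split; [case/andP: s0 => /ltW|exact: content_hausdorff He].
apply/eqP; rewrite eq_le; apply/andP; split.
  have d0 : 0 < d%:R :> R by rewrite ltr0n.
  have d2 : 0 < (d%:R / 2 : R) < d%:R by apply/andP; split; lra.
  apply: ge_sup => //; have [e e0 He] := H _ d2; exists (d%:R / 2).
  by split; [case/andP: d2 => /ltW|exact: content_hausdorff He].
rewrite leNgt; apply/negP => h; have h0 := hausdorff_dim_ge0 Acube.
have := low ((hausdorff_dim A + d%:R) / 2); move: h h0; move: (hausdorff_dim A) (d%:R) => a b h h0.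
by move=> /(_ ltac:(lra)); lra.
Qed.

(** The power [s] being continuous, [U] has a neighbourhood whose diameter [t] satisfies
    [t^s = (diam U)^s + eta]; here [t > 0] even if [U] is empty or a point. *)
Lemma enlarge s U eta : 0 < s -> 0 < eta -> (diam_pow s U < +oo)%E ->
  exists (W : set V) (t : R), [/\ open W, U `<=` W, 0 < t,
    forall x y, W x -> W y -> enorm (x - y) <= t & ((t `^ s)%:E <= diam_pow s U + eta%:E)%E].
Proof.
move=> s0 eta0 fin; have d0 : 0 < d%:R :> R by rewrite ltr0n.
have [U0|/set0P U0] := eqVneq U set0.
  exists set0, (eta `^ s^-1); rewrite U0; split; [exact: open0|by []|by rewrite powR_gt0|by []|].
  by rewrite -powRrM mulVf ?gt_eqF // powRr1 ?(ltW eta0) // leeDr // diam_pow_ge0.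
have [r [r0 -> Ur]] := diam_pow_fin s0 fin U0.
have rs := powR_ge0 r s.
pose t := (r `^ s + eta) `^ s^-1.
have ts : t `^ s = r `^ s + eta by rewrite -powRrM mulVf ?gt_eqF // powRr1 // addr_ge0 // ltW.
have t0 : 0 < t by rewrite powR_gt0 // ltr_wpDl.
have rt : r < t.
  rewrite ltNge; apply/negP => tr.
  have : t `^ s <= r `^ s by apply: ge0_ler_powR; rewrite ?nnegrE ?(ltW s0) ?(ltW t0).
  by rewrite ts; lra.
pose h := (t - r) / (2 * d%:R); have h0 : 0 < h by rewrite divr_gt0 ?subr_gt0 ?mulr_gt0.
exists (\bigcup_(y in U) ball y h), t; split => //.
- by apply: bigcup_open => y _; exact: ball_open.
- by move=> x Ux; exists x => //; exact: ballxx.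
- move=> x y [x' Ux' xx'] [y' Uy' yy'].
  have E (z z' : V) : ball z h z' -> enorm (z - z') <= (t - r) / 2.
    rewrite -ball_normE /ball_ /= => /ltW zz'; apply: (le_trans (enorm_le d_gt0 _)).
    apply: (@le_trans _ _ (d%:R * h)); first by rewrite ler_pM2l.
    by rewrite le_eqVlt; apply/orP; left; apply/eqP; rewrite /h; field; rewrite gt_eqF.
  have := E _ _ xx'; have := E _ _ yy'; have := Ur _ _ Ux' Uy'.
  have -> : x - y = - (x' - x) + ((x' - y') + (y' - y)).
    by rewrite opprB [x' - y' + _]addrA subrK addrA subrK.
  have := enorm_triangle (- (x' - x)) ((x' - y') + (y' - y)).
  have := enorm_triangle (x' - y') (y' - y); rewrite enormN.
  move: (enorm _) (enorm _) (enorm _) (enorm _) (enorm _) => *; lra.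
- by rewrite ts EFinD.
Qed.

Lemma enlarge_cover s (U : nat -> set V) eta : 0 < s -> 0 < eta ->
  (\sum_(0 <= i <oo) diam_pow s (U i) < +oo)%E ->
  exists (W : nat -> set V) (t : nat -> R),
    [/\ forall i, open (W i), forall i, U i `<=` W i, forall i, 0 < t i,
     forall i x y, W i x -> W i y -> enorm (x - y) <= t i &
     (\sum_(0 <= i <oo) (t i `^ s)%:E <= \sum_(0 <= i <oo) diam_pow s (U i) + eta%:E)%E].
Proof.
move=> s0 eta0 fin.
have WP i : exists Wt : set V * R, [/\ open Wt.1, U i `<=` Wt.1, 0 < Wt.2,
    forall x y, Wt.1 x -> Wt.1 y -> enorm (x - y) <= Wt.2 &
    ((Wt.2 `^ s)%:E <= diam_pow s (U i) + (eta / (2 ^ i.+1)%:R)%:E)%E].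
  have e0 : 0 < eta / (2 ^ i.+1)%:R by rewrite divr_gt0 // ltr0n expn_gt0.
  have fi : (diam_pow s (U i) < +oo)%E.
    by apply: le_lt_trans fin; apply: nneseries_term => n; exact: diam_pow_ge0.
  have [W [t H]] := enlarge s0 e0 fi.
  by exists (W, t).
have [Wt H] := choice WP; exists (fun i => (Wt i).1), (fun i => (Wt i).2).
split=> [i|i|i|i|]; try by have [] := H i.
apply: le_trans (epsilon_trick xpredT (fun i => diam_pow_ge0 s (U i)) (ltW eta0)).
apply: lee_nneseries => i _; first by rewrite lee_fin powR_ge0.
by have [] := H i.
Qed.

End Content.

(** * A compact set of full dimension with prescribed binary digits *)

Section Digits.

(** The binary digits in these positions, counted from 0, are prescribed to vanish. *)
Definition is_gap (p : nat) : bool := [exists k : 'I_p.+1, p == (k.+1 ^ 2)%N].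

Fixpoint gaps (n : nat) : nat := if n is n'.+1 then (gaps n' + is_gap n')%N else 0%N.

(** The numbers with [n] binary digits, the prescribed ones being zero. *)
Fixpoint digit_seq (n : nat) : seq nat :=
  if n is n'.+1 then
    if is_gap n' then [seq j.*2 | j <- digit_seq n']
    else [seq j.*2 | j <- digit_seq n'] ++ [seq j.*2.+1 | j <- digit_seq n']
  else [:: 0%N].

Lemma gaps_sq n : (gaps n ^ 2 <= n)%N.
Proof.
suff : (gaps n == 0%N) || (gaps n ^ 2 < n)%N by move=> /orP[/eqP ->|/ltnW].
elim: n => [|n IH] //=; case: (boolP (is_gap n)) => [/existsP[k /eqP nk]|_]; last first.
  by rewrite addn0; case/orP: IH => [->//|h]; rewrite ltnS (ltnW h) orbT.
rewrite addn1 /= ltnS {2}nk leq_sqr ltnS.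
by case/orP: IH => [/eqP -> //|]; rewrite {2}nk ltn_sqr ltnS.
Qed.

Lemma gaps_le n : (gaps n <= n)%N.
Proof. by elim: n => //= n IH; case: (is_gap n); rewrite ?addn1 ?addn0 // ltnW. Qed.

Lemma size_digit_seq n : (size (digit_seq n) * 2 ^ gaps n = 2 ^ n)%N.
Proof.
elim: n => [|n IH] //=; case: (is_gap n).
  by rewrite size_map addn1 expnS mulnCA IH -expnS.
by rewrite size_cat !size_map addn0 mulnDl IH addnn -mul2n -expnS.
Qed.

Lemma digit_seq_gt0 n : (0 < size (digit_seq n))%N.
Proof. by have := size_digit_seq n; case: (size _) => //; rewrite mul0n => /esym/eqP; rewrite expn_eq0. Qed.

Lemma digit_seq_lt n j : j \in digit_seq n -> (j < 2 ^ n)%N.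
Proof.
elim: n j => [|n IH] j /=; first by rewrite inE => /eqP ->.
rewrite expnS; case: (is_gap n); first by move=> /mapP[i /IH i2 ->]; lia.
by rewrite mem_cat => /orP[] /mapP[i /IH i2 ->]; lia.
Qed.

Lemma uniq_digit_seq n : uniq (digit_seq n).
Proof.
have i1 : injective double by move=> x y; lia.
have i2 : injective (fun j => j.*2.+1) by move=> x y; lia.
elim: n => [|n IH] //=; case: (is_gap n); first by rewrite map_inj_uniq.
rewrite cat_uniq !map_inj_uniq // IH /= andbT; apply/hasPn => _ /mapP[i _ ->].
by apply/negP => /mapP[k _]; lia.
Qed.

Lemma modn_double a b : (a.*2 %% b.*2 = (a %% b).*2)%N.
Proof. by rewrite -!muln2 -muln_modl. Qed.

Lemma digit_seq_gap n j p : j \in digit_seq n -> (p < n)%N -> is_gap p ->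
  (j %% 2 ^ (n - p) < 2 ^ (n - p).-1)%N.
Proof.
elim: n j => [|n IH] j //=; rewrite ltnS leq_eqVlt => jn /predU1P[pn|pn] gp.
  move: jn; rewrite -pn gp => /mapP[i _ ->].
  by rewrite subSnn /= expn1 modn2 odd_double.
have e : (2 ^ (n - p) = (2 ^ (n - p).-1).*2)%N by rewrite -mul2n -expnS prednK // subn_gt0.
have H i : i \in digit_seq n -> (i.*2.+1 %% (2 ^ (n - p)).*2 < 2 ^ (n - p))%N.
  move=> /IH/(_ pn gp); move: e; move: (2 ^ (n - p))%N (2 ^ (n - p).-1)%N => M N e h.
  have -> : i.*2.+1 = (i %/ M * M.*2 + (i %% M).*2.+1)%N.
    by rewrite {1}(divn_eq i M) doubleD -doubleMr addnS.
  rewrite modnMDl modn_small; lia.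
have H0 i : i \in digit_seq n -> (i.*2 %% (2 ^ (n - p)).*2 < 2 ^ (n - p))%N.
  move=> /IH/(_ pn gp); rewrite modn_double; move: e; move: (2 ^ (n - p))%N (2 ^ _)%N => M N e h.
  lia.
rewrite subSn ?(ltnW pn) // expnS mul2n /=; move: jn; case: (is_gap n).
  by move=> /mapP[i /H0 h ->].
by rewrite mem_cat => /orP[] /mapP[i ih ->]; [exact: H0|exact: H].
Qed.

(** All the numbers with [m] digits have the same number of continuations with [n]
    digits, as the digits that are free do not depend on the others. *)
Lemma digit_seq_cell m n i : (m <= n)%N ->
  (count (fun j : nat => j %/ 2 ^ (n - m) == i) (digit_seq n) * size (digit_seq m) <=
   size (digit_seq n))%N.
Proof.
elim: n => [|n IH].
  by rewrite leqn0 => /eqP -> /=; case: (_ == _).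
rewrite leq_eqVlt => /predU1P[->|mn].
  rewrite subnn -[leqRHS]mul1n leq_mul2r; apply/orP; right.
  rewrite (eq_count (a2 := pred1 i)); last by move=> j /=; rewrite divn1.
  by rewrite (count_uniq_mem _ (uniq_digit_seq _)) leq_b1.
rewrite subSn // expnS /=; have := IH mn; set M := (2 ^ (n - m))%N => H.
have E (b : bool) : (fun j : nat => (nat_of_bool b + j.*2) %/ (2 * M) == i)%N =1 (fun j => j %/ M == i)%N.
  by move=> j /=; rewrite divnMA divn2 half_bit_double.
case: (is_gap n).
  rewrite count_map size_map (eq_count (a2 := fun j => j %/ M == i)%N) //.
  by move=> j; exact: (E false).
rewrite count_cat !count_map size_cat !size_map.
rewrite (eq_count (a2 := fun j => j %/ M == i)%N); last by move=> j; exact: (E false).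
rewrite [X in (_ + X)%N](eq_count (a2 := fun j => j %/ M == i)%N); last by move=> j; exact: (E true).
by rewrite mulnDl leq_add.
Qed.

Lemma card_nth_count (s : seq nat) (P : pred nat) :
  #|[pred k : 'I_(size s) | P (nth 0%N s k)]| = count P s.
Proof. by rewrite -sum1_card -sum1_count [RHS](big_nth 0%N) big_mkord. Qed.

End Digits.

Section GapSet.
Variables (R : realType) (d : nat).
Hypothesis d_gt0 : (0 < d)%N.
Local Notation V := 'rV[R]_d.

Lemma pi2_ge0 : 0 <= pi *+ 2 :> R.
Proof. by rewrite mulrn_wge0 // pi_ge0. Qed.

Definition gap_set : set V := unit_cube R d `&`
  [set x | forall i k, 0 <= sin (2 ^+ (k.+1 ^ 2) * x ord0 i * (pi *+ 2))].

Lemma closed_gap_set : closed gap_set.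
Proof.
apply: closedI; first exact: closed_cube.
rewrite [X in closed X](_ : _ = \bigcap_(p in [set: 'I_d * nat])
    ((fun x : V => sin (2 ^+ (p.2.+1 ^ 2) * x ord0 p.1 * (pi *+ 2))) @^-1` [set r : R | 0 <= r])).
  apply: closed_bigI => p _; apply: closed_comp; last exact: closed_ge.
  move=> x _; apply: continuous_comp; last exact: continuous_sin.
  apply: (@lip_continuous _ _ (fun x : V => 2 ^+ (p.2.+1 ^ 2) * x ord0 p.1 * (pi *+ 2))
    (2 ^+ (p.2.+1 ^ 2) * (pi *+ 2))) => u v.
  rewrite -mulrBl -mulrBr !normrM [`|2 ^+ _|]ger0_norm ?exprn_ge0 // mulrAC.
  rewrite [`|pi *+ 2|]ger0_norm ?pi2_ge0 //.
  apply: ler_wpM2l; first by rewrite mulr_ge0 ?exprn_ge0 ?pi2_ge0.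
  by have := coord_le_norm (u - v) p.1; rewrite !mxE.
apply/seteqP; split=> x H; first by move=> [i k] _; exact: H.
by move=> i k; exact: (H (i, k)).
Qed.

Lemma sinD_nat2pi (x : R) (q : nat) : sin (x + q%:R * (pi *+ 2)) = sin x.
Proof. by rewrite mulr_natl (periodicn (@sinD2pi R)). Qed.

Lemma zero_gap_set : gap_set 0.
Proof.
split=> [i|i k]; first by rewrite mxE lexx ler01.
by rewrite mxE mulr0 mul0r sin0.
Qed.

Definition digit_pt n (k : {ffun 'I_d -> 'I_(size (digit_seq n))}) : V :=
  \row_i ((nth 0%N (digit_seq n) (k i))%:R / 2 ^+ n).

Lemma digit_pt_gap_set n k : gap_set (@digit_pt n k).
Proof.
have n0 : 0 < 2 ^+ n :> R by rewrite exprn_gt0.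
have jin i : nth 0%N (digit_seq n) (k i) \in digit_seq n by exact: mem_nth.
split=> [i|i q]; rewrite mxE; move: (jin i); move: (nth _ _ _) => j ji.
  rewrite divr_ge0 ?ler0n ?(ltW n0) //= ler_pdivrMr // mul1r -natrX ler_nat.
  exact: ltnW (digit_seq_lt ji).
have [np|pn] := leqP n (q.+1 ^ 2).
  have -> : 2 ^+ (q.+1 ^ 2) * (j%:R / 2 ^+ n) = (2 ^ (q.+1 ^ 2 - n) * j)%:R :> R.
    rewrite natrM natrX -{1}(subnK np) exprD; field.
    by rewrite gt_eqF.
  by rewrite -[X in sin X]add0r sinD_nat2pi sin0.
set p := (q.+1 ^ 2)%N in pn *.
have gp : is_gap p.
  by apply/existsP; exists (inord q); rewrite inordK // ltnS /p; nia.
have := digit_seq_gap ji pn gp; set M := (2 ^ (n - p))%N; set r := (j %% M)%N => rM.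
have M0 : 0 < M%:R :> R by rewrite ltr0n expn_gt0.
have M2 : M%:R = 2 * (2 ^ (n - p).-1)%:R :> R.
  by rewrite -natrM -expnS prednK // subn_gt0.
have -> : 2 ^+ p * (j%:R / 2 ^+ n) = r%:R / M%:R + (j %/ M)%:R :> R.
  rewrite {1}(divn_eq j M) natrD natrM -/r.
  have -> : 2 ^+ n = 2 ^+ p * M%:R :> R by rewrite /M natrX -exprD subnKC // ltnW.
  field; by rewrite !gt_eqF ?exprn_gt0.
rewrite mulrDl sinD_nat2pi; apply: sin_ge0_pi; rewrite mulr_ge0 ?divr_ge0 ?ler0n ?pi2_ge0 //=.
rewrite -[pi *+ 2]mulr_natl mulrA ler_piMl ?pi_ge0 // mulrAC ler_pdivrMr // mul1r M2 mulrC ler_pM2l //.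
by rewrite ler_nat ltnW.
Qed.

(** The set [E] meets at most three consecutive dyadic intervals of level [m]. *)
Lemma card_digit_line n m (E : set R) : (m <= n)%N ->
  (forall x y, E x -> E y -> `|x - y| <= 2 ^- m) ->
  (#|[pred k : 'I_(size (digit_seq n)) | `[< E ((nth 0%N (digit_seq n) k)%:R / 2 ^+ n) >]]|
    * size (digit_seq m) <= 3 * size (digit_seq n))%N.
Proof.
move=> mn HE; pose P := fun j : nat => `[< E (j%:R / 2 ^+ n) >].
rewrite (card_nth_count _ P).
have [/hasP[j0 j0n /asboolP Ej0]|] := boolP (has P (digit_seq n)); last first.
  by rewrite has_count -leqNgt leqn0 => /eqP ->.
pose M := (2 ^ (n - m))%N; have M0 : (0 < M)%N by rewrite expn_gt0.
pose i0 := (j0 %/ M)%N.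
pose c (i : nat) : pred nat := fun j : nat => (j %/ M == i)%N.
have cU (a b : pred nat) t : (count (predU a b) t <= count a t + count b t)%N.
  by rewrite -count_predUI leq_addr.
have n0 : 0 < 2 ^+ n :> R by rewrite exprn_gt0.
have Pc : subpred P (predU (predU (c i0.-1) (c i0)) (c i0.+1)).
  move=> j /asboolP Ej; have := HE _ _ Ej Ej0.
  rewrite -mulrBl normrM [`|_^-1|]ger0_norm ?invr_ge0 ?(ltW n0) // ler_pdivrMr //.
  have -> : 2 ^- m * 2 ^+ n = M%:R :> R.
    by rewrite /M natrX -{1}(subnK mn) exprD mulrCA mulVf ?mulr1 // gt_eqF // exprn_gt0.
  rewrite ler_norml => /andP[a b].
  have h1 : (j0 <= j + M)%N by rewrite -(ler_nat R) natrD; lra.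
  have h2 : (j <= j0 + M)%N by rewrite -(ler_nat R) natrD; lra.
  have k1 : (j %/ M <= i0.+1)%N.
    by apply: leq_trans (leq_div2r M h2) _; rewrite divnDr ?dvdnn // divnn M0 addn1.
  have k2 : (i0 <= (j %/ M).+1)%N.
    by apply: leq_trans (leq_div2r M h1) _; rewrite divnDr ?dvdnn // divnn M0 addn1.
  by rewrite /= /c /=; move: k1 k2; move: (j %/ M)%N i0 => u v; lia.
have h i : (count (c i) (digit_seq n) * size (digit_seq m) <= size (digit_seq n))%N.
  exact: digit_seq_cell.
apply: (@leq_trans ((count (c i0.-1) (digit_seq n) + count (c i0) (digit_seq n) +
    count (c i0.+1) (digit_seq n)) * size (digit_seq m))).
  rewrite leq_mul2r; apply/orP; right; apply: leq_trans (sub_count Pc _) _.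
  by apply: leq_trans (cU _ _ _) _; rewrite leq_add2r.
rewrite !mulnDl !mulSn mul0n addn0 addnA; apply: leq_add => //; exact: leq_add.
Qed.

Lemma card_digit_pts n m (W : set V) : (m <= n)%N ->
  (forall x y, W x -> W y -> forall i, `|x ord0 i - y ord0 i| <= 2 ^- m) ->
  (#|[pred k | `[< W (@digit_pt n k) >]]| * size (digit_seq m) ^ d <=
    (3 * size (digit_seq n)) ^ d)%N.
Proof.
move=> mn HW; pose E i := [set r : R | exists2 x, W x & x ord0 i = r].
pose F i : pred 'I_(size (digit_seq n)) :=
  [pred k : 'I_(size (digit_seq n)) | `[< E i ((nth 0%N (digit_seq n) k)%:R / 2 ^+ n) >]].
apply: (@leq_trans (#|family F| * size (digit_seq m) ^ d)).
  rewrite leq_mul2r; apply/orP; right; apply: subset_leq_card; apply/fintype.subsetP => k.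
  rewrite inE => Wk; apply/familyP => i; rewrite inE.
  have h : E i ((nth 0%N (digit_seq n) (k i))%:R / 2 ^+ n) by exists (digit_pt k); rewrite ?mxE.
  exact: h.
rewrite card_family foldrE big_map big_enum /=.
rewrite -[X in (_ ^ X)%N]card_ord -[X in (_ <= _ ^ X)%N]card_ord -!prod_nat_const -big_split /=.
apply: leq_prod => i _; apply: card_digit_line => // x y [u Wu <-] [v Wv <-]; exact: HW.
Qed.

(** At most [sqrt m] of the first [m] digits are prescribed. *)
Lemma digit_growth (sg : R) : 0 < sg < 1 ->
  exists2 kap : R, 0 < kap & forall m, kap * 2 `^ (sg * m%:R) <= (size (digit_seq m))%:R.
Proof.
move=> /andP[s0 s1]; have dl : 0 < 1 - sg by lra.
exists (2 `^ (- (4 * (1 - sg))^-1)); first by rewrite powR_gt0.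
move=> m; have g := gaps_le m.
have -> : (size (digit_seq m))%:R = 2 `^ ((m - gaps m)%:R) :> R.
  rewrite powR_mulrn // -natrX; congr (_%:R); apply/eqP.
  by rewrite -(eqn_pmul2r (expn_gt0 2 (gaps m))) size_digit_seq -expnD subnK.
rewrite -powRD ?pnatr_eq0 ?implybT //; apply: ler_powR; first by rewrite ler1n.
rewrite natrB //; have := gaps_sq m; rewrite -(ler_nat R) natrX.
move: (gaps m)%:R (m%:R) => x y xy'.
have -> : sg * y = y - (1 - sg) * y by ring.
have [e eE] : exists e : R, e = 1 - sg by exists (1 - sg).
rewrite -eE in dl *; move: eE => _.
have h : x <= e * y + (4 * e)^-1.
  have : 0 <= (4 * e)^-1 * (2 * e * x - 1) ^+ 2.
    by rewrite mulr_ge0 ?sqr_ge0 // invr_ge0 mulr_ge0 // ltW.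
  have -> : (4 * e)^-1 * (2 * e * x - 1) ^+ 2 = e * x ^+ 2 - x + (4 * e)^-1.
    by field; rewrite gt_eqF.
  have : e * x ^+ 2 <= e * y by rewrite ler_pM2l.
  lra.
lra.
Qed.

Lemma compact_nat_cover (A : set V) (W : nat -> set V) :
  compact A -> (forall i, open (W i)) -> A `<=` \bigcup_i W i ->
  exists N, A `<=` \bigcup_(i in [set i | (i < N)%N]) W i.
Proof.
rewrite compact_cover => cA oW AW.
have [D _ AD] := cA nat setT W (fun i _ => oW i) AW.
exists (\max_(i <- finmap.enum_fset D) i).+1 => x /AD[i /= iD Wi]; exists i => //=.
by rewrite ltnS; apply: leq_bigmax_seq.
Qed.

Lemma cube_compact : compact (unit_cube R d).
Proof.
apply: bounded_closed_compact; last exact: closed_cube.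
exists 1; split; first exact: num_real.
move=> M M1 x xc; apply: norm_le_coord => [|i]; first by rewrite (le_trans _ (ltW M1)).
by have /andP[x0 x1] := xc i; rewrite ger0_norm // (le_trans x1) // ltW.
Qed.

Lemma gap_set_compact : compact gap_set.
Proof. exact: subclosed_compact closed_gap_set cube_compact (@subIsetl _ _ _). Qed.

Lemma dyadic_scale (t : R) M : t <= 1 -> 2^-1 ^+ M < t ->
  exists m, [/\ (m <= M)%N, t <= 2^-1 ^+ m & 2^-1 ^+ m < 2 * t].
Proof.
move=> t1; elim: M => [|M IH] Mt; first by move: (lt_le_trans Mt t1); rewrite expr0 ltxx.
have [tM|/IH[m [mM h1 h2]]] := leP t (2^-1 ^+ M); last by exists m; split => //; exact: ltnW.
by exists M; split=> //; move: Mt; rewrite exprS; lra.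
Qed.

(** A Frostman condition for the uniform measures on the digit points, uniformly in
    the number [n] of digits at the scales larger than [2^(-n)]. *)
Lemma digit_mass (s : R) : 0 < s < d%:R -> exists2 K : R, 0 < K &
  forall (W : set V) (t : R) n, 0 < t -> 2^-1 ^+ n < t ->
  (forall x y, W x -> W y -> enorm (x - y) <= t) ->
  (#|[pred k | `[< W (@digit_pt n k) >]]|)%:R <= K * t `^ s * (size (digit_seq n))%:R ^+ d.
Proof.
move=> /andP[s0 sd]; have d0 : 0 < d%:R :> R by rewrite ltr0n.
have [|kap k0 hk] := @digit_growth (s / d%:R).
  by rewrite divr_gt0 //= ltr_pdivrMr // mul1r.
have K0 : 0 <= 3 ^+ d * kap ^- d * 2 `^ s.
  by rewrite !mulr_ge0 ?powR_ge0 ?invr_ge0 ?exprn_ge0 // ltW.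
exists (3 ^+ d * kap ^- d * 2 `^ s + 1); first by rewrite ltr_wpDl.
move=> W t n t0 nt HW; set w := (size (digit_seq n))%:R.
have w0 : 0 <= w ^+ d by rewrite exprn_ge0 // ler0n.
have ts := powR_ge0 t s.
have [t1|t1] := leP t 1; last first.
  apply: (@le_trans _ _ (w ^+ d)).
    rewrite -natrX ler_nat -[X in (_ <= _ ^ X)%N]card_ord -[X in (_ <= X ^ _)%N]card_ord -card_ffun.
    exact: max_card.
  rewrite -[leLHS]mul1r ler_wpM2r // -[leLHS]mul1r ler_pM // ?lerDr //.
  apply: (@le_trans _ _ (1 `^ s)); first by rewrite powR1.
  by rewrite ge0_ler_powR ?nnegrE ?(ltW s0) ?(ltW t0) // ltW.
have [m [mn tm mt]] := dyadic_scale t1 nt.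
have H : forall x y, W x -> W y -> forall i, `|x ord0 i - y ord0 i| <= 2 ^- m.
  move=> x y Wx Wy i; rewrite -exprVn; apply: le_trans tm; apply: le_trans (HW _ _ Wx Wy).
  by have := enorm_ge_coord (x - y) i; rewrite !mxE.
have := card_digit_pts mn H; rewrite -(ler_nat R) natrM !natrX natrM exprMn -/w.
set c := #|_|%:R => hc.
have wm : kap ^+ d * (2 * t) `^ (- s) <= (size (digit_seq m))%:R ^+ d.
  apply: (@le_trans _ _ ((kap * 2 `^ (s / d%:R * m%:R)) ^+ d)); last first.
    by rewrite lerXn2r ?nnegrE ?mulr_ge0 ?powR_ge0 ?ler0n ?(ltW k0).
  rewrite exprMn ler_pM2l ?exprn_gt0 //.
  rewrite -powR_mulrn ?powR_ge0 // -powRrM mulrAC divfK ?gt_eqF //.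
  have -> : 2 `^ (s * m%:R) = (2^-1 ^+ m) `^ (- s) :> R.
    rewrite -[2^-1]powR_inv1 // -powR_mulrn ?powR_ge0 // -!powRrM; congr (_ `^ _).
    by ring.
  rewrite !powRN lef_pV2 ?posrE ?powR_gt0 ?exprn_gt0 ?mulr_gt0 //.
  by rewrite ge0_ler_powR ?nnegrE ?(ltW s0) ?exprn_ge0 ?mulr_ge0 ?(ltW t0) // ltW.
have p0 : 0 < kap ^+ d * (2 * t) `^ (- s) by rewrite mulr_gt0 ?exprn_gt0 ?powR_gt0 ?mulr_gt0.
have h : c * (kap ^+ d * (2 * t) `^ (- s)) <= 3 ^+ d * w ^+ d.
  by apply: le_trans hc; rewrite ler_wpM2l // ler0n.
rewrite mulrDl mulrDl mul1r ler_wpDr ?mulr_ge0 //.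
move: h; rewrite -ler_pdivlMr // => /le_trans; apply.
rewrite le_eqVlt; apply/orP; left; apply/eqP.
rewrite powRN (powRM _ (ltW (ltr0n R 2 : 0 < 2)) (ltW t0)); field.
by rewrite !gt_eqF ?powR_gt0 ?exprn_gt0.
Qed.

(** Mass distribution principle. By compactness a finite part of an open cover
    contains all the digit points with [n] digits, and the cover has small weight only
    if it misses some of them for large [n]. *)
Lemma gap_set_content (s : R) : 0 < s < d%:R ->
  exists2 e : R, 0 < e & content_ge s e gap_set.
Proof.
move=> s0d; have /andP[s0 _] := s0d; have [K K0 HK] := digit_mass s0d.
pose e := (2 * K)^-1; have e0 : 0 < e by rewrite invr_gt0 mulr_gt0.
exists e => // U CU; rewrite leNgt; apply/negP => small.
have fin : (\sum_(0 <= i <oo) diam_pow s (U i) < +oo)%E by apply: lt_trans small _; exact: ltry.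
have [W [t [oW UW t0 Wt Ht]]] := enlarge_cover d_gt0 s0 e0 fin.
have CW : gap_set `<=` \bigcup_i W i by move=> x /CU[i _ Ui]; exists i => //; exact: UW.
have [N CN] := compact_nat_cover gap_set_compact oW CW.
have [n hn] : exists n, forall i, (i < N)%N -> 2^-1 ^+ n < t i.
  elim: (N) => [|N' [n hn]]; first by exists 0%N.
  have [k hk] := small_inv (t0 N'); exists (n + k)%N => i.
  have p1 q : 2^-1 ^+ q <= 1 :> R by rewrite exprn_ile1 // invf_le1 // ler1n.
  rewrite ltnS leq_eqVlt => /predU1P[->|/hn h].
    apply: le_lt_trans hk; rewrite exprD; apply: (@le_trans _ _ (2^-1 ^+ k)).
      by rewrite ler_piMl // exprn_ge0.
    by rewrite exprVn lef_pV2 ?posrE ?exprn_gt0 ?ltr0n // -natrX ler_nat ltn_expl.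
  by apply: le_lt_trans h; rewrite exprD ler_piMr // exprn_ge0.
have lim : (\sum_(i < N) (t i `^ s)%:E < (K^-1)%:E)%E.
  apply: (@le_lt_trans _ _ (\sum_(0 <= i <oo) (t i `^ s)%:E)%E).
    rewrite -(big_mkord xpredT (fun i => (t i `^ s)%:E)).
    by apply: nneseries_lim_ge => i _ _; rewrite lee_fin powR_ge0.
  apply: (le_lt_trans Ht); apply: (@lt_le_trans _ _ (e%:E + e%:E)%E).
    by rewrite lteD2rE.
  rewrite -EFinD lee_fin le_eqVlt; apply/orP; left; apply/eqP; rewrite /e.
  by field; rewrite gt_eqF.
move: lim; rewrite sumEFin lte_fin => lim.
set w := (size (digit_seq n))%:R : R.
have w0 : 0 < w ^+ d by rewrite exprn_gt0 // ltr0n digit_seq_gt0.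
have : w ^+ d <= \sum_(i < N) (#|[pred k | `[< W i (@digit_pt n k) >]]|)%:R.
  rewrite -natr_sum -natrX ler_nat.
  rewrite -[X in (_ ^ X)%N]card_ord -[X in (X ^ _)%N]card_ord -card_ffun.
  under eq_bigr do rewrite -sum1_card.
  rewrite (exchange_big_dep xpredT) //= -sum1_card; apply: leq_sum => k _.
  have [i /= iN Wi] := CN _ (digit_pt_gap_set k).
  rewrite (bigD1 (Ordinal iN)) //=; exact/asboolP.
move=> H; have := le_trans H (ler_sum _ (fun i _ => HK _ _ _ (t0 _) (hn _ (ltn_ord i)) (Wt _))).
rewrite -mulr_suml -mulr_sumr leNgt => /negP; apply.
rewrite -[ltRHS]mul1r ltr_pM2r // mulrC -ltr_pdivlMr // mul1r; exact: lim.
Qed.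

End GapSet.

(** * The prescribed digits prevent Fourier decay *)

Section GapSetNull.
Variables (R : realType) (d : nat).
Hypothesis d_gt0 : (0 < d)%N.
Local Notation V := 'rV[R]_d.
Local Notation BV := (borel_rV R d).

Lemma trig_products (a b a2 b2 : R) :
  (sin a + cos a2 / 2) * (sin b + cos b2 / 2) =
  2^-1 * cos (a - b) - 2^-1 * cos (a + b) + 4^-1 * sin (a + b2) + 4^-1 * sin (a - b2) +
  4^-1 * sin (a2 + b) - 4^-1 * sin (a2 - b) + 8^-1 * cos (a2 - b2) + 8^-1 * cos (a2 + b2).
Proof. by rewrite !cosD !sinD !cosN !sinN; field. Qed.

Definition wave (o : 'I_d) (b : bool) (u : R) (x : V) : R :=
  if b then cos (u * x ord0 o) else sin (u * x ord0 o).

(** As [sin t + cos (2 t) / 2 = 1 / 2 + sin t - (sin t)^2], this is at least [1 / 2]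
    where the sine is nonnegative, although its mean is zero. *)
Definition pulse (o : 'I_d) (u : R) (x : V) : R :=
  sin (u * x ord0 o) + cos ((2 * u) * x ord0 o) / 2.

Lemma pulse_mul o u v x : pulse o u x * pulse o v x = \sum_(p <- [::
    (2^-1, (true, u - v)); (- 2^-1, (true, u + v));
    (4^-1, (false, u + 2 * v)); (4^-1, (false, u - 2 * v));
    (4^-1, (false, 2 * u + v)); (- 4^-1, (false, 2 * u - v));
    (8^-1, (true, 2 * u - 2 * v)); (8^-1, (true, 2 * u + 2 * v))])
  p.1 * wave o p.2.1 p.2.2 x.
Proof.
rewrite /pulse trig_products !big_cons big_nil /wave /= !mulNr.
by rewrite -!mulrBl -!mulrDl addr0 !addrA.
Qed.

Definition freq (k : nat) : R := 2 ^+ (k.+1 ^ 2) * (pi *+ 2).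

Lemma freq_step k l : (k < l)%N -> 8 * freq k <= freq l.
Proof.
move=> kl; rewrite /freq mulrA ler_wpM2r ?pi2_ge0 //.
have -> : (8 : R) = 2 ^+ 3 by rewrite -natrX.
rewrite -exprD ler_weXn2l ?ler1n //; nia.
Qed.

Lemma freq_ge k : k%:R <= freq k.
Proof.
have p1 : 1 <= pi *+ 2 :> R by have := pi_ge2 R; rewrite -mulr_natr; lra.
apply: (@le_trans _ _ (2 ^+ (k.+1 ^ 2))); last by rewrite /freq ler_peMr // exprn_ge0.
rewrite -natrX ler_nat; apply: leq_trans (ltnW (ltn_expl k (ltnSn 1))) _.
by rewrite leq_pexp2l //; nia.
Qed.

(** The frequencies in [pulse_mul] are all large when [u] is large and [v] is much
    larger. *)
Lemma separated_freqs (T u v : R) : 0 < u -> T <= u -> 8 * u <= v ->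
  [/\ T <= `|u - v|, T <= `|u + v|, T <= `|u + 2 * v|, T <= `|u - 2 * v| &
   [/\ T <= `|2 * u + v|, T <= `|2 * u - v|, T <= `|2 * u - 2 * v| & T <= `|2 * u + 2 * v|]].
Proof.
move=> u0 Tu uv; split; last split.
- by rewrite distrC; apply: le_trans (ler_norm _); lra.
- by apply: le_trans (ler_norm _); lra.
- by apply: le_trans (ler_norm _); lra.
- by rewrite distrC; apply: le_trans (ler_norm _); lra.
- by apply: le_trans (ler_norm _); lra.
- by rewrite distrC; apply: le_trans (ler_norm _); lra.
- by rewrite distrC; apply: le_trans (ler_norm _); lra.
- by apply: le_trans (ler_norm _); lra.
Qed.

Lemma pulse_gap_set o k x : @gap_set R d x -> 1 / 2 <= pulse o (freq k) x.
Proof.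
move=> [_ /(_ o k)]; rewrite mulrAC -/(freq k) /pulse => s0.
have -> : 2 * freq k * x ord0 o = (freq k * x ord0 o) *+ 2 by rewrite -mulrA mulr_natl.
rewrite cos_mulr2n cos2sin2; have := sin_le1 (freq k * x ord0 o).
by move: s0; move: (sin _) => a; nra.
Qed.

Lemma pulse_le o u x : `|pulse o u x| <= 3 / 2.
Proof.
rewrite /pulse (le_trans (ler_normD _ _)) // normrM [`|2^-1|]ger0_norm ?invr_ge0 //.
have := sin_max (u * x ord0 o); have := cos_max (2 * u * x ord0 o).
move: (`|_|) (`|_|) => a b; lra.
Qed.

Variables (mu : probability BV R) (c s : R).
Hypotheses (s_gt0 : 0 < s) (dec : fourier_decay mu c s).

Let o : 'I_d := Ordinal d_gt0.
Let xi (u : R) : V := u *: delta_mx ord0 o.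

Lemma dotp_axis u x : dotp (xi u) x = u * x ord0 o.
Proof. by rewrite dotpC dotpZr dotp_delta. Qed.

Lemma wave_bounded b u : bounded_mfun (wave o b u : BV -> R).
Proof.
rewrite /wave; case: b; under eq_fun do rewrite -dotp_axis.
  exact: cos_dotp_bounded.
exact: sin_dotp_bounded.
Qed.

Lemma wave_vanish (e : R) : 0 < e -> exists2 T, 0 < T &
  forall b u, T <= `|u| -> `|\int[mu]_x wave o b u x| <= e.
Proof.
move=> e0; have [c0 hc] := dec; have ce : 0 < c / e by rewrite divr_gt0.
pose T := (c / e) `^ (2 / s); have T0 : 0 < T by rewrite powR_gt0.
exists T => // b u Tu; have u0 : 0 < `|u| by exact: lt_le_trans Tu.
have xi0 : xi u != 0.
  apply/eqP => /(congr1 (fun v : V => v ord0 o)); rewrite !mxE !eqxx mulr1 => u00.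
  by move: u0; rewrite u00 normr0 ltxx.
have en : `|u| <= enorm (xi u).
  by have := enorm_ge_coord (xi u) o; rewrite !mxE !eqxx mulr1.
have small : ComplexField.Normc.normc (fourier mu (xi u)) <= e.
  apply: (le_trans (hc _ xi0)); rewrite mulNr powRN ler_pdivrMr; last first.
    by rewrite powR_gt0 // (lt_le_trans u0).
  rewrite mulrC -ler_pdivrMr //; apply: (@le_trans _ _ (T `^ (s / 2))).
    rewrite /T -powRrM (_ : 2 / s * (s / 2) = 1) ?powRr1 ?(ltW ce) //.
    by field; rewrite gt_eqF.
  apply: ge0_ler_powR; rewrite ?nnegrE ?divr_ge0 ?(ltW s_gt0) ?(ltW T0) //.
    by rewrite (le_trans _ en) // ltW.
  exact: le_trans en.
apply: le_trans small; rewrite normc_fourier.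
have -> : \int[mu]_x wave o b u x = if b then cosint mu (xi u) else sinint mu (xi u).
  rewrite /wave /cosint /sinint; case: b; apply: eq_Rintegral => x _; by rewrite dotp_axis.
by case: b; rewrite -sqrtr_sqr ler_wsqrtr // ?lerDl ?lerDr sqr_ge0.
Qed.

Lemma pulse_bounded u : bounded_mfun (pulse o u : BV -> R).
Proof.
apply: bounded_mfunD; first exact: (wave_bounded false).
by apply: bounded_mfunM; [exact: (wave_bounded true)|exact: bounded_mfun_cst].
Qed.

Lemma pulse_decorrelate (e T u v : R) :
  (forall b w, T <= `|w| -> `|\int[mu]_x wave o b w x| <= e) ->
  0 < u -> T <= u -> 8 * u <= v -> `|\int[mu]_x (pulse o u x * pulse o v x)| <= 3 * e.
Proof.
move=> H u0 Tu uv; under eq_Rintegral do rewrite pulse_mul.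
rewrite Rintegral_sum //; last first.
  by move=> p; apply: bounded_mfunM; [exact: bounded_mfun_cst|exact: wave_bounded].
have [f1 f2 f3 f4 [f5 f6 f7 f8]] := separated_freqs u0 Tu uv.
set l := (X in \sum_(_ <- X) _).
have /allP Tl : all (fun p : R * (bool * R) => T <= `|p.2.2|) l.
  by rewrite /l /= f1 f2 f3 f4 f5 f6 f7 f8.
have e0 : 0 <= e by apply: le_trans (H true _ f1).
apply: (le_trans (ler_norm_sum _ _ _)); apply: (@le_trans _ _ (\sum_(p <- l) `|p.1| * e)).
  rewrite !big_seq; apply: ler_sum => p pl.
  rewrite RintegralZl //; last by apply: bounded_mfun_integrable => //; exact: wave_bounded.
  by rewrite normrM ler_wpM2l // H // Tl.
rewrite -mulr_suml ler_wpM2r // /l !big_cons big_nil /= !normrN !(@ger0_norm _ _^-1) ?invr_ge0 //.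
lra.
Qed.

(** On the gap set the average of [n] functions [pulse (freq k)] is at least [1 / 2].
    They are almost uncorrelated for large [k], hence this average is small in mean
    square. *)
Lemma gap_set_null : mu (@gap_set R d) = 0%E.
Proof.
have mC : measurable (@gap_set R d : set BV) by apply: closed_borel; exact: closed_gap_set.
suff H (e : R) : 0 < e -> fine (mu (@gap_set R d)) <= 24 * e.
  rewrite -(fineK (prob_fin_num mu mC)); congr (_%:E); apply/eqP.
  rewrite eq_le fine_ge0 ?measure_ge0 // andbT; apply/ler_addgt0Pr => e e0; rewrite add0r.
  have e24 : 0 < e / 24 by rewrite divr_gt0.
  by have := H _ e24; rewrite [24 * _]mulrC divfK // pnatr_eq0.
move=> e0; have [T T0 HT] := wave_vanish e0.
have [n0 hn] := small_inv e0; set n := n0.+1 in hn.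
have nR : 0 < n%:R :> R by rewrite ltr0n.
pose K := (Num.truncn T).+1.
have KT k : (K <= k)%N -> T <= freq k.
  move=> Kk; apply: le_trans (freq_ge k); apply: (@le_trans _ _ K%:R); last by rewrite ler_nat.
  exact: ltW (truncnS_gt _).
pose h (x : V) := \sum_(k < n) pulse o (freq (K + k)) x.
have bh : bounded_mfun (h : BV -> R) by apply: bounded_mfun_sum => i; exact: pulse_bounded.
have hC x : @gap_set R d x -> n%:R / 2 <= h x.
  move=> xC; apply: (@le_trans _ _ (\sum_(k < n) (1 / 2 : R))).
    by rewrite sumr_const card_ord -[leRHS]mulr_natl mul1r.
  by apply: ler_sum => k _; exact: pulse_gap_set.
have bgg k l : bounded_mfun (fun x : BV => pulse o (freq k) x * pulse o (freq l) x).
  by apply: bounded_mfunM; exact: pulse_bounded.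
have int_h : \int[mu]_x (h x * h x) <= \sum_(k < n) \sum_(l < n) (3 * (k == l)%:R + 3 * e).
  have -> : \int[mu]_x (h x * h x) =
      \sum_(k < n) \sum_(l < n) \int[mu]_x (pulse o (freq (K + k)) x * pulse o (freq (K + l)) x).
    have bk (k : 'I_n) : bounded_mfun (fun x : BV =>
        \sum_(l < n) pulse o (freq (K + k)) x * pulse o (freq (K + l)) x).
      by apply: bounded_mfun_sum => l; exact: bgg.
    rewrite (_ : \int[mu]_x (h x * h x) = \int[mu]_x (\sum_(k < n) \sum_(l < n)
        pulse o (freq (K + k)) x * pulse o (freq (K + l)) x)); last first.
      apply: eq_Rintegral => x _; rewrite /h mulr_suml; apply: eq_bigr => k _.
      by rewrite mulr_sumr.
    rewrite Rintegral_sum //; apply: eq_bigr => k _.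
    by rewrite Rintegral_sum // => l; exact: bgg.
  apply: ler_sum => k _; apply: ler_sum => l _; apply: (le_trans (ler_norm _)).
  have [->|kl] := eqVneq k l.
    apply: (@le_trans _ _ 3); last by rewrite mulr1 lerDl mulr_ge0 // ltW.
    apply: Rintegral_norm_le => [|x]; first by have [] := bgg (K + l)%N (K + l)%N.
    rewrite normrM; have := pulse_le o (freq (K + l)) x; have := normr_ge0 (pulse o (freq (K + l)) x).
    by move: (`|_|) => a; nra.
  rewrite mulr0 add0r; move: kl; rewrite neq_ltn => /orP[kl|lk].
    apply: (pulse_decorrelate HT); last by apply: freq_step; rewrite ltn_add2l.
      by apply: lt_le_trans (KT _ _); rewrite ?leq_addr.
    by apply: KT; rewrite leq_addr.
  under eq_Rintegral do rewrite mulrC.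
  apply: (pulse_decorrelate HT); last by apply: freq_step; rewrite ltn_add2l.
    by apply: lt_le_trans (KT _ _); rewrite ?leq_addr.
  by apply: KT; rewrite leq_addr.
have sumE : \sum_(k < n) \sum_(l < n) (3 * (k == l)%:R + 3 * e) = 3 * n%:R + 3 * e * n%:R ^+ 2 :> R.
  have row (k : 'I_n) : \sum_(l < n) (3 * (k == l)%:R + 3 * e) = 3 + 3 * e * n%:R :> R.
    rewrite big_split /= sumr_const card_ord -mulr_sumr -[_ *+ n]mulr_natr (bigD1 k) //= eqxx big1.
      by rewrite addr0 mulr1.
    by move=> l; rewrite eq_sym => /negbTE ->.
  rewrite (eq_bigr _ (fun k _ => row k)) sumr_const card_ord -[_ *+ n]mulr_natr; ring.
have low : (n%:R / 2) ^+ 2 * fine (mu (@gap_set R d)) <= \int[mu]_x (h x * h x).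
  rewrite -Rintegral_indic // -RintegralZl //; last first.
    by apply: bounded_mfun_integrable => //; exact: bounded_mfun_indic.
  apply: le_Rintegral_prob.
  - by apply: bounded_mfunM; [exact: bounded_mfun_cst|exact: bounded_mfun_indic].
  - exact: bounded_mfunM.
  move=> x; rewrite indicE; case: (boolP (_ \in _)) => [/set_mem xC|_]; last first.
    by rewrite mulr0 -expr2 sqr_ge0.
  rewrite mulr1 -expr2 lerXn2r ?nnegrE ?divr_ge0 ?ler0n //; last exact: hC.
  by apply: le_trans (hC x xC); rewrite divr_ge0 ?ler0n.
have := le_trans low int_h; rewrite sumE; move: (fine _) => m hm.
have h3 : 3 * n%:R <= 3 * e * n%:R ^+ 2.
  rewrite -mulrA ler_pM2l // expr2 mulrA ler_peMl ?ler0n //.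
  by rewrite mulrC -ler_pdivrMl // mulr1 ltW.
have n2 : 0 < n%:R ^+ 2 :> R by rewrite exprn_gt0.
rewrite -(ler_pM2r n2); move: hm h3 n2; rewrite exprMn; move: (n%:R ^+ 2) => N; lra.
Qed.

End GapSetNull.

(** * The hyperspace *)

Section Hyperspace.
Variables (R : realType) (d : nat).
Hypothesis d_gt0 : (0 < d)%N.
Local Notation V := 'rV[R]_d.
Local Notation T := (set_type (unit_cube R d)).
Local Notation H := (hyperspace T).

Definition body (K : H) : set V := set_val @` sval K.

Lemma body_cube K : body K `<=` unit_cube R d.
Proof. by move=> _ [x _ <-]; exact: set_valP. Qed.

Lemma body_compact K : compact (body K).
Proof.
apply: continuous_compact; last exact: (svalP K).
by apply: continuous_subspaceT; exact: initial_continuous.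
Qed.

Lemma body_closed K : closed (body K).
Proof. exact: (compact_closed (@norm_hausdorff _ _) (@body_compact K)). Qed.

Lemma open_subP (U : set T) : open U <-> exists2 W : set V, open W & U = set_val @^-1` W.
Proof. by split=> [[W oW <-]|[W oW ->]]; exists W. Qed.

Lemma subbase_open (O : set H) : vietoris_subbase O -> open O.
Proof.
move=> sO; exists [set O] => /=; last by rewrite bigcup_set1.
by move=> _ ->; exact: (finI_from1 id sO).
Qed.

Lemma open_inside (W : set V) : open W -> open [set K : H | body K `<=` W].
Proof.
move=> oW; apply: subbase_open; left; exists (set_val @^-1` (~` W)).
  rewrite -[_ @^-1` _]setCK; apply: open_closedC; apply/open_subP; exists W => //.
  by rewrite -preimage_setC setCK.
apply/seteqP; split=> K /=.
  move=> KW; apply/seteqP; split=> // x [Kx nW]; apply: nW; apply: KW; by exists x.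
by move=> K0 _ [x Kx <-]; apply: contrapT => nW; have : (sval K `&` set_val @^-1` (~` W)) x by []; rewrite K0.
Qed.

Lemma open_meets (W : set V) : open W -> open [set K : H | body K `&` W !=set0].
Proof.
move=> oW; apply: subbase_open; right; exists (set_val @^-1` W); first by apply/open_subP; exists W.
apply/seteqP; split=> K /=.
  by move=> [_ [[x Kx <-] Wx]]; exists x.
by move=> [x [Kx Wx]]; exists (set_val x); split=> //; exists x.
Qed.

Definition hclose (e : R) (A B : set V) : Prop :=
  (forall x, A x -> exists2 y, B y & `|x - y| <= e) /\
  (forall x, B x -> exists2 y, A y & `|x - y| <= e).

Lemma hclose_le e e' A B : e <= e' -> hclose e A B -> hclose e' A B.
Proof.
move=> ee' [h1 h2]; split=> x /[dup] _; [move/h1|move/h2] => -[y By xy]; exists y => //;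
  exact: le_trans ee'.
Qed.

(** The Lebesgue number of a cover with one open set. *)
Lemma compact_inside (A W : set V) : compact A -> open W -> A `<=` W ->
  exists2 e : R, 0 < e & forall x y, A x -> `|x - y| <= e -> W y.
Proof.
move=> cA oW AW.
pose B (n : nat) : set V := [set x | exists2 r : R, n.+1%:R^-1 < r & ball x r `<=` W]°.
have [N AN] : exists N, A `<=` \bigcup_(i in [set i | (i < N)%N]) B i.
  apply: compact_nat_cover => // [i|x /AW Wx]; first exact: open_interior.
  have /nbhs_ballP[r /= r0 rW] : nbhs x W by exact: open_nbhs_nbhs.
  have r2 : 0 < r / 2 by rewrite divr_gt0.
  have [n hn] := small_inv r2; exists n => //; rewrite /B /interior /=.
  apply/nbhs_ballP; exists (r / 2) => //= y xy; exists (r / 2) => // z yz; apply: rW.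
  by rewrite [r](splitr r); exact: ball_triangle yz.
exists N.+1%:R^-1; first by rewrite invr_gt0 ltr0n.
move=> x y /AN[i /= iN /interior_subset[r ir rW]] xy; apply: rW.
rewrite -ball_normE /ball_ /=; apply: le_lt_trans xy _; apply: le_lt_trans ir.
by rewrite lef_pV2 ?posrE ?ltr0n // ler_nat ltnS ltnW.
Qed.

(** The Vietoris topology is coarser than that of the Hausdorff distance, by
    compactness for the miss sets and by openness for the hit sets. *)
Lemma vietoris_hclose (O : set H) (K : H) : open O -> O K ->
  exists2 e : R, 0 < e & forall K', hclose e (body K) (body K') -> O K'.
Proof.
have sub (P : set H) : vietoris_subbase P -> P K ->
    exists2 e : R, 0 < e & forall K', hclose e (body K) (body K') -> P K'.
  move=> [[C cC ->]|[U oU ->]] /=.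
    have /open_subP[W oW CW] : open (~` C) by exact: closed_openC.
    move=> KC; have KW : body K `<=` W.
      move=> _ [x Kx <-]; have : (~` C) x by move=> Cx; have : (sval K `&` C) x by []; rewrite KC.
      by rewrite CW.
    have [e e0 he] := compact_inside (@body_compact K) oW KW.
    exists e => // K' [_ h]; apply/seteqP; split=> // x [K'x Cx].
    have /h[y Ky xy] : body K' (set_val x) by exists x.
    have : (~` C) x by rewrite CW; apply: (he _ _ Ky); rewrite distrC.
    exact.
  have /open_subP[W oW UW] := oU; move=> [x [Kx Ux]].
  have Wx : W (set_val x) by move: Ux; rewrite UW.
  have /nbhs_ballP[r /= r0 rW] : nbhs (set_val x) W by exact: open_nbhs_nbhs.
  exists (r / 2); first by rewrite divr_gt0.
  move=> K' [h _]; have /h[_ [z K'z <-] xz] : body K (set_val x) by exists x.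
  exists z; split=> //; rewrite UW; apply: rW; rewrite -ball_normE /ball_ /=.
  by apply: le_lt_trans xz _; rewrite ltr_pdivrMr // ltr_pMr // ltr1n.
move=> [D HD <-] [A DA AK]; have [F FD FA] := HD _ DA.
have fin (s : seq (set H)) : (forall P, P \in s -> vietoris_subbase P /\ P K) ->
    exists2 e : R, 0 < e & forall K', hclose e (body K) (body K') -> forall P, P \in s -> P K'.
  elim: s => [|P s IH] sP; first by exists 1.
  have [e e0 he] : exists2 e : R, 0 < e & forall K', hclose e (body K) (body K') ->
      forall Q, Q \in s -> Q K'.
    by apply: IH => Q Qs; apply: sP; rewrite inE Qs orbT.
  have [sPP PK] := sP P (mem_head _ _); have [e' e'0 he'] := sub P sPP PK.
  exists (Num.min e e'); first by rewrite lt_min e0 e'0.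
  move=> K' KK' Q; rewrite inE => /predU1P[->|Qs].
    by apply: he'; apply: hclose_le KK'; rewrite ge_min lexx orbT.
  by apply: he Qs; apply: hclose_le KK'; rewrite ge_min lexx.
have [e e0 he] : exists2 e : R, 0 < e & forall K', hclose e (body K) (body K') ->
    forall P, P \in finmap.enum_fset F -> P K'.
  apply: fin => P PF; split; first by have := FD P PF; rewrite inE.
  by have : A K by []; rewrite -FA; exact.
exists e => // K' /he h; exists A; first exact: DA.
by change (A K'); rewrite -FA => P PF; exact: h.
Qed.

Lemma vietoris_continuous (X : topologicalType) (f : X -> H) :
  (forall x (e : R), 0 < e -> \forall x' \near x, hclose e (body (f x)) (body (f x'))) ->
  continuous f.
Proof.
move=> Hf x O; rewrite nbhsE => -[Q [oQ Qx] QO].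
have [e e0 he] := vietoris_hclose oQ Qx; rewrite /= /nbhs /=.
by apply: filterS (Hf x e e0) => x' /he /QO.
Qed.

Lemma hyperspace_of (A : set V) : closed A -> A `<=` unit_cube R d ->
  exists K : H, body K = A.
Proof.
move=> cA Acube.
have cT : compact (set_val @^-1` A : set T).
  move=> F PF FA.
  have [p [Ap cp]] : A `&` cluster (set_val @ F) !=set0.
    have cA' : compact A := subclosed_compact cA (@cube_compact R d) Acube.
    exact: (cA' (set_val @ F) _ FA).
  have pc : p \in unit_cube R d by apply: mem_set; exact: Acube.
  exists (SigSub pc : T); split=> // B C FB [W [oW Wp WC]].
  have [W' oW' WW'] := oW.
  have FB' : F (set_val @^-1` (set_val @` B)) by apply: filterS FB => x Bx; exists x.
  have nW' : nbhs p W' by apply: open_nbhs_nbhs; split=> //; move: Wp; rewrite -WW'.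
  have [_ [[x Bx <-] W'x]] := cp _ W' FB' nW'; exists x; split=> //; apply: WC.
  by rewrite -WW'.
exists (exist _ _ cT); rewrite /body /=; apply/seteqP; split=> [_ [x Ax <-] //|x Ax].
have xc : x \in unit_cube R d by apply: mem_set; exact: Acube.
by exists (SigSub xc : T).
Qed.

(** * F-sigma sets *)

Lemma Fsigma_countable (X : topologicalType) (I : countType) (A : I -> set X) :
  (forall i, Fsigma (A i)) -> Fsigma (\bigcup_i A i).
Proof.
move=> fA; have : forall i, exists F : nat -> set X, (forall k, closed (F k)) /\ A i = \bigcup_k F k.
  by move=> i; have [F cF AF] := fA i; exists F.
move=> /choice[F HF]; exists (fun n => if unpickle n is Some (i, k) then F i k else set0).
  move=> n; case: (unpickle n) => [[i k]|]; [by have [cF _] := HF i|exact: closed0].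
apply/seteqP; split=> x.
  move=> [i _]; have [_ ->] := HF i; move=> [k _ Fk].
  by exists (pickle (i, k)) => //; rewrite pickleK.
move=> [n _]; case: (unpickle n) => [[i k]|] // Fk; exists i => //.
by have [_ ->] := HF i; exists k.
Qed.

Lemma FsigmaU (X : topologicalType) (A B : set X) : Fsigma A -> Fsigma B -> Fsigma (A `|` B).
Proof.
move=> fA fB; have -> : A `|` B = \bigcup_(b : bool) (if b then A else B).
  apply/seteqP; split=> [x [Ax|Bx]|x [[] _]]; [by exists true|by exists false|by left|by right].
by apply: Fsigma_countable => -[].
Qed.

Lemma Fsigma_Sigma0 (X : topologicalType) (A : set X) : Fsigma A -> Sigma0 2 A.
Proof.
move=> [F cF ->]; apply: (@Sigma0_bigcup _ 2 (fun=> 1%N)) => // i.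
by apply: Sigma0_open; exact: closed_openC.
Qed.

(** Two values differ when a rational number [q] separates them. The set [q < f] is a
    countable union of closed sets, and the trace of [g <= q] on one of these has an
    F-sigma complement, as open sets are F-sigma. *)
Lemma Pi0_eq (X : topologicalType) (f g : X -> R) :
  (forall O : set X, open O -> Fsigma O) ->
  (forall x, 0 <= f x) -> (forall x, 0 <= g x) ->
  (forall q : R, 0 <= q -> Fsigma [set x | q < f x]) ->
  (forall q : R, 0 <= q -> Fsigma [set x | q < g x]) ->
  Pi0 3 [set x | f x = g x].
Proof.
move=> FO f0 g0 Ff Fg; rewrite /Pi0.
pose fg (b : bool) := if b then f else g.
have Ffg b (q : R) : 0 <= q -> Fsigma [set x | q < fg b x] by case: b; [exact: Ff|exact: Fg].
pose qr (q : rat) : R := Num.max 0 (ratr q).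
have qr0 q : 0 <= qr q by rewrite le_max lexx.
have [D HD] : exists D : bool * rat -> nat -> set X, forall p,
    (forall i, closed (D p i)) /\ [set x | qr p.2 < fg p.1 x] = \bigcup_i D p i.
  suff /choice[D HD] : forall p : bool * rat, exists D : nat -> set X,
      (forall i, closed (D i)) /\ [set x | qr p.2 < fg p.1 x] = \bigcup_i D i by exists D.
  by move=> [b q]; have [D cD DE] := Ffg b (qr q) (qr0 q); exists D.
pose G (n : nat) : set X := if unpickle n is Some ((b, q), i) then
  D (b, q) i `&` ~` [set x | qr q < fg (~~ b) x] else set0.
have -> : ~` [set x | f x = g x] = \bigcup_n G n.
  apply/seteqP; split=> x /=.
    move=> /eqP ne; have [b hb] : exists b, fg (~~ b) x < fg b x.
      by move: ne; rewrite neq_lt => /orP[h|h]; [exists false|exists true].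
    have [q] := rat_in_itvoo hb; rewrite in_itv /= => /andP[q1 q2].
    have qE : qr q = ratr q.
      by apply/max_idPr; apply: ltW; apply: le_lt_trans q1; case: (b).
    have : [set x | qr q < fg b x] x by rewrite /= qE.
    rewrite (HD (b, q)).2 => -[i _ Di]; exists (pickle ((b, q), i)) => //.
    rewrite /G pickleK; split=> //=; rewrite qE; apply/negP; rewrite -leNgt; exact: ltW.
  move=> [n _]; rewrite /G; case: (unpickle n) => [[[b q] i]|] // [Di /=] h1 h2.
  have h3 : qr q < fg b x by have : (\bigcup_i D (b, q) i) x; [exists i|rewrite -(HD (b, q)).2].
  by apply: h1; move: h3; case: (b) => /=; rewrite h2.
apply: (@Sigma0_bigcup _ 3 (fun=> 2%N)) => // n; apply: Fsigma_Sigma0; rewrite /G.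
case: (unpickle n) => [[[b q] i]|]; last by rewrite setC0; apply: FO; exact: openT.
rewrite setCI setCK; apply: FsigmaU; last exact: Ffg.
by apply: FO; apply: closed_openC; exact: (HD (b, q)).1.
Qed.

Definition grid_box (n : nat) (k : {ffun 'I_d -> 'I_n.+2}) : set V :=
  [set x | in_box n.+1%:R^-1 (\row_i ((k i)%:R / n.+1%:R)) x].

Lemma grid_box_cover n x : unit_cube R d x -> exists k, grid_box (n := n) k x.
Proof.
move=> xc; have N0 : 0 < n.+1%:R :> R by rewrite ltr0n.
have kP i : (Num.truncn (x ord0 i * n.+1%:R) < n.+2)%N.
  have /andP[x0 x1] := xc i; rewrite ltnS truncn_le_nat; apply: (@le_lt_trans _ _ (n.+1%:R)).
    by rewrite -[leRHS]mul1r ler_pM2r.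
  by rewrite ltr_nat.
exists [ffun i => Ordinal (kP i)]; apply/forallP => i; rewrite mxE ffunE /=.
have /andP[x0 x1] := xc i; rewrite ler_pdivrMr // truncn_le ?mulr_ge0 ?(ltW N0) //=.
rewrite -[X in _ + X]mul1r -mulrDl ler_pdivlMr // natr1 ltW //; exact: truncnS_gt.
Qed.

Lemma itv_dist (a e x y : R) : a <= x <= a + e -> a <= y <= a + e -> `|x - y| <= e.
Proof.
by move=> /andP[h1 h2] /andP[h3 h4]; rewrite ler_norml; apply/andP; split; lra.
Qed.

Lemma grid_box_small n k x y : grid_box (n := n) k x -> grid_box k y -> `|x - y| <= n.+1%:R^-1.
Proof.
move=> /forallP hx /forallP hy; apply: norm_le_coord => [|i]; first by rewrite invr_ge0 ler0n.
by rewrite !mxE; exact: itv_dist (hx i) (hy i).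
Qed.

(** For every grid there are finitely many closed sets [W], each prescribing which
    boxes of the grid are met; two elements of [W] are within the mesh for the
    Hausdorff distance. An open set is the union of the sets [W] that it contains. *)
Lemma hyperspace_open_Fsigma (O : set H) : open O -> Fsigma O.
Proof.
move=> oO; pose I := {n : nat & {set {ffun 'I_d -> 'I_n.+2}}}.
pose W (i : I) : set H := [set K | body K `<=` [set x | exists2 k, k \in tagged i & grid_box k x]]
  `&` [set K | forall k, k \in tagged i -> body K `&` grid_box k !=set0].
have cB n k : closed (grid_box (n := n) k) by exact: closed_box.
have cW i : closed (W i).
  case: i => n sg; apply: closedI.
    rewrite -[X in closed X]setCK; apply: open_closedC.
    rewrite (_ : ~` _ = [set K : H | body K `&` ~` [set x | exists2 k, k \in sg & grid_box k x] !=set0]).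
      apply: open_meets; apply: closed_openC.
      rewrite (_ : [set x | _] = \bigcup_(k in [set` sg]) grid_box k).
        by apply: closed_bigcup; [exact: finite_finset|].
      by apply/seteqP; split=> x [k ks kx]; exists k.
    apply/seteqP; split=> K /=; first by move=> /existsNP[x /not_implyP[Kx nx]]; exists x.
    by move=> [x [Kx nx]] KW; apply: nx; exact: KW.
  rewrite (_ : [set K : H | _] = \bigcap_(k in [set` sg]) [set K : H | body K `&` grid_box k !=set0]).
    apply: closed_bigI => k _; rewrite -[X in closed X]setCK; apply: open_closedC.
    rewrite (_ : ~` _ = [set K : H | body K `<=` ~` grid_box k]).
      by apply: open_inside; exact: closed_openC.
    apply/seteqP; split=> K /=; first by move=> nK x Kx kx; apply: nK; exists x.
    by move=> KW [x [Kx kx]]; exact: KW Kx kx.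
  by apply/seteqP; split=> K h k ks; exact: h.
have -> : O = \bigcup_(i : I) (if `[< W i `<=` O >] then W i else set0).
  apply/seteqP; split=> [K OK|K [i _]]; last by case: asboolP => // WO /WO.
  have [e e0 he] := vietoris_hclose oO OK; have [n hn] := small_inv e0.
  pose sg : {set {ffun 'I_d -> 'I_n.+2}} := [set k | `[< body K `&` grid_box k !=set0 >]]%SET.
  exists (Tagged (fun n => {set {ffun 'I_d -> 'I_n.+2}}) sg) => //.
  have WK : W (Tagged (fun n => {set {ffun 'I_d -> 'I_n.+2}}) sg) K.
    split=> /=; last by move=> k; rewrite inE => /asboolP.
    move=> x Kx; have [k kx] := grid_box_cover n (body_cube Kx); exists k => //.
    by rewrite inE; apply/asboolP; exists x.
  case: asboolP => // nW; exfalso; apply: nW => K' [/= h1 h2]; apply: he; split=> x Kx.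
    have [k kx] := grid_box_cover n (body_cube Kx).
    have [|y [Ky ky]] := h2 k; first by rewrite inE; apply/asboolP; exists x.
    by exists y => //; apply: le_trans (grid_box_small kx ky) (ltW hn).
  have [k ks kx] := h1 _ Kx; move: ks; rewrite inE => /asboolP[y [Ky ky]].
  by exists y => //; apply: le_trans (grid_box_small kx ky) (ltW hn).
by apply: Fsigma_countable => i; apply: closed_Fsigma; case: asboolP => _ //; exact: closed0.
Qed.

Lemma open_near (O : set H) : (forall K, O K -> exists2 Q, open Q /\ Q K & Q `<=` O) -> open O.
Proof.
move=> h; rewrite openE => K /h[Q [oQ QK] QO]; apply: filterS QO _.
exact: open_nbhs_nbhs.
Qed.

(** * Superlevel sets of the Hausdorff dimension *)

(** A cover of [K] of weight less than [e] can be enlarged to an open cover of weight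
    less than [e], which is also a cover of the compact sets close to [K]. *)
Lemma closed_content (s e : R) : 0 < s -> closed [set K : H | content_ge s e (body K)].
Proof.
move=> s0; rewrite -[X in closed X]setCK; apply: open_closedC; apply: open_near => K /=.
move=> /existsNP[U /not_implyP[KU /negP]]; rewrite -ltNge => small.
set S := (\sum_(0 <= i <oo) diam_pow s (U i))%E in small.
have S0 : (0 <= S)%E by apply: nneseries_ge0 => i _ _; exact: diam_pow_ge0.
have fin : (S < +oo)%E by apply: lt_trans small _; exact: ltry.
have [r rS] : exists r : R, S = r%:E by exists (fine S); rewrite fineK // ge0_fin_numE.
have re : 0 < (e - r) / 2 by move: small; rewrite rS lte_fin => re; rewrite divr_gt0 // subr_gt0.
have [W [t [oW UW t0 Wt Ht]]] := enlarge_cover d_gt0 s0 re fin.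
exists [set K : H | body K `<=` \bigcup_i W i].
  split; first by apply: open_inside; apply: bigcup_open => i _; exact: oW.
  by move=> x /KU[i _ Ui]; exists i => //; exact: UW.
move=> K' KW /(_ W KW); apply/negP; rewrite -ltNge.
apply: (@le_lt_trans _ _ (\sum_(0 <= i <oo) (t i `^ s)%:E)%E).
  apply: lee_nneseries => [i _ _|i _]; first exact: diam_pow_ge0.
  by apply: diam_pow_le; [exact: ltW|exact: Wt].
apply: (le_lt_trans Ht); rewrite -/S rS -EFinD lte_fin; move: re; lra.
Qed.

Lemma hausdorff_dim_Fsigma (p : R) : 0 <= p -> Fsigma [set K : H | p < hausdorff_dim (body K)].
Proof.
move=> p0; exists (fun n => [set K : H | content_ge (p + n.+1%:R^-1) n.+1%:R^-1 (body K)]).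
  by move=> n; apply: closed_content; rewrite ltr_wpDl // invr_gt0 ltr0n.
apply/seteqP; split=> K /=.
  by move/(hausdorff_dim_gtP d_gt0 (@body_cube K) p0) => [n h]; exists n.
by move=> [n _ h]; apply/(hausdorff_dim_gtP d_gt0 (@body_cube K) p0); exists n.
Qed.

(** * Superlevel sets of the Fourier dimension *)

Local Notation BV := (borel_rV R d).

Lemma support_full (mu : probability BV R) (A : set V) : measurable (A : set BV) ->
  msupport mu `<=` A -> mu A = 1%E.
Proof.
move=> mA sA; have mN : measurable (~` msupport mu : set BV).
  apply: open_borel; rewrite openE => x /existsNP[U /not_implyP[oU /not_implyP[Ux U0]]].
  apply: filterS (open_nbhs_nbhs (conj oU Ux)) => y Uy /(_ U oU Uy) h; exact: (U0 h).
have h : mu (~` A) = 0%E.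
  apply/eqP; rewrite eq_le measure_ge0 andbT -(msupport_compl_null mu).
  by apply: le_measure; rewrite ?inE //; [exact: measurableC|exact: subsetC].
by rewrite -[A]setCK probability_setC ?h ?sube0 //; exact: measurableC.
Qed.

Definition carries (c s : R) (A : set V) : Prop :=
  exists mu : probability BV R, msupport mu `<=` A /\ fourier_decay mu c s.

(** Along an ultrafilter of compact sets converging to [K], choose measures and take
    their weak limit: the decay passes to the limit because [c] is fixed, and a ball
    outside of [K] is eventually outside of the supports. *)
Lemma closed_carries (c s : R) : closed [set K : H | carries c s (body K)].
Proof.
move=> K clK.
have nuP (L : H) : exists mu : probability BV R, mu (unit_cube R d) = 1%E /\
    (carries c s (body L) -> msupport mu `<=` body L /\ fourier_decay mu c s).
  have [[mu [smu dmu]]|nc] := pselect (carries c s (body L)).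
    exists mu; split=> // ; apply: support_full; first exact: measurable_cube.
    by move=> x /smu; exact: body_cube.
  exists (cloud_prob (0 : V) [::]); split=> //; apply: cloud_prob_full => x.
  by rewrite mem_seq1 => /eqP -> i; rewrite mxE lexx ler01.
have [nu hnu] := choice nuP.
pose G := within [set L : H | carries c s (body L)] (nbhs K).
have PG : ProperFilter G.
  split; last exact: within_filter.
  rewrite /G /within /= => h; have [L [cL]] := clK _ h; exact.
have [U [UU GU]] := @ultraFilterLemma H G PG.
have [mu lim] := weak_limit d_gt0 UU (fun L => (hnu L).1).
have UC : U [set L : H | carries c s (body L)] by apply: GU; exact: withinT.
have Uopen (Q : set H) : open Q -> Q K -> U Q.
  move=> oQ QK; apply: GU; rewrite /G /within /=.
  by apply: filterS (open_nbhs_nbhs (conj oQ QK)).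
have FU := @ultra_proper _ _ UU.
have c0 : 0 < c.
  by have [L [? [_ []]]] := filter_ex UC.
exists mu; split.
  move=> y ys; apply: contrapT => nKy.
  have oN : open (~` body K) by apply: closed_openC; exact: body_closed.
  have /nbhs_ballP[r /= r0 rK] : nbhs y (~` body K) by exact: open_nbhs_nbhs.
  have r2 : 0 < r / 2 by rewrite divr_gt0.
  apply: (limit_support UU lim r2 _ ys).
  have Uin : U [set L : H | body L `<=` ~` [set x | `|x - y| <= r / 2]].
    apply: Uopen.
      apply: open_inside; apply: closed_openC.
      rewrite (_ : [set x | _] = (fun x : V => `|x - y|) @^-1` [set t | t <= r / 2]) //.
      apply: closed_comp; last exact: closed_le.
      move=> x _; apply: (@lip_continuous _ _ (fun x : V => `|x - y|) 1) => u v.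
      rewrite mul1r; apply: (le_trans (ler_dist_dist _ _)).
      by have -> : u - y - (v - y) = u - v by rewrite opprB addrA subrK.
    move=> x Kx xy; apply: (rK x) => //; rewrite -ball_normE /ball_ /= distrC.
    by apply: le_lt_trans xy _; rewrite ltr_pdivrMr // ltr_pMr // ltr1n.
  apply: filterS (filterI UC Uin) => L [cL Lout] /=.
  have [sL _] := (hnu L).2 cL.
  have mb : measurable (ball y (r / 2) : set BV) by apply: open_borel; exact: ball_open.
  have full : nu L (~` ball y (r / 2)) = 1%E.
    apply: support_full; first exact: measurableC.
    move=> x /sL/Lout nx bx; apply: nx; move: bx; rewrite -ball_normE /ball_ /= distrC; exact: ltW.
  by rewrite -[ball y _]setCK probability_setC ?full ?subee //; exact: measurableC.
split=> // xi xi0; set b := c * _.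
have b0 : 0 <= b by rewrite mulr_ge0 ?powR_ge0 // ltW.
have lc := @limit_cosint _ _ _ _ _ _ lim xi.
have ls := @limit_sinint _ _ _ _ _ _ lim xi.
have l2 : cosint (nu L) xi * cosint (nu L) xi + sinint (nu L) xi * sinint (nu L) xi @[L --> U] -->
    cosint mu xi * cosint mu xi + sinint mu xi * sinint mu xi.
  by apply: cvgD; [exact: (cvgM lc lc)|exact: (cvgM ls ls)].
have h : `|cosint mu xi * cosint mu xi + sinint mu xi * sinint mu xi| <= b ^+ 2.
  apply: (limit_le UU l2); apply: filterS UC => L cL /=.
  have [_ [_ /(_ xi xi0)]] := (hnu L).2 cL; rewrite normc_fourier -/b => hb.
  rewrite -!expr2 ger0_norm ?addr_ge0 ?sqr_ge0 //.
  by rewrite -[leLHS]sqr_sqrtr ?addr_ge0 ?sqr_ge0 // lerXn2r ?nnegrE ?sqrtr_ge0.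
rewrite normc_fourier -(ger0_norm b0) -sqrtr_sqr ler_wsqrtr // !expr2.
by apply: le_trans (ler_norm _) _; rewrite -expr2.
Qed.

Lemma fourier_dim_bounded (A : set V) : ubound [set s : R | 0 <= s <= d%:R /\
    exists mu : probability BV R, msupport mu `<=` A /\
    exists c : R, 0 < c /\ forall x : V, x != 0 ->
      ComplexField.Normc.normc (fourier mu x) <= c * enorm x `^ (- s / 2)] d%:R.
Proof. by move=> s [/andP[]]. Qed.

Lemma fourier_dim_ge0 (A : set V) : 0 <= fourier_dim A.
Proof.
rewrite /fourier_dim; set S := (X in sup X); have ub : ubound S d%:R := @fourier_dim_bounded A.
have [->|/set0P[s Ss]] := eqVneq S set0; first by rewrite sup0.
have [/andP[s0 _] _] := Ss.
by apply: le_trans s0 _; apply: ub_le_sup => //; exists d%:R.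
Qed.

Lemma fourier_dim_le (A : set V) : fourier_dim A <= d%:R.
Proof.
rewrite /fourier_dim; set S := (X in sup X); have ub : ubound S d%:R := @fourier_dim_bounded A.
have [->|/set0P S0] := eqVneq S set0; first by rewrite sup0.
exact: ge_sup.
Qed.

Lemma fourier_dim_gtP (A : set V) (p : R) : 0 <= p ->
  p < fourier_dim A <-> exists2 n, p + n.+1%:R^-1 <= d%:R & carries n.+1%:R (p + n.+1%:R^-1) A.
Proof.
move=> p0; rewrite /fourier_dim; set S := (X in sup X).
have ub : ubound S d%:R := @fourier_dim_bounded A.
split=> [pS|[n nd [mu [sA [c0 dec]]]]].
  have S0 : S !=set0.
    by apply/set0P/eqP => S0; move: pS; rewrite S0 sup0 => /(le_lt_trans p0); rewrite ltxx.
  have [s [/andP[s0 sd] [mu [sA [c cdec]]]] ps] := sup_gt S0 pS.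
  have sp : 0 < s - p by rewrite subr_gt0.
  have [n1 hn1] := small_inv sp; pose n := maxn n1 (Num.truncn (c + 2)).+1.
  have ns : n.+1%:R^-1 < s - p.
    apply: le_lt_trans hn1; rewrite lef_pV2 ?posrE ?ltr0n // ler_nat ltnS; exact: leq_maxl.
  have nn : 0 < n.+1%:R^-1 :> R by rewrite invr_gt0 ltr0n.
  exists n; first by move: ns sd; move: (n.+1%:R^-1) => u; lra.
  exists mu; split=> //.
  have hs : 0 <= p + n.+1%:R^-1 <= s.
    by move: ns nn; move: (n.+1%:R^-1) => u *; apply/andP; split; lra.
  have [c2 dec] := fourier_decay_weaken hs cdec; split; first by rewrite ltr0n.
  move=> x /dec; move/le_trans; apply; rewrite ler_wpM2r ?powR_ge0 //.
  apply: ltW; apply: (lt_le_trans (truncnS_gt _)); rewrite ler_nat.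
  by apply: leqW; exact: leq_maxr.
have nn : 0 < n.+1%:R^-1 :> R by rewrite invr_gt0 ltr0n.
apply: (@lt_le_trans _ _ (p + n.+1%:R^-1)); first by rewrite ltrDl.
apply: ub_le_sup; first by exists d%:R.
split; first by rewrite nd addr_ge0 // ltW.
by exists mu; split=> //; exists n.+1%:R.
Qed.

Lemma fourier_dim_Fsigma (p : R) : 0 <= p -> Fsigma [set K : H | p < fourier_dim (body K)].
Proof.
move=> p0; exists (fun n => if p + n.+1%:R^-1 <= d%:R
    then [set K : H | carries n.+1%:R (p + n.+1%:R^-1) (body K)] else set0).
  by move=> n; case: ifP => _; [exact: closed_carries|exact: closed0].
apply/seteqP; split=> K /=.
  by move/(fourier_dim_gtP _ p0) => [n nd h]; exists n => //; rewrite nd.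
by move=> [n _]; case: ifP => // nd h; apply/(fourier_dim_gtP _ p0); exists n.
Qed.

Lemma salem_Pi0 : Pi0 3 (salem_sets R d).
Proof.
apply: (@Pi0_eq H (fun K => hausdorff_dim (body K)) (fun K => fourier_dim (body K))).
- exact: hyperspace_open_Fsigma.
- by move=> K; apply: hausdorff_dim_ge0 => //; exact: body_cube.
- by move=> K; exact: fourier_dim_ge0.
- exact: hausdorff_dim_Fsigma.
- exact: fourier_dim_Fsigma.
Qed.

End Hyperspace.

(** * Bits describing Pi^0_3 sets of zero-dimensional Polish spaces *)

Section Counter.
Variables (X : topologicalType).

Definition locally_constant (T : Type) (f : X -> T) : Prop :=
  forall x, \forall x' \near x, f x' = f x.

Lemma clopen_locally_constant (U : set X) : clopen U -> locally_constant (fun x => `[< U x >]).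
Proof.
move=> [oU cU] x; have [Ux|nU] := pselect (U x).
  apply: filterS (open_nbhs_nbhs (conj oU Ux)) => x' Ux'.
  by rewrite !asboolT.
apply: filterS (open_nbhs_nbhs (conj (closed_openC cU) nU)) => x' nU'.
by rewrite !asboolF.
Qed.

Lemma locally_constant_app (T S : Type) (f : X -> T) (g : T -> X -> S) :
  locally_constant f -> (forall t, locally_constant (g t)) -> locally_constant (fun x => g (f x) x).
Proof. by move=> hf hg x; apply: filterS2 (hf x) (hg (f x) x) => x' /= -> ->. Qed.

Lemma locally_constant_exists (I : finType) (f : I -> X -> bool) :
  (forall i, locally_constant (f i)) -> locally_constant (fun x => [exists i, f i x]).
Proof.
move=> hf x; apply: filterS (filter_forall (nbhs_filter x) (fun i => hf i x)) => x' h.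
by apply: eq_existsb => i; exact: h.
Qed.

Variable U : nat -> nat -> set X.
Hypothesis clopenU' : forall i j, clopen (U i j).

Definition refuted (i n : nat) (x : X) : bool := [exists j : 'I_n.+1, `[< U i j x >]].

Fixpoint candidate (n : nat) (x : X) : nat :=
  if n is n'.+1 then (candidate n' x + refuted (candidate n' x) n' x)%N else 0%N.

(** The automaton looking for an index [i] with [x] outside all the [U i j]: the
    current candidate is dropped when it is refuted, which raises the bit. *)
Definition drop_bit (n : nat) (x : X) : bool := refuted (candidate n x) n x.

Lemma refuted_lc i n : locally_constant (refuted i n).
Proof. by apply: locally_constant_exists => j; exact: clopen_locally_constant. Qed.

Lemma candidate_lc n : locally_constant (candidate n).
Proof.
elim: n => [|n IH]; first by move=> x; exact: nearW.
apply: (locally_constant_app (g := fun i x => (i + refuted i n x)%N)) => // i x.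
by apply: filterS (refuted_lc i n x) => x' ->.
Qed.

Lemma drop_bit_lc n : locally_constant (drop_bit n).
Proof.
apply: (locally_constant_app (g := fun i x => refuted i n x)); first exact: candidate_lc.
by move=> i; exact: refuted_lc.
Qed.

(** The candidate never passes an index that works. If it stabilizes, it is never
    refuted by the sets [U i j] with larger and larger [j], so it works. *)
Lemma drop_bitP x : (\bigcup_i ~` (\bigcup_j U i j)) x <->
  exists n0, forall n, (n0 <= n)%N -> ~~ drop_bit n x.
Proof.
split=> [[i _ nU]|[n0 h]]; last first.
  have cE n : (n0 <= n)%N -> candidate n x = candidate n0 x.
    elim: n => [|n IH]; first by rewrite leqn0 => /eqP ->.
    rewrite leq_eqVlt => /predU1P[->//|]; rewrite ltnS => n0n /=.
    by have := h n n0n; rewrite /drop_bit => /negbTE ->; rewrite addn0 IH.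
  exists (candidate n0 x) => // -[j _ Uj].
  have := h (maxn n0 j) (leq_maxl _ _); rewrite /drop_bit cE ?leq_maxl //.
  move/existsP; apply; have jn : (j < (maxn n0 j).+1)%N by rewrite ltnS leq_maxr.
  by exists (Ordinal jn); apply/asboolP.
have nr n : ~~ refuted i n x.
  by apply/existsP => -[j /asboolP Uj]; apply: nU; exists j.
have ci n : (candidate n x <= i)%N.
  elim: n => //= n; rewrite leq_eqVlt => /predU1P[->|ci].
    by rewrite (negbTE (nr n)) addn0.
  by apply: leq_trans ci; rewrite -addn1 leq_add2l leq_b1.
apply: contrapT => /forallNP often.
have big m : exists n, (m <= candidate n x)%N.
  elim: m => [|m [n mn]]; first by exists 0%N.
  have /existsNP[k /not_implyP[nk /negP/negPn dk]] := often n.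
  exists k.+1 => /=; rewrite -/(drop_bit k x) dk addn1 ltnS; apply: leq_trans mn _.
  elim: k nk {dk} => [|k IH]; first by rewrite leqn0 => /eqP ->.
  rewrite leq_eqVlt => /predU1P[->//|]; rewrite ltnS => /IH h /=.
  by apply: leq_trans h _; exact: leq_addr.
by have [n] := big i.+1; rewrite ltnNge ci.
Qed.

End Counter.

Section Bits.
Variables (R : realType) (X : topologicalType).
Hypotheses (polX : polish R X) (basX : has_clopen_basis X).

(** For every small ball around a point of a countable dense set, one clopen set between
    this ball and [O] is chosen, if there is one. *)
Lemma open_countable_clopen (O : set X) : open O ->
  exists2 U : nat -> set X, (forall n, clopen (U n)) & O = \bigcup_n U n.
Proof.
move=> oO; have [[D /countable_injP[f injf] dD] [M _ [h [g [ch cg hK gK]]]]] := polX.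
have [B [Bopen Bbase] Bclopen] := basX.
pose good (p : nat * nat) (U : set X) := [/\ clopen U, U `<=` O &
  exists x, [/\ D x, f x = p.1 & h @^-1` ball (h x) (p.2.+1%:R^-1 : R) `<=` U]].
pose W p : set X := xget set0 (good p).
have Wclopen p : clopen (W p).
  by rewrite /W; case: xgetP => [U -> []//|_]; exact: clopen0.
have WO p : W p `<=` O by rewrite /W; case: xgetP => [U -> []//|_].
exists (fun n => if unpickle n is Some p then W p else set0).
  by move=> n; case: (unpickle n) => // *; exact: clopen0.
apply/seteqP; split=> [y Oy|y [n _]]; last by case: (unpickle n) => // p; exact: WO.
have [U [BU Uy] UO] : exists2 U, B U /\ U y & U `<=` O.
  by have [U [BU Uy] UO] := Bbase y O (open_nbhs_nbhs (conj oO Oy)); exists U.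
have /cg/nbhs_ballP[r /= r0 rU] : nbhs (g (h y)) U.
  by rewrite hK; apply: open_nbhs_nbhs; split=> //; exact: Bopen.
have r2 : 0 < r / 2 by rewrite divr_gt0.
have [k hk] := small_inv r2.
have k0 : 0 < k.+1%:R^-1 :> R by rewrite invr_gt0 ltr0n.
have [x [xy Dx]] : (h @^-1` (ball (h y) k.+1%:R^-1)°) `&` D !=set0.
  apply: dD; first by exists y; apply: nbhsx_ballx.
  by apply: open_comp => [z _|]; [exact: ch|exact: open_interior].
have {}xy : ball (h y) k.+1%:R^-1 (h x) by exact: interior_subset xy.
have gU : good (f x, k) U.
  split=> //; first exact: Bclopen.
  exists x; split=> // z /= xz; rewrite -(hK z); apply: rU.
  rewrite [r](splitr r); apply: ball_triangle (le_ball (ltW hk) xy) _.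
  exact: le_ball (ltW hk) _ xz.
have [_ _ [x' [Dx' fx' Wx']]] := xgetPex set0 (ex_intro _ U gU).
exists (pickle (f x, k)) => //; rewrite pickleK; apply: Wx' => /=.
have -> : x' = x by apply: injf => //; exact: mem_set.
exact: ball_sym.
Qed.

Lemma Sigma0_low_Fsigma n (B : set X) : Sigma0 n B -> (n < 3)%N -> Fsigma B.
Proof.
case=> {n B} [B /open_countable_clopen[U cU ->] _|n eta F n1 en FF n3].
  by exists U => // i; have [] := cU i.
exists F => // i; rewrite -[F i]setCK; apply: open_closedC.
have := FF i; have : (eta i < 2)%N by apply: leq_trans (en i) _; rewrite -ltnS.
move: (eta i) (~` F i) => e A e2 SA; case: SA e2 => // m eta' F' m1 _ _ m2.
by move: m2; rewrite ltnNge m1.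
Qed.

Lemma Fsigma_bits (B : set X) : Fsigma B -> exists b : nat -> X -> bool,
  (forall n, locally_constant (b n)) /\
  forall x, B x <-> exists n0, forall n, (n0 <= n)%N -> ~~ b n x.
Proof.
move=> [F cF ->].
have /choice[U HU] : forall i, exists U : nat -> set X,
    (forall j, clopen (U j)) /\ ~` F i = \bigcup_j U j.
  by move=> i; have [U cU FU] := open_countable_clopen (closed_openC (cF i)); exists U.
exists (drop_bit U); split=> [n|x].
  by apply: drop_bit_lc => i j; exact: (HU i).1.
rewrite -(drop_bitP U); suff -> : \bigcup_i F i = \bigcup_i ~` \bigcup_j U i j by [].
by apply: eq_bigcupr => i _; rewrite -(HU i).2 setCK.
Qed.

Lemma Pi0_3_bits (A : set X) : Pi0 3 A -> exists b : nat -> nat -> X -> bool,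
  (forall m n, locally_constant (b m n)) /\
  forall x, A x <-> forall m, exists n0, forall n, (n0 <= n)%N -> ~~ b m n x.
Proof.
rewrite /Pi0 => SA.
have [F FF AF] : exists2 F : nat -> set X, (forall i, Fsigma (~` F i)) & ~` A = \bigcup_i F i.
  move: SA; move: (~` A) => B; move E : 3%N => n SB; case: SB E => {n B} [B _ []//|n eta F _ en FF n3].
  by exists F => // i; apply: Sigma0_low_Fsigma (FF i) _; rewrite n3; exact: en.
have /choice[b hb] := fun i => Fsigma_bits (FF i).
exists b; split=> [m|x]; first exact: (hb m).1.
have -> : A = \bigcap_i ~` F i by rewrite -setC_bigcup -AF setCK.
by split=> [h m|h m _]; apply/(hb m).2; [exact: h|exact: h].
Qed.

End Bits.

(** * The reduction *)

Section Reduction.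
Variables (R : realType) (d : nat).
Hypothesis d_gt0 : (0 < d)%N.
Local Notation V := 'rV[R]_d.
Local Notation BV := (borel_rV R d).
Local Notation T := (set_type (unit_cube R d)).
Local Notation H := (hyperspace T).

(** The parameters of the [m]-th piece make its Fourier dimension tend to [d] and its
    diameter to zero. *)
Definition piece (m : nat) (r : nat -> bool) : set V := @tree_set R d m.+3 m.+1 r.

Definition coded (r : nat -> nat -> bool) : set V :=
  @gap_set R d `|` \bigcup_m piece m (r m).

Lemma piece_norm m r x : piece m r x -> `|x| <= m.+1%:R^-1.
Proof.
move=> px; apply: norm_le_coord => [|i]; first by rewrite invr_ge0 ler0n.
have /andP[x0 x1] := tree_set_box (J := m.+3) (m0 := m.+1) d_gt0 isT isT i px.
by rewrite ger0_norm.
Qed.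

Lemma piece_cube m r : piece m r `<=` unit_cube R d.
Proof.
move=> x px i; have /andP[x0 x1] := tree_set_box (J := m.+3) (m0 := m.+1) d_gt0 isT isT i px.
by rewrite x0 (le_trans x1) // invf_le1 ?ltr0n // ler1n.
Qed.

Lemma closed_piece m r : closed (piece m r).
Proof. exact: (@closed_tree_set R d m.+3 m.+1 d_gt0 isT isT r). Qed.

Lemma coded_cube r : coded r `<=` unit_cube R d.
Proof. by move=> x [[]//|[m _ /piece_cube]]. Qed.

Lemma closed_norm_le (e : R) : closed [set x : V | `|x| <= e].
Proof.
rewrite (_ : [set x | _] = (fun x : V => `|x|) @^-1` [set t | t <= e]) //.
apply: closed_comp; last exact: closed_le.
move=> x _; apply: (@lip_continuous _ _ (fun x : V => `|x|) 1) => u v.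
by rewrite mul1r; exact: ler_dist_dist.
Qed.

(** Away from the origin, which lies in the gap set, the union is finite. *)
Lemma closed_coded r : closed (coded r).
Proof.
have -> : coded r = \bigcap_M (@gap_set R d `|`
    (\bigcup_(m in [set m | (m < M)%N]) piece m (r m) `|` [set x : V | `|x| <= M.+1%:R^-1])).
  apply/seteqP; split=> x.
    move=> [xC|[m _ px]] M _; first by left.
    have [mM|Mm] := ltnP m M; first by right; left; exists m.
    right; right => /=; apply: (le_trans (piece_norm px)).
    by rewrite lef_pV2 ?posrE ?ltr0n // ler_nat ltnS.
  move=> h; have [[m px]|nx] := pselect (exists m, piece m (r m) x); first by right; exists m.
  left; have [xC|nC] := pselect (gap_set x) => //.
  suff -> : x = 0 by exact: zero_gap_set.
  apply/eqP; rewrite -normr_le0; apply/ler_addgt0Pr => e e0; rewrite add0r.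
  have [M hM] := small_inv e0; have [//|[[m _ px]|/= xM]] := h M I.
    by exfalso; apply: nx; exists m.
  exact: le_trans xM (ltW hM).
apply: closed_bigI => M _; apply: closedU; first exact: closed_gap_set.
apply: closedU; last exact: closed_norm_le.
by apply: closed_bigcup => [|m _]; [exact: finite_II|exact: closed_piece].
Qed.

(** The pieces after [N] are within [1 / (N + 1)] of the origin. *)
Lemma coded_uniform (r r' : nat -> nat -> bool) N :
  (forall m n, (m <= N)%N -> (n <= N)%N -> r m n = r' m n) ->
  forall x, coded r x -> exists2 y, coded r' y & `|x - y| <= N.+1%:R^-1.
Proof.
move=> rr' x [xC|[m _ px]].
  by exists x; [left|rewrite subrr normr0 invr_ge0 ler0n].
have [mN|Nm] := leqP m N.
  have [y py xy] := @tree_set_uniform R d m.+3 m.+1 d_gt0 isT isT (r m) (r' m) N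
    (fun n nN => rr' m n mN nN) x px.
  by exists y => //; right; exists m.
exists 0; first by left; exact: zero_gap_set.
rewrite subr0; apply: (le_trans (piece_norm px)).
by rewrite lef_pV2 ?posrE ?ltr0n // ler_nat ltnS ltnW.
Qed.

Lemma coded_dim r : hausdorff_dim (coded r) = d%:R.
Proof.
apply: hausdorff_dim_full => //; first exact: coded_cube.
move=> s s0d; have [e e0 he] := gap_set_content d_gt0 s0d; exists e => //.
by apply: content_ge_sub he; left.
Qed.

Lemma two_beta m : 2 * beta R d m.+3 = d%:R - d.+1%:R / m.+3%:R.
Proof.
rewrite /beta /rank natrM -subnDA addn1 natrB; last by nia.
rewrite natrM; have : m.+3%:R != 0 :> R by rewrite pnatr_eq0.
move: (m.+3%:R) (d.+1%:R) (d%:R) => x y z x0; field; exact: x0.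
Qed.

(** The pieces carry measures whose decay exponents [2 beta] tend to [d]. *)
Lemma coded_salem r : (forall m, exists n0, forall n, (n0 <= n)%N -> ~~ r m n) ->
  salem (coded r).
Proof.
move=> fin; rewrite /salem coded_dim.
pose S := [set s : R | 0 <= s <= d%:R /\
    exists mu : probability BV R, msupport mu `<=` coded r /\
    exists c : R, 0 < c /\ forall x : V, x != 0 ->
      ComplexField.Normc.normc (fourier mu x) <= c * enorm x `^ (- s / 2)].
have ub : ubound S d%:R := @fourier_dim_bounded R d (coded r).
have low m : 2 * beta R d m.+3 <= fourier_dim (coded r).
  have [k0 hk] := fin m.
  have [mu [c [smu dec]]] := @tree_measure R d m.+3 m.+1 d_gt0 isT isT (r m) k0 hk.
  apply: ub_le_sup; first by exists d%:R.
  split.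
    rewrite mulr_ge0 ?(ltW (beta_gt0 R d_gt0 _)) //= two_beta lerBlDr lerDl.
    by rewrite divr_ge0 ?ler0n.
  by exists mu; split; [move=> x /smu px; right; exists m|exists c].
apply/eqP; rewrite eq_le fourier_dim_le andbT.
apply/ler_addgt0Pr => e e0; have d1 : 0 < d.+1%:R :> R by rewrite ltr0n.
have [m] := small_inv (divr_gt0 e0 d1); rewrite ltr_pdivlMr // => hm.
have := low m; rewrite two_beta => h; rewrite -lerBlDr; apply: le_trans h; rewrite lerD2l lerN2.
apply: le_trans (ltW hm); rewrite mulrC ler_pM2r //.
by rewrite lef_pV2 ?posrE ?ltr0n // ler_nat; lia.
Qed.

Lemma box_exponent_mono J J' : (2 < J)%N -> (J <= J')%N ->
  box_exponent R d J <= box_exponent R d J'.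
Proof.
move=> J2 JJ'; rewrite /box_exponent lerD2l lerN2 ler_wpM2l ?ler0n //.
by rewrite lef_pV2 ?posrE ?ltr0n ?ler_nat; lia.
Qed.

Lemma box_exponent_lt J : (2 < J)%N -> 0 <= box_exponent R d J < d%:R.
Proof.
move=> J2; have J0 : 0 < (2 * J - 1)%:R :> R by rewrite ltr0n; lia.
rewrite /box_exponent subr_ge0 ler_pdivrMr // -natrM ler_nat leq_pmulr; last by lia.
by rewrite ltrBlDr ltrDl divr_gt0 // ltr0n.
Qed.

(** A measure on the coded set with a decay beyond the box exponent of the piece [M]
    charges none of the pieces: the first ones by their box exponents, which increase
    with the index, and the others since their rows are infinite. *)
Lemma coded_not_salem (r : nat -> nat -> bool) M :
  (forall m, (M <= m)%N -> forall n0, exists2 n, (n0 <= n)%N & r m n) -> ~ salem (coded r).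
Proof.
move=> inf; rewrite /salem coded_dim => dE.
have /andP[q0 qd] := @box_exponent_lt M.+3 isT; set q := box_exponent R d M.+3 in q0 qd.
pose s := (q + d%:R) / 2.
have [sq sd] : q < s /\ s < d%:R by rewrite /s; split; lra.
have s0 : 0 < s by exact: le_lt_trans sq.
have s0d : 0 < s < d%:R by rewrite s0.
have : s < fourier_dim (coded r) by rewrite -dE.
move/(fourier_dim_gtP _ (ltW s0)) => [n _ [mu [smu dec0]]].
have [c dec] : exists c, fourier_decay mu c s.
  exists (n.+1%:R + 2); apply: fourier_decay_weaken dec0.
  by rewrite (ltW s0) lerDl invr_ge0 ler0n.
have mK : measurable (coded r : set BV) by apply: closed_borel; exact: closed_coded.
have full := support_full mK smu.
suff : mu (coded r) = 0%E by rewrite full => /eqP; rewrite eqe oner_eq0.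
apply/(negligibleP _ mK); apply: negligibleU.
  apply/negligibleP; first by apply: closed_borel; exact: closed_gap_set.
  exact: gap_set_null dec.
apply: negligible_bigcup => m.
apply/negligibleP; first by apply: closed_borel; exact: closed_piece.
have [mM|Mm] := ltnP m M.
  apply: (@tree_null R d m.+3 m.+1 d_gt0 isT isT mu c s) => //; apply: le_lt_trans sq.
  by apply: box_exponent_mono => //; rewrite !ltnS ltnW.
exact: (@tree_null_often R d m.+3 m.+1 d_gt0 isT isT mu c s (r m) s0d dec (inf m Mm)).
Qed.

Section Hardness.
Variables (X : topologicalType) (b : nat -> nat -> X -> bool).
Hypothesis b_lc : forall m n, locally_constant (b m n).

(** With the maxima of the rows up to [m] as [m]-th row, one infinite row makes all the
    later ones infinite. *)
Let row (x : X) (m n : nat) : bool := [exists i : 'I_m.+1, b i n x].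

Lemma row_lc m n : locally_constant (fun x => row x m n).
Proof. by apply: locally_constant_exists => i; exact: b_lc. Qed.

Lemma coded_reduction : wadge_le
  [set x | forall m, exists n0, forall n, (n0 <= n)%N -> ~~ b m n x] (salem_sets R d).
Proof.
have /choice[f fE] : forall x, exists K : H, body K = coded (row x).
  by move=> x; apply: hyperspace_of; [exact: closed_coded|exact: coded_cube].
exists f.
  apply: vietoris_continuous => // x e e0; have [N hN] := small_inv e0.
  have near_rows : \forall x' \near x, forall p : 'I_N.+1 * 'I_N.+1,
      row x' p.1 p.2 = row x p.1 p.2.
    by apply: filter_forall => p; exact: row_lc.
  apply: filterS near_rows => x' rows; rewrite !fE.
  have agree m n : (m <= N)%N -> (n <= N)%N -> row x m n = row x' m n.
    move=> mN nN; apply: esym.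
    exact: rows (Ordinal (mN : (m < N.+1)%N), Ordinal (nN : (n < N.+1)%N)).
  split=> y.
    by move=> /(coded_uniform agree)[z zK yz]; exists z => //; exact: le_trans yz (ltW hN).
  have agree' m n : (m <= N)%N -> (n <= N)%N -> row x' m n = row x m n.
    by move=> mN nN; rewrite agree.
  by move=> /(coded_uniform agree')[z zK yz]; exists z => //; exact: le_trans yz (ltW hN).
move=> x /=; rewrite /salem_sets /= -/(body (f x)) fE; split=> [fin|sal].
  apply: coded_salem => m; elim: m => [|m [n1 h1]].
    have [n0 h] := fin 0%N; exists n0 => n nn; apply/existsP => -[j].
    by rewrite ord1; apply/negP; exact: h.
  have [n0 h] := fin m.+1; exists (maxn n0 n1) => n; rewrite geq_max => /andP[a c].
  apply/existsP => -[j bj]; have := ltn_ord j; rewrite ltnS leq_eqVlt => /predU1P[im|im].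
    by move: bj; rewrite im; apply/negP; exact: h.
  have /existsP := h1 n c; apply; exists (Ordinal im); exact: bj.
apply: contrapT => /existsNP[M nM]; apply: (@coded_not_salem (row x) M) sal => m Mm n0.
apply: contrapT => no; apply: nM; exists n0 => n n0n; apply/negP => bn; apply: no.
exists n => //; apply/existsP; have Mm' : (M < m.+1)%N by rewrite ltnS.
by exists (Ordinal Mm').
Qed.

End Hardness.

End Reduction.

Theorem theorem4p7 (R : realType) (d : nat) (hd : (1 <= d)%N) :
  pointclass_complete R (Pi0 3) (salem_sets R d).
Proof.
split; last exact: salem_Pi0.
move=> X polX basX A PA; have [b [b_lc bA]] := Pi0_3_bits polX basX PA.
have [f cf hf] := coded_reduction R hd b_lc.
by exists f => // x; rewrite -hf; exact: bA.
Qed.
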